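(* Let $A$ be a non-negative commutative DG ring such that $\mathrm{H}_0(A)$ is Noetherian, $\mathrm{H}(A)$ is finitely generated over $\mathrm{H}_0(A)$, and the underlying graded ring $A^\natural$ is Noetherian. For each $n\geq0$, each $X\in\mathsf{D}^f_b(A)$, and each full subcategory $\mathcal{G}\subseteq\mathsf{D}^f_b(A)$, the set $$\{\bar{\mathfrak{p}}\in\operatorname{Spec}(\mathrm{H}_0(A))\mid X_{\bar{\mathfrak{p}}}\in\mathsf{thick}^n_{\mathsf{D}^f_b(A_{\bar{\mathfrak{p}}})}(\mathcal{G}_{\bar{\mathfrak{p}}})\}$$ is open in $\operatorname{Spec}(\mathrm{H}_0(A))$.
   Context: DG rings are graded homologically (differential of degree $-1$). A DG ring is commutative if it is graded-commutative and $a^2=0$ for $a$ of odd degree; non-negative means $A_i=0$ for $i<0$. $\mathsf{D}(A)$ is the derived category of DG $A$-modules; $\mathsf{D}^f_b(A)$ is the full subcategory of those $X$ with $\mathrm{H}_i(X)=0$ for $|i|\gg0$ and every $\mathrm{H}_i(X)$ finitely generated over $\mathrm{H}_0(A)$. For $\bar{\mathfrak{p}}\in\operatorname{Spec}(\mathrm{H}_0(A))$ let $\mathfrak{p}=\pi^{-1}(\bar{\mathfrak{p}})$ with $\pi\colon A_0\to\mathrm{H}_0(A)$ canonical; $A_{\bar{\mathfrak{p}}}=A\otimes_{A_0}(A_0)_{\mathfrak{p}}$, $X_{\bar{\mathfrak{p}}}=X\otimes_{A_0}(A_0)_{\mathfrak{p}}$, and $\mathcal{G}_{\bar{\mathfrak{p}}}=\{G_{\bar{\mathfrak{p}}}\mid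 G\in\mathcal{G}\}$ as a full subcategory of $\mathsf{D}^f_b(A_{\bar{\mathfrak{p}}})$. For a full subcategory $\mathcal{G}$ of a triangulated category $\mathcal{S}$: $\mathsf{thick}^0_{\mathcal{S}}(\mathcal{G})=\{0\}$; $\mathsf{thick}^1_{\mathcal{S}}(\mathcal{G})$ is the smallest full subcategory containing $\mathcal{G}$ and closed under finite direct sums, direct summands and suspensions ($\Sigma^i$, $i\in\mathbb{Z}$); for $n\ge2$, $\mathsf{thick}^n_{\mathcal{S}}(\mathcal{G})$ consists of those $X$ that appear in an exact triangle $X_1\to X\oplus X'\to X_2\to\Sigma X_1$ with $X_1\in\mathsf{thick}^1_{\mathcal{S}}(\mathcal{G})$, $X_2\in\mathsf{thick}^{n-1}_{\mathcal{S}}(\mathcal{G})$. *)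

(* Defs.v *)
From HB Require Import structures.
From mathcomp Require Import all_boot all_order all_algebra.
From mathcomp Require Import zify ring.
From mathcomp Require Import all_classical.
From mathcomp Require Import topology.

Set Implicit Arguments.
Unset Strict Implicit.
Unset Printing Implicit Defensive.

Import GRing.Theory.
Local Open Scope classical_set_scope.
Local Open Scope ring_scope.
Local Open Scope quotient_scope.

Record is_ideal (R : comPzRingType) (I : set R) : Prop := IsIdeal {
  ideal0 : I 0;
  idealD : forall x y, I x -> I y -> I (x + y);
  idealM : forall a x, I x -> I (a * x) }.

Definition noetherian (R : comPzRingType) : Prop :=
  forall I : set R, is_ideal I ->
  exists (n : nat) (g : 'I_n -> R),
    I = [set x | exists c : 'I_n -> R, x = \sum_(k < n) c k * g k].

Definition fin_gen (R : pzRingType) (M : lmodType R) : Prop :=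
  exists (n : nat) (g : 'I_n -> M),
    forall x : M, exists c : 'I_n -> R, x = \sum_(k < n) c k *: g k.

Record spec (R : comPzRingType) := Spec {
  prime_set :> set R;
  prime_ideal : is_ideal prime_set;
  prime_proper : ~ prime_set 1;
  prime_mul : forall x y, prime_set (x * y) -> prime_set x \/ prime_set y }.

HB.instance Definition _ (R : comPzRingType) := gen_eqMixin (spec R).
HB.instance Definition _ (R : comPzRingType) := gen_choiceMixin (spec R).

Section Zariski.
Variable R : comPzRingType.

Definition zariski_open (U : set (spec R)) : Prop :=
  exists E : set R, U = [set p | ~ (E `<=` p)].

Lemma zariski_openT : zariski_open setT.
Proof.
exists [set 1]; apply/seteqP; split=> // p _ /= h.
by apply: (@prime_proper _ p); apply: h.
Qed.

Lemma zariski_openI : setI_closed zariski_open.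
Proof.
move=> _ _ [E ->] [F ->].
exists [set x | exists2 a, E a & exists2 b, F b & x = a * b].
apply/seteqP; split=> p /=.
  case=> nE nF h.
  have [a /not_implyP[Ea npa]] : exists a, ~ (E a -> prime_set p a) by apply/existsNP.
  have [b /not_implyP[Fb npb]] : exists b, ~ (F b -> prime_set p b) by apply/existsNP.
  have : prime_set p (a * b) by apply: h; exists a => //; exists b.
  by case/prime_mul.
move=> h; split=> hE; apply: h => _ [a Ea [b Fb ->]].
  by rewrite mulrC; apply: idealM; [exact: prime_ideal | exact: hE].
by apply: idealM; [exact: prime_ideal | exact: hE].
Qed.

Lemma zariski_open_bigU (I : Type) (f : I -> set (spec R)) :
  (forall i, zariski_open (f i)) -> zariski_open (\bigcup_i f i).
Proof.
move=> /choice[E fE]; exists (\bigcup_i E i).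
apply/seteqP; split=> p /=.
  by case=> i _; rewrite fE => /= h h'; apply: h => x Ex; apply: h'; exists i.
move=> h; apply: contrapT => h'; apply: h => x [i _ Ex].
by apply: contrapT => npx; apply: h'; exists i => //; rewrite fE => /= /(_ _ Ex).
Qed.

HB.instance Definition _ := isOpenTopological.Build (spec R)
  zariski_openT zariski_openI zariski_open_bigU.

Lemma open_spec : open = zariski_open.
Proof. by []. Qed.

End Zariski.

Record multset (R : comPzRingType) := Multset {
  mset :> set R;
  mset1 : mset 1;
  msetM : forall s t, mset s -> mset t -> mset (s * t) }.

Section Localization.
Variables (R : comPzRingType) (S : multset R).

Definition den (s : set_type S) : R := val s.
Lemma denP s : mset S (den s). Proof. exact: set_mem (valP s). Qed.

Definition den1 : set_type S := exist _ 1 (mem_set (mset1 S)).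
Definition denM (s t : set_type S) : set_type S :=
  exist _ (den s * den t) (mem_set (msetM (denP s) (denP t))).

Lemma denMC s t : denM s t = denM t s.
Proof. by apply: val_inj; rewrite /= /den mulrC. Qed.
Lemma denMA s t u : denM s (denM t u) = denM (denM s t) u.
Proof. by apply: val_inj; rewrite /= /den mulrA. Qed.
Lemma den1M s : denM den1 s = s.
Proof. by apply: val_inj; rewrite /= mul1r. Qed.

Lemma den_denM s t : den (denM s t) = den s * den t. Proof. by []. Qed.
Lemma den_den1 : den den1 = 1. Proof. by []. Qed.

Section Module.
Variable M : lmodType R.

Definition loc_rel (x y : M * set_type S) : bool :=
  `[< exists2 u, mset S u & u *: (den y.2 *: x.1) = u *: (den x.2 *: y.1) >].

Lemma loc_rel_is_equiv : equiv_class_of loc_rel.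
Proof.
split=> [x|x y|y x z]; rewrite /loc_rel.
- by apply/asboolP; exists 1 => //; exact: mset1.
- by apply/asboolP/asboolP => -[u Su e]; exists u.
- move=> /asboolP[u Su e] /asboolP[v Sv e']; apply/asboolP.
  exists (u * v * den y.2).
    by apply: msetM; [exact: msetM | exact: denP].
  rewrite !scalerA in e e' *.
  have -> : u * v * den y.2 * den z.2 = (v * den z.2) * (u * den y.2) by ring.
  have -> : u * v * den y.2 * den x.2 = (u * den x.2) * (v * den y.2) by ring.
  by rewrite -scalerA e scalerA [_ * (u * _)]mulrC -[RHS]scalerA -e' scalerA.
Qed.

Canonical loc_equiv := EquivRelPack loc_rel_is_equiv.
Canonical loc_encModRel := defaultEncModRel loc_rel.

Definition loc := {eq_quot loc_rel}.
HB.instance Definition _ := EqQuotient.on loc.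
HB.instance Definition _ := Choice.on loc.

Definition frac (x : M) (s : set_type S) : loc := \pi_loc (x, s).

Lemma frac_eq x s y t : frac x s = frac y t <->
  exists2 u, mset S u & u *: (den t *: x) = u *: (den s *: y).
Proof.
by split=> [/eqmodP/asboolP|h] //; apply/eqmodP/asboolP.
Qed.

Lemma frac_eq1 x s y t : den t *: x = den s *: y -> frac x s = frac y t.
Proof. by move=> h; apply/frac_eq; exists 1; [exact: mset1 | rewrite h]. Qed.

Lemma fracP (z : loc) : exists x s, z = frac x s.
Proof. by exists (repr z).1, (repr z).2; rewrite /frac -surjective_pairing reprK. Qed.

Lemma frac_repr (x : M) s : exists2 u, mset S u &
  u *: (den s *: (repr (frac x s)).1) = u *: (den (repr (frac x s)).2 *: x).
Proof.
by apply/frac_eq; rewrite /frac -surjective_pairing reprK.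
Qed.

Definition loc_add (z w : loc) : loc :=
  let x := repr z in let y := repr w in
  frac (den y.2 *: x.1 + den x.2 *: y.1) (denM x.2 y.2).
Definition loc_opp (z : loc) : loc := let x := repr z in frac (- x.1) x.2.
Definition loc0 : loc := frac 0 den1.

Lemma loc_addE x s y t :
  loc_add (frac x s) (frac y t) = frac (den t *: x + den s *: y) (denM s t).
Proof.
rewrite /loc_add; apply/frac_eq.
have [u Su] := frac_repr x s; have [v Sv] := frac_repr y t.
case: (repr (frac x s)) (repr (frac y t)) => [x' s'] [y' t'] /= e' e.
exists (u * v); first exact: msetM.
rewrite !den_denM !scalerDr !scalerA in e e' *; congr (_ + _).
- have -> : u * v * (den s * den t) * den t' = (v * den t * den t') * (u * den s) by ring.
  by rewrite -scalerA e scalerA; congr (_ *: _); ring.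
- have -> : u * v * (den s * den t) * den s' = (u * den s * den s') * (v * den t) by ring.
  by rewrite -scalerA e' scalerA; congr (_ *: _); ring.
Qed.

Lemma loc_oppE x s : loc_opp (frac x s) = frac (- x) s.
Proof.
rewrite /loc_opp; apply/frac_eq; have [u Su e] := frac_repr x s.
by exists u => //; rewrite !scalerN e.
Qed.

Lemma loc_addA : associative loc_add.
Proof.
move=> a b c; have [x [s ->]] := fracP a; have [y [t ->]] := fracP b.
have [z [u ->]] := fracP c; rewrite !loc_addE denMA; congr frac.
by rewrite !den_denM !scalerDr !scalerA addrA [den u * _]mulrC [den u * _]mulrC.
Qed.

Lemma loc_addC : commutative loc_add.
Proof.
move=> a b; have [x [s ->]] := fracP a; have [y [t ->]] := fracP b.
by rewrite !loc_addE addrC denMC.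
Qed.

Lemma loc_add0 : left_id loc0 loc_add.
Proof.
move=> a; have [x [s ->]] := fracP a.
by rewrite loc_addE den1M scaler0 add0r den_den1 scale1r.
Qed.

Lemma loc_addN : left_inverse loc0 loc_opp loc_add.
Proof.
move=> a; have [x [s ->]] := fracP a.
by rewrite loc_oppE loc_addE scalerN addNr; apply: frac_eq1; rewrite !scaler0.
Qed.

HB.instance Definition _ :=
  GRing.isZmodule.Build loc loc_addA loc_addC loc_add0 loc_addN.

Lemma fracD x s y t :
  frac x s + frac y t = frac (den t *: x + den s *: y) (denM s t).
Proof. exact: loc_addE. Qed.

Lemma fracDr x y s : frac (x + y) s = frac x s + frac y s.
Proof.
by rewrite fracD; apply: frac_eq1; rewrite den_denM -scalerDr scalerA.
Qed.

Lemma fracN x s : - frac x s = frac (- x) s.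
Proof. exact: loc_oppE. Qed.

Lemma frac0 s : frac 0 s = 0.
Proof. by apply: frac_eq1; rewrite !scaler0. Qed.

Lemma frac_mul x s t : frac x s = frac (den t *: x) (denM t s).
Proof. by apply: frac_eq1; rewrite den_denM scalerA mulrC. Qed.

Lemma loc_common (z w : loc) : exists x y s, z = frac x s /\ w = frac y s.
Proof.
have [x [s ->]] := fracP z; have [y [t ->]] := fracP w.
exists (den t *: x), (den s *: y), (denM s t); split; last exact: frac_mul.
by rewrite denMC; exact: frac_mul.
Qed.

End Module.

Definition loc_map (M N : lmodType R) (f : M -> N) (z : loc M) : loc N :=
  frac (f (repr z).1) (repr z).2.

Lemma loc_mapE (M N : lmodType R) (f : M -> N) :
  scalable f -> forall x s, loc_map f (frac x s) = frac (f x) s.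
Proof.
move=> fZ x s; apply/frac_eq; have [u Su e] := frac_repr x s.
by exists u => //; rewrite -!fZ e.
Qed.

Definition loc_bil (M N P : lmodType R) (b : M -> N -> P)
    (z : loc M) (w : loc N) : loc P :=
  frac (b (repr z).1 (repr w).1) (denM (repr z).2 (repr w).2).

Lemma loc_bilE (M N P : lmodType R) (b : M -> N -> P) :
  (forall y, scalable (b^~ y)) -> (forall x, scalable (b x)) ->
  forall x s y t, loc_bil b (frac x s) (frac y t) = frac (b x y) (denM s t).
Proof.
move=> bZl bZr x s y t; apply/frac_eq.
have [u Su] := frac_repr x s; have [v Sv] := frac_repr y t.
case: (repr (frac x s)) (repr (frac y t)) => [x' s'] [y' t'] /= e' e.
exists (u * v); first exact: msetM.
rewrite !den_denM !scalerA in e e' *.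
transitivity (b ((u * den s) *: x') ((v * den t) *: y')).
  by rewrite bZl bZr scalerA; congr (_ *: _); ring.
by rewrite e e' bZl bZr scalerA; congr (_ *: _); ring.
Qed.

(* loc M has the universal property of M (x)_R S^{-1}R; here R^o is R as a
   module over itself, so loc R^o is S^{-1}R. *)
Lemma loc_tensor_universal (M : lmodType R) (P : zmodType) (b : M -> loc R^o -> P) :
  (forall z, {morph b^~ z : x y / x + y}) ->
  (forall x, {morph b x : z w / z + w}) ->
  (forall a x (r : R) s,
    b (a *: x) (frac (r : R^o) s) = b x (frac (a * r : R^o) s)) ->
  exists! g : loc M -> P, {morph g : z w / z + w} /\
    forall x (r : R) s, g (frac (r *: x) s) = b x (frac (r : R^o) s).
Proof.
move=> bDl bDr bZ.
pose g (z : loc M) := b (repr z).1 (frac (1 : R^o) (repr z).2).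
have gE x s : g (frac x s) = b x (frac (1 : R^o) s).
  rewrite /g; have [u Su] := frac_repr x s.
  case: (repr (frac x s)) => x' s' /= e.
  pose v : set_type S := exist _ u (mem_set Su).
  have dv : den v = u by [].
  have -> : frac (1 : R^o) s' =
      frac (u * den s * 1 : R^o) (denM (denM v s) s').
    apply: frac_eq1; rewrite !den_denM /GRing.scale /= !mulr1.
    by rewrite dv mulrC.
  rewrite -bZ -scalerA e scalerA bZ; congr (b x _).
  apply: frac_eq1; rewrite !den_denM /GRing.scale /= dv; ring.
exists g; split=> [|g' [g'D g'E]]; last first.
  apply/funext => z; have [x [s ->]] := fracP z.
  by rewrite gE -g'E scale1r.
split=> [z w|x r s]; last by rewrite gE bZ mulr1.
have [x [y [s [-> ->]]]] := loc_common z w.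
by rewrite -fracDr !gE bDl.
Qed.

End Localization.

Section KoszulSign.
Variable V : zmodType.
Implicit Types (i j : int) (x y : V).

(* (-1)^i x *)
Definition ksign i x : V := if odd (absz i) then - x else x.

Lemma ksignD i x y : ksign i (x + y) = ksign i x + ksign i y.
Proof. by rewrite /ksign; case: ifP => // _; rewrite opprD. Qed.
Lemma ksignN i x : ksign i (- x) = - ksign i x.
Proof. by rewrite /ksign; case: ifP. Qed.
Lemma ksign0 i : ksign i 0 = 0.
Proof. by rewrite /ksign; case: ifP; rewrite ?oppr0. Qed.
Lemma ksign_add i j x : ksign i (ksign j x) = ksign (i + j) x.
Proof.
rewrite /ksign; have -> : odd (absz (i + j)) = odd (absz i) (+) odd (absz j) by lia.
by do 2![case: odd => //=]; rewrite opprK.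
Qed.
Lemma ksign_congr i j x : odd (absz i) = odd (absz j) -> ksign i x = ksign j x.
Proof. by rewrite /ksign => ->. Qed.
Lemma ksign_even i x : ~~ odd (absz i) -> ksign i x = x.
Proof. by rewrite /ksign => /negbTE ->. Qed.
End KoszulSign.

Lemma ksign_map (V W : zmodType) (f : V -> W) i x :
  (forall y, f (- y) = - f y) -> f (ksign i x) = ksign i (f x).
Proof. by move=> fN; rewrite /ksign; case: ifP. Qed.

Lemma oddzM (i j : int) : odd (absz (i * j)) = odd (absz i) && odd (absz j).
Proof. by rewrite abszM oddM. Qed.

Lemma add_map0 (V W : zmodType) (f : V -> W) :
  {morph f : x y / x + y} -> f 0 = 0.
Proof. by move=> fD; apply: (addrI (f 0)); rewrite -fD !addr0. Qed.

Lemma add_mapN (V W : zmodType) (f : V -> W) :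
  {morph f : x y / x + y} -> {morph f : x / - x}.
Proof.
by move=> fD x; apply: (addIr (f x)); rewrite -fD !addNr (add_map0 fD).
Qed.

(* Non-negative commutative DG rings, homologically graded. Every structure map
   takes a proof of the equation between its degrees as argument: this way the
   axioms need no transport along equalities of degrees. *)
Record dgring := DGRing {
  rg :> int -> zmodType;
  rmul : forall i j k, i + j = k -> rg i -> rg j -> rg k;
  rone : rg 0;
  rdif : forall i j, j + 1 = i -> rg i -> rg j;
  rmulDl : forall i j k (e : i + j = k) a b c,
    rmul e (a + b) c = rmul e a c + rmul e b c;
  rmulDr : forall i j k (e : i + j = k) a b c,
    rmul e a (b + c) = rmul e a b + rmul e a c;
  rmulA : forall i j k ij jk l (e1 : i + j = ij) (e2 : ij + k = l)
      (e3 : j + k = jk) (e4 : i + jk = l) a b c,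
    rmul e2 (rmul e1 a b) c = rmul e4 a (rmul e3 b c);
  rmul1 : forall i (e : 0 + i = i) a, rmul e rone a = a;
  rmulC : forall i j k (e : i + j = k) (e' : j + i = k) a b,
    rmul e a b = ksign (i * j) (rmul e' b a);
  rmul_odd : forall i k (e : i + i = k) a, odd (absz i) -> rmul e a a = 0;
  rdifD : forall i j (e : j + 1 = i) a b, rdif e (a + b) = rdif e a + rdif e b;
  rdif_dif : forall i j k (e : j + 1 = i) (e' : k + 1 = j) a,
    rdif e' (rdif e a) = 0;
  rleibniz : forall i j k i' j' k' (e : i + j = k) (ei : i' + 1 = i)
      (ej : j' + 1 = j) (ek : k' + 1 = k) (e1 : i' + j = k') (e2 : i + j' = k')
      a b,
    rdif ek (rmul e a b) =
      rmul e1 (rdif ei a) b + ksign i (rmul e2 a (rdif ej b));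
  rnonneg : forall i, i < 0 -> forall a : rg i, a = 0 }.

Record dgmod (A : dgring) := DGMod {
  md :> int -> zmodType;
  act : forall i j k, i + j = k -> A i -> md j -> md k;
  dif : forall i j, j + 1 = i -> md i -> md j;
  actDl : forall i j k (e : i + j = k) a b x,
    act e (a + b) x = act e a x + act e b x;
  actDr : forall i j k (e : i + j = k) a x y,
    act e a (x + y) = act e a x + act e a y;
  actA : forall i j k ij jk l (e1 : i + j = ij) (e2 : ij + k = l)
      (e3 : j + k = jk) (e4 : i + jk = l) a b x,
    act e2 (rmul e1 a b) x = act e4 a (act e3 b x);
  act1 : forall i (e : 0 + i = i) x, act e (rone A) x = x;
  difD : forall i j (e : j + 1 = i) x y, dif e (x + y) = dif e x + dif e y;
  dif_dif : forall i j k (e : j + 1 = i) (e' : k + 1 = j) x,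
    dif e' (dif e x) = 0;
  leibniz : forall i j k i' j' k' (e : i + j = k) (ei : i' + 1 = i)
      (ej : j' + 1 = j) (ek : k' + 1 = k) (e1 : i' + j = k') (e2 : i + j' = k')
      a x,
    dif ek (act e a x) =
      act e1 (rdif ei a) x + ksign i (act e2 a (dif ej x)) }.

Section DGModTheory.
Variables (A : dgring) (X : dgmod A).

Lemma rdif0 i j (e : j + 1 = i) : rdif e (0 : A i) = 0.
Proof. exact: (add_map0 (rdifD e)). Qed.
Lemma rdifN i j (e : j + 1 = i) (a : A i) : rdif e (- a) = - rdif e a.
Proof. exact: (add_mapN (rdifD e)). Qed.
Lemma act0r i j k (e : i + j = k) (a : A i) : act e a (0 : X j) = 0.
Proof. exact: (add_map0 (actDr e a)). Qed.
Lemma actNr i j k (e : i + j = k) (a : A i) (x : X j) : act e a (- x) = - act e a x.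
Proof. exact: (add_mapN (actDr e a)). Qed.
Lemma act0l i j k (e : i + j = k) (x : X j) : act e (0 : A i) x = 0.
Proof. by apply: (@add_map0 _ _ ((act e)^~ x)) => a b; exact: actDl. Qed.
Lemma actNl i j k (e : i + j = k) (a : A i) (x : X j) : act e (- a) x = - act e a x.
Proof. by apply: (@add_mapN _ _ ((act e)^~ x)) => b c; exact: actDl. Qed.
Lemma dif0 i j (e : j + 1 = i) : dif e (0 : X i) = 0.
Proof. exact: (add_map0 (difD e)). Qed.
Lemma difN i j (e : j + 1 = i) (x : X i) : dif e (- x) = - dif e x.
Proof. exact: (add_mapN (difD e)). Qed.

(* d vanishes on A_0 since A_{-1} = 0 *)
Lemma rdif_deg0 j (e : j + 1 = 0) (a : A 0) : rdif e a = 0.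
Proof. by apply: rnonneg; lia. Qed.

Lemma dif_act0 i j (ei : 0 + i = i) (ej : 0 + j = j) (e : j + 1 = i) a (x : X i) :
  dif e (act ei a x) = act ej a (dif e x).
Proof.
have e1 : - 1 + 1 = 0 :> int by lia.
have e2 : - 1 + i = j by lia.
by rewrite (leibniz ei e1 e e e2 ej) rdif_deg0 act0l add0r.
Qed.
End DGModTheory.

Definition dgself (A : dgring) : dgmod A :=
  @DGMod A A (@rmul A) (@rdif A) (@rmulDl A) (@rmulDr A) (@rmulA A) (@rmul1 A)
    (@rdifD A) (@rdif_dif A) (@rleibniz A).

Definition ring0 (A : dgring) : Type := A 0.

Section Ring0.
Variable A : dgring.
HB.instance Definition _ := GRing.Zmodule.on (ring0 A).

Definition mul0 (a b : ring0 A) : ring0 A := rmul (addr0 0) a b.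

Lemma mul0A : associative mul0.
Proof. by move=> a b c; rewrite /mul0; apply/esym/rmulA. Qed.
Lemma mul0C : commutative mul0.
Proof. by move=> a b; rewrite /mul0 (rmulC _ (addr0 0)) ksign_even. Qed.
Lemma mul01 : left_id (rone A : ring0 A) mul0.
Proof. by move=> a; exact: rmul1. Qed.
Lemma mul0Dl : left_distributive mul0 +%R.
Proof. by move=> a b c; exact: rmulDl. Qed.

HB.instance Definition _ :=
  GRing.Zmodule_isComPzRing.Build (ring0 A) mul0A mul0C mul01 mul0Dl.

Lemma ring0M (a b : ring0 A) (e : 0 + 0 = 0) : a * b = rmul e a b.
Proof. by rewrite (eq_irrelevance e (addr0 0)). Qed.
End Ring0.

Definition mod0 (A : dgring) (X : dgmod A) (i : int) : Type := X i.

Section Mod0.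
Variables (A : dgring) (X : dgmod A) (i : int).
HB.instance Definition _ := GRing.Zmodule.on (mod0 X i).

Definition scale0 (a : ring0 A) (x : mod0 X i) : mod0 X i := act (add0r i) a x.

Lemma scale0A a b x : scale0 a (scale0 b x) = scale0 (a * b) x.
Proof. by apply/esym/actA. Qed.
Lemma scale01 : left_id 1 scale0.
Proof. by move=> x; exact: act1. Qed.
Lemma scale0Dr : right_distributive scale0 +%R.
Proof. by move=> a x y; exact: actDr. Qed.
Lemma scale0Dl x : {morph scale0^~ x : a b / a + b}.
Proof. by move=> a b; exact: actDl. Qed.

HB.instance Definition _ := GRing.Zmodule_isLmodule.Build (ring0 A) (mod0 X i)
  scale0A scale01 scale0Dr scale0Dl.

Lemma scale0E (a : ring0 A) (x : mod0 X i) (e : 0 + i = i) : a *: x = act e a x.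
Proof. by rewrite (eq_irrelevance e (add0r i)). Qed.
End Mod0.

(* H_0(A) = A_0 / d(A_1): every element of A_0 is a cycle since A_{-1} = 0 *)
Section H0.
Variable A : dgring.

Definition bnd0 (a : ring0 A) : bool := `[< exists b : A 1, a = rdif (add0r 1) b >].

Lemma bnd0_zmod : zmod_closed bnd0.
Proof.
split=> [|a b /asboolP[a' ->] /asboolP[b' ->]]; apply/asboolP.
  by exists 0; rewrite rdif0.
by exists (a' - b'); rewrite rdifD rdifN.
Qed.
HB.instance Definition _ := GRing.isZmodClosed.Build (ring0 A) bnd0 bnd0_zmod.

Lemma bnd0D a b : bnd0 a -> bnd0 b -> bnd0 (a + b).
Proof.
move=> /asboolP[a' ->] /asboolP[b' ->]; apply/asboolP.
by exists (a' + b'); rewrite rdifD.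
Qed.

Lemma bnd0_ideal a b : bnd0 b -> bnd0 (a * b).
Proof.
move=> /asboolP[c ->]; apply/asboolP; exists (rmul (add0r 1) a c).
by rewrite (ring0M _ _ (add0r 0)); apply/esym/(@dif_act0 A (dgself A) 1 0).
Qed.

Definition H0 := Quotient.quot (GRing.ZmodClosed.clone (ring0 A) bnd0 _).
HB.instance Definition _ := GRing.Zmodule.on H0.

Definition pi0 (a : ring0 A) : H0 := \pi_H0 a.

Lemma pi0_eq a b : pi0 a = pi0 b <-> bnd0 (a - b).
Proof.
by rewrite /pi0; split=> [/eqP|h]; [|apply/eqP]; rewrite -Quotient.idealrBE.
Qed.
Lemma pi0_repr c : pi0 (repr c) = c. Proof. exact: reprK. Qed.
Lemma pi0D : {morph pi0 : a b / a + b}.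
Proof. by move=> a b; rewrite /pi0 !piE. Qed.

Definition H0_mul (c d : H0) : H0 := pi0 (repr c * repr d).

Lemma H0_mulE a b : H0_mul (pi0 a) (pi0 b) = pi0 (a * b).
Proof.
apply/pi0_eq.
set a' := repr _; set b' := repr _.
have /pi0_eq ha : pi0 a' = pi0 a by rewrite pi0_repr.
have /pi0_eq hb : pi0 b' = pi0 b by rewrite pi0_repr.
have -> : a' * b' - a * b = b' * (a' - a) + a * (b' - b) by ring.
by apply: bnd0D; exact: bnd0_ideal.
Qed.

Lemma H0_mulA : associative H0_mul.
Proof.
move=> a b c; rewrite -(pi0_repr a) -(pi0_repr b) -(pi0_repr c).
by rewrite !H0_mulE mulrA.
Qed.
Lemma H0_mulC : commutative H0_mul.
Proof.
by move=> a b; rewrite -(pi0_repr a) -(pi0_repr b) !H0_mulE mulrC.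
Qed.
Lemma H0_mul1 : left_id (pi0 1) H0_mul.
Proof. by move=> a; rewrite -(pi0_repr a) !H0_mulE mul1r. Qed.
Lemma H0_mulDl : left_distributive H0_mul +%R.
Proof.
move=> a b c; rewrite -(pi0_repr a) -(pi0_repr b) -(pi0_repr c).
by rewrite -pi0D !H0_mulE mulrDl pi0D.
Qed.

HB.instance Definition _ :=
  GRing.Zmodule_isComPzRing.Build H0 H0_mulA H0_mulC H0_mul1 H0_mulDl.

Lemma pi0M : {morph pi0 : a b / a * b}.
Proof. by move=> a b; rewrite -H0_mulE. Qed.
Lemma pi01 : pi0 1 = 1. Proof. by []. Qed.
End H0.

Section Homology.
Variables (A : dgring) (X : dgmod A) (i : int).

Definition cyc (x : X i) : bool := `[< forall j (e : j + 1 = i), dif e x = 0 >].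

Lemma cyc_zmod : zmod_closed cyc.
Proof.
split=> [|x y /asboolP hx /asboolP hy]; apply/asboolP => j e; first exact: dif0.
by rewrite difD difN hx hy subrr.
Qed.
HB.instance Definition _ := GRing.isZmodClosed.Build (X i) cyc cyc_zmod.

Record cycle := Cycle { cycle_val :> X i; cycleP : cyc cycle_val }.
HB.instance Definition _ := [isSub for cycle_val].
HB.instance Definition _ := [Choice of cycle by <:].
HB.instance Definition _ := [SubChoice_isSubZmodule of cycle by <:].

Definition bnd (z : cycle) : bool :=
  `[< exists j (e : i + 1 = j) (y : X j), cycle_val z = dif e y >].

Lemma bnd_zmod : zmod_closed bnd.
Proof.
split=> [|x y /asboolP[j [e [x' hx]]] /asboolP[k [e' [y' hy]]]]; apply/asboolP.
  by exists (i + 1), erefl, 0; rewrite dif0.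
subst j k; exists (i + 1), erefl, (x' - y').
by rewrite difD difN /= hx hy.
Qed.

Lemma bndD z w : bnd z -> bnd w -> bnd (z + w).
Proof.
move=> hz hw; have -> : z + w = z - (0 - w) by rewrite sub0r opprK.
by have [h0 hB] := bnd_zmod; apply: (hB _ _ hz); apply: (hB _ _ h0).
Qed.
HB.instance Definition _ := GRing.isZmodClosed.Build cycle bnd bnd_zmod.

Definition homology := Quotient.quot (GRing.ZmodClosed.clone cycle bnd _).
HB.instance Definition _ := GRing.Zmodule.on homology.

Definition hclass (z : cycle) : homology := \pi_homology z.

Lemma hclass_eq z w : hclass z = hclass w <-> bnd (z - w).
Proof.
by rewrite /hclass; split=> [/eqP|h]; [|apply/eqP]; rewrite -Quotient.idealrBE.
Qed.
Lemma hclass_repr h : hclass (repr h) = h. Proof. exact: reprK. Qed.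
Lemma hclassD : {morph hclass : z w / z + w}.
Proof. by move=> z w; rewrite /hclass !piE. Qed.

Lemma act0_cyc (a : ring0 A) (z : cycle) : cyc (act (add0r i) a (cycle_val z)).
Proof.
apply/asboolP => j e; rewrite (dif_act0 _ (add0r j)).
by have /asboolP -> := cycleP z; rewrite act0r.
Qed.
Definition cyc_scale (a : ring0 A) (z : cycle) : cycle := Cycle (act0_cyc a z).

Lemma bnd_scale a z : bnd z -> bnd (cyc_scale a z).
Proof.
move=> /asboolP[j [e [y hy]]]; apply/asboolP; exists j, e, (act (add0r j) a y).
by rewrite (dif_act0 _ (add0r i)) /= hy.
Qed.

Lemma bnd_scale0 a z : bnd0 a -> bnd (cyc_scale a z).
Proof.
move=> /asboolP[b ->]; apply/asboolP; exists (i + 1), erefl.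
exists (act (addrC 1 i) b (cycle_val z)) => /=.
have e : i - 1 + 1 = i by lia.
have e2 : 1 + (i - 1) = i by lia.
rewrite (leibniz (addrC 1 i) (add0r 1) e erefl (add0r i) e2).
by have /asboolP -> := cycleP z; rewrite act0r ksign0 addr0.
Qed.

Definition H_scale (c : H0 A) (h : homology) : homology := hclass (cyc_scale (repr c) (repr h)).

Lemma H_scaleE a z : H_scale (pi0 a) (hclass z) = hclass (cyc_scale a z).
Proof.
apply/hclass_eq; set a' := repr _; set z' := repr _.
have /pi0_eq ha : pi0 a' = pi0 a by rewrite pi0_repr.
have /hclass_eq hz : hclass z' = hclass z by rewrite hclass_repr.
have -> : cyc_scale a' z' - cyc_scale a z =
    cyc_scale (a' - a) z' + cyc_scale a (z' - z).
  by apply: val_inj; rewrite /= actDl actNl actDr actNr addrA subrK.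
by apply: bndD; [exact: bnd_scale0 | exact: bnd_scale].
Qed.

Lemma H_scaleA c d h : H_scale c (H_scale d h) = H_scale (c * d) h.
Proof.
rewrite -(pi0_repr c) -(pi0_repr d) -(hclass_repr h) -pi0M !H_scaleE.
by congr hclass; apply: val_inj; apply/esym/actA.
Qed.
Lemma H_scale1 : left_id 1 H_scale.
Proof.
move=> h; rewrite -(hclass_repr h) -pi01 H_scaleE; congr hclass.
by apply: val_inj; exact: act1.
Qed.
Lemma H_scaleDr : right_distributive H_scale +%R.
Proof.
move=> c h k; rewrite -(pi0_repr c) -(hclass_repr h) -(hclass_repr k) -hclassD.
by rewrite !H_scaleE -hclassD; congr hclass; apply: val_inj; exact: actDr.
Qed.
Lemma H_scaleDl h : {morph H_scale^~ h : c d / c + d}.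
Proof.
move=> c d; rewrite -(pi0_repr c) -(pi0_repr d) -(hclass_repr h) -pi0D.
by rewrite !H_scaleE -hclassD; congr hclass; apply: val_inj; exact: actDl.
Qed.

HB.instance Definition _ := GRing.Zmodule_isLmodule.Build (H0 A) homology
  H_scaleA H_scale1 H_scaleDr H_scaleDl.

Lemma pi0_scale (a : ring0 A) z : pi0 a *: hclass z = hclass (cyc_scale a z).
Proof. exact: H_scaleE. Qed.
End Homology.

(* the degree-i component of a homogeneous element of degree j *)
Definition homog (M : int -> zmodType) (i j : int) (x : M j) : M i :=
  if j =P i is ReflectT e then ecast k (M k) e x else 0.

Definition gr_fin_gen (R : pzRingType) (M : int -> lmodType R) : Prop :=
  exists (n : nat) (deg : 'I_n -> int) (g : forall k, M (deg k)),
    forall i (x : M i), exists c : 'I_n -> R,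
      x = \sum_(k < n) c k *: homog (M := M) i (g k).

Record gr_ideal (A : dgring) (I : forall i, set (A i)) : Prop := GrIdeal {
  gr_ideal0 : forall i, I i 0;
  gr_idealD : forall i x y, I i x -> I i y -> I i (x + y);
  gr_idealM : forall i j k (e : i + j = k) a x, I j x -> I k (rmul e a x) }.

(* The underlying graded ring is Noetherian: every homogeneous ideal is generated
   by finitely many homogeneous elements (left, right and two-sided homogeneous
   ideals agree by graded commutativity). *)
Definition gr_noetherian (A : dgring) : Prop :=
  forall I : forall i, set (A i), gr_ideal I ->
  exists (n : nat) (deg : 'I_n -> int) (g : forall k, A (deg k)),
    forall i, I i = [set x | exists c : forall k, A (i - deg k),
      x = \sum_(k < n) rmul (subrK (deg k) i) (c k) (g k)].

(* A (x)_{A_0} S^{-1}A_0 and X (x)_{A_0} S^{-1}A_0, realised degreewise as modules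
   of fractions over A_0. *)
Section DGLocalization.
Variables (A : dgring) (S : multset (ring0 A)).

Section LocModule.
Variable X : dgmod A.

Definition lcomp (i : int) : zmodType := loc S (mod0 X i).

Definition lact i j k (e : i + j = k) :
    loc S (mod0 (dgself A) i) -> lcomp j -> lcomp k :=
  loc_bil (S := S) (M := mod0 (dgself A) i) (N := mod0 X j) (P := mod0 X k)
    (act e).

Definition ldif i j (e : j + 1 = i) : lcomp i -> lcomp j :=
  loc_map (S := S) (M := mod0 X i) (N := mod0 X j) (dif e).

Lemma act_scale0l i j k (e : i + j = k) (y : mod0 X j) :
  scalable ((fun a => act e a y) : mod0 (dgself A) i -> mod0 X k).
Proof. by move=> r a; exact: actA. Qed.

Lemma act_scale0r i j k (e : i + j = k) (a : A i) :
  scalable (act e a : mod0 X j -> mod0 X k).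
Proof.
move=> r x; have e' : i + 0 = i by lia.
apply: (etrans (esym (actA e' e (add0r j) e a r x))).
rewrite (rmulC _ (add0r i)) mulr0 ksign_even //.
exact: actA.
Qed.

Lemma dif_scale0 i j (e : j + 1 = i) :
  scalable (dif e : mod0 X i -> mod0 X j).
Proof. by move=> r x; exact: dif_act0. Qed.

Lemma lactE i j k (e : i + j = k) a s x t :
  lact e (frac a s) (frac x t) = frac (act e a x : mod0 X k) (denM s t).
Proof.
by apply: loc_bilE; [exact: act_scale0l | exact: act_scale0r].
Qed.

Lemma ldifE i j (e : j + 1 = i) x s :
  ldif e (frac x s) = frac (dif e x : mod0 X j) s.
Proof. exact/loc_mapE/dif_scale0. Qed.

Lemma ksign_frac k i (x : mod0 X i) (s : set_type S) :
  ksign k (frac x s) = frac (ksign k x : mod0 X i) s.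
Proof. by apply/esym/(@ksign_map _ _ (fun x : mod0 X i => frac x s)) => y; rewrite fracN. Qed.

Lemma lactDl i j k (e : i + j = k) a b x :
  lact e (a + b) x = lact e a x + lact e b x.
Proof.
have [a' [b' [s [-> ->]]]] := loc_common a b; have [y [t ->]] := fracP x.
by rewrite -fracDr !lactE actDl fracDr.
Qed.
Lemma lactDr i j k (e : i + j = k) a x y :
  lact e a (x + y) = lact e a x + lact e a y.
Proof.
have [x' [y' [s [-> ->]]]] := loc_common x y; have [b [t ->]] := fracP a.
by rewrite -fracDr !lactE actDr fracDr.
Qed.
Lemma ldifD i j (e : j + 1 = i) x y : ldif e (x + y) = ldif e x + ldif e y.
Proof.
have [x' [y' [s [-> ->]]]] := loc_common x y.
by rewrite -fracDr !ldifE difD fracDr.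
Qed.
Lemma ldif_dif i j k (e : j + 1 = i) (e' : k + 1 = j) x : ldif e' (ldif e x) = 0.
Proof. by have [y [s ->]] := fracP x; rewrite !ldifE dif_dif frac0. Qed.
End LocModule.

Definition lone : lcomp (dgself A) 0 := frac (rone A : mod0 (dgself A) 0) (den1 S).

Section LocModule2.
Variable X : dgmod A.

Lemma lactA i j k ij jk l (e1 : i + j = ij) (e2 : ij + k = l)
    (e3 : j + k = jk) (e4 : i + jk = l) a b (x : lcomp X k) :
  lact e2 (lact (X := dgself A) e1 a b) x = lact e4 a (lact e3 b x).
Proof.
have [a' [s ->]] := fracP a; have [b' [t ->]] := fracP b.
have [y [u ->]] := fracP x.
by rewrite !lactE denMA; congr frac; exact: actA.
Qed.
Lemma lact1 i (e : 0 + i = i) (x : lcomp X i) : lact e lone x = x.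
Proof.
by have [y [s ->]] := fracP x; rewrite lactE den1M act1.
Qed.
Lemma lleibniz i j k i' j' k' (e : i + j = k) (ei : i' + 1 = i)
    (ej : j' + 1 = j) (ek : k' + 1 = k) (e1 : i' + j = k') (e2 : i + j' = k')
    a (x : lcomp X j) :
  ldif ek (lact e a x) =
    lact e1 (ldif (X := dgself A) ei a) x + ksign i (lact e2 a (ldif ej x)).
Proof.
have [b [s ->]] := fracP a; have [y [t ->]] := fracP x.
rewrite !(lactE, ldifE) ksign_frac -fracDr; congr frac.
exact: leibniz.
Qed.
End LocModule2.

Lemma lmulC i j k (e : i + j = k) (e' : j + i = k) (a : lcomp (dgself A) i)
    (b : lcomp (dgself A) j) :
  lact e a b = ksign (i * j) (lact e' b a).
Proof.
have [a' [s ->]] := fracP a; have [b' [t ->]] := fracP b.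
by rewrite !lactE denMC ksign_frac; congr frac; exact: rmulC.
Qed.
Lemma lmul_odd i k (e : i + i = k) (a : lcomp (dgself A) i) :
  odd (absz i) -> lact e a a = 0.
Proof.
move=> io; have [b [s ->]] := fracP a; rewrite lactE -[RHS](frac0 _ (denM s s)).
by congr frac; exact: rmul_odd.
Qed.
Lemma lnonneg i : i < 0 -> forall a : lcomp (dgself A) i, a = 0.
Proof.
move=> i0 a; have [b [s ->]] := fracP a.
by rewrite -[RHS](frac0 _ s); congr frac; exact: rnonneg.
Qed.

Definition loc_dgring : dgring :=
  @DGRing (lcomp (dgself A)) (@lact (dgself A)) lone (@ldif (dgself A))
    (@lactDl (dgself A)) (@lactDr (dgself A)) (@lactA (dgself A))
    (@lact1 (dgself A)) lmulC lmul_odd (@ldifD (dgself A))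
    (@ldif_dif (dgself A)) (@lleibniz (dgself A)) lnonneg.

Definition loc_dgmod (X : dgmod A) : dgmod loc_dgring :=
  @DGMod loc_dgring (lcomp X) (@lact X) (@ldif X) (@lactDl X) (@lactDr X)
    (@lactA X) (@lact1 X) (@ldifD X) (@ldif_dif X) (@lleibniz X).

End DGLocalization.

Section AtPrime.
Variables (A : dgring) (p : spec (H0 A)).

Definition cpl : set (ring0 A) := [set a | ~ prime_set p (pi0 a)].

Lemma cpl1 : cpl 1.
Proof. by rewrite /cpl /= pi01; exact: prime_proper. Qed.
Lemma cplM s t : cpl s -> cpl t -> cpl (s * t).
Proof. by rewrite /cpl /= => hs ht; rewrite pi0M => /prime_mul[]. Qed.
Definition prime_cpl : multset (ring0 A) := Multset cpl1 cplM.
End AtPrime.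

Definition dgring_at (A : dgring) (p : spec (H0 A)) : dgring :=
  loc_dgring (prime_cpl p).
Definition dgmod_at (A : dgring) (p : spec (H0 A)) (X : dgmod A) :
  dgmod (dgring_at p) := loc_dgmod (prime_cpl p) X.

Section Morphisms.
Variable A : dgring.
Implicit Types X Y Z : dgmod A.

Record dghom X Y := DGHom {
  hom :> forall i, X i -> Y i;
  homD : forall i (x y : X i), hom (x + y) = hom x + hom y;
  homM : forall i j k (e : i + j = k) a x, hom (act e a x) = act e a (hom x);
  hom_dif : forall i j (e : j + 1 = i) x, hom (dif e x) = dif e (hom x) }.
Arguments hom {X Y} f i x : rename.

Lemma hom0 X Y (f : dghom X Y) i : f i 0 = 0.
Proof. exact: (add_map0 (@homD _ _ f i)). Qed.
Lemma homN X Y (f : dghom X Y) i x : f i (- x) = - f i x.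
Proof. exact: (add_mapN (@homD _ _ f i)). Qed.

Definition dgid X : dghom X X.
Proof. by exists (fun i x => x). Defined.

Definition dgcomp X Y Z (g : dghom Y Z) (f : dghom X Y) : dghom X Z.
Proof.
exists (fun i x => g i (f i x)) => *; by rewrite ?homD ?homM ?hom_dif.
Defined.

Definition homotopic X Y (f g : dghom X Y) : Prop :=
  exists h : forall i j, i + 1 = j -> X i -> Y j,
  [/\ forall i j (e : i + 1 = j) x y, h i j e (x + y) = h i j e x + h i j e y,
      forall i j k j' k' (e : i + j = k) (ej : j + 1 = j') (ek : k + 1 = k')
        (e' : i + j' = k') a x,
        h k k' ek (act e a x) = ksign i (act e' a (h j j' ej x)) &
      forall i j k (ej : i + 1 = j) (ek : k + 1 = i) x,
        f i x - g i x = dif ej (h i j ej x) + h k i ek (dif ek x)].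

Section HMap.
Variables (X Y : dgmod A) (f : dghom X Y) (i : int).

Lemma hom_cyc (z : cycle X i) : cyc (f i (cycle_val z)).
Proof.
apply/asboolP => j e; rewrite -hom_dif.
by have /asboolP -> := cycleP z; rewrite hom0.
Qed.
Definition cyc_map (z : cycle X i) : cycle Y i := Cycle (hom_cyc z).

Definition hmap (h : homology X i) : homology Y i := hclass (cyc_map (repr h)).

Lemma hmapE z : hmap (hclass z) = hclass (cyc_map z).
Proof.
apply/hclass_eq; set w := repr _.
have /hclass_eq/asboolP[j [e [y hy]]] : hclass w = hclass z by rewrite hclass_repr.
apply/asboolP; exists j, e, (f j y) => /=.
by rewrite -hom_dif -hy /= homD homN.
Qed.
End HMap.
Arguments hmap {X Y} f i h.

Definition qis X Y (f : dghom X Y) : Prop := forall i, bijective (hmap f i).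

Lemma qisP X Y (f : dghom X Y) : qis f <->
  (forall i z, bnd (cyc_map f z) -> bnd (z : cycle X i)) /\
  (forall i (w : cycle Y i), exists z, bnd (w - cyc_map f z)).
Proof.
split=> [h|[hi hs] i].
  split=> [i z hz|i w].
    rewrite -[z]subr0; apply/hclass_eq; apply: (bij_inj (h i)).
    rewrite !hmapE; apply/hclass_eq.
    have -> // : cyc_map f z - cyc_map f 0 = cyc_map f z.
    by apply: val_inj; rewrite /= hom0 subr0.
  have [g fg gf] := h i; exists (repr (g (hclass w))); apply/hclass_eq.
  by rewrite -hmapE hclass_repr gf.
have /choice[g gE] : forall k : homology Y i, exists h, hmap f i h = k.
  move=> k; have [z hz] := hs i (repr k); exists (hclass z).
  by rewrite hmapE -[RHS]hclass_repr; apply/esym/hclass_eq.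
have injf : injective (hmap f i).
  move=> a b; rewrite -(hclass_repr a) -(hclass_repr b) !hmapE => /hclass_eq e.
  apply/hclass_eq/hi; have -> // : cyc_map f (repr a - repr b) =
    cyc_map f (repr a) - cyc_map f (repr b).
  by apply: val_inj; rewrite /= homD homN.
by exists g => // x; apply: injf; rewrite gE.
Qed.

Lemma qis_id X : qis (dgid X).
Proof.
apply/qisP; split=> [i z|i w]; last first.
  exists w; have -> : cyc_map (dgid X) w = w by exact: val_inj.
  by rewrite subrr; apply/asboolP; exists (i + 1), erefl, 0; rewrite dif0.
by have -> : cyc_map (dgid X) z = z by exact: val_inj.
Qed.

Lemma qis_comp X Y Z (g : dghom Y Z) (f : dghom X Y) :
  qis g -> qis f -> qis (dgcomp g f).
Proof.
move=> hg hf i.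
apply: (eq_bij (bij_comp (hg i) (hf i))) => h.
by rewrite /= -(hclass_repr h) !hmapE; congr hclass; exact: val_inj.
Qed.

Section Constructions.

Definition dgzero : dgmod A.
Proof.
by apply: (@DGMod A (fun=> 'I_1 : zmodType) (fun _ _ _ _ _ _ => 0) (fun _ _ _ _ => 0));
  move=> *; exact: etrans (ord1 _) (esym (ord1 _)).
Defined.

Definition dgsum X Y : dgmod A.
Proof.
apply: (@DGMod A (fun i => (X i * Y i)%type : zmodType)
  (fun i j k e a x => (act e a x.1, act e a x.2))
  (fun i j e x => (dif e x.1, dif e x.2))).
- by move=> *; rewrite !actDl.
- by move=> *; rewrite /= !actDr.
- by move=> *; congr (_, _); exact: actA.
- by move=> i e [x y]; rewrite /= !act1.
- by move=> *; rewrite /= !difD.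
- by move=> *; rewrite /= !dif_dif.
- move=> i j k i' j' k' e ei ej ek e1 e2 a [x y] /=.
  rewrite !(leibniz e ei ej ek e1 e2) /ksign.
  by case: ifP.
Defined.

(* (Sigma^n X)_i = X_{i-n} with differential (-1)^n d and with
   a . Sigma^n x = (-1)^{n|a|} Sigma^n (a x) *)
Lemma shift_idx (n i j k : int) : i + j = k -> i + (j - n) = k - n.
Proof. by move<-; rewrite addrA. Qed.
Lemma shift_idx1 (n i j : int) : j + 1 = i -> (j - n) + 1 = i - n.
Proof. by move<-; rewrite addrAC. Qed.

Definition dgshift (n : int) X : dgmod A.
Proof.
apply: (@DGMod A (fun i => X (i - n))
  (fun i j k e a x => ksign (n * i) (act (shift_idx n e) a x))
  (fun i j e x => ksign n (dif (shift_idx1 n e) x))).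
- by move=> *; rewrite actDl ksignD.
- by move=> *; rewrite actDr ksignD.
- move=> i j k ij jk l e1 e2 e3 e4 a b x.
  rewrite (ksign_map _ _ (actNr _ a)) ksign_add -mulrDr e1; congr ksign.
  exact: actA.
- by move=> i e x; rewrite mulr0 ksign_even // act1.
- by move=> *; rewrite difD ksignD.
- by move=> *; rewrite (ksign_map _ _ (difN _)) dif_dif !ksign0.
- move=> i j k i' j' k' e ei ej ek e1 e2 a x.
  rewrite (ksign_map _ _ (difN _)) (ksign_map _ _ (actNr _ a)).
  rewrite (leibniz _ ei (shift_idx1 n ej) _ (shift_idx n e1) (shift_idx n e2)).
  rewrite !ksignD !ksign_add; congr (_ + _); apply: ksign_congr.
    by rewrite -ei; lia.
  by lia.
Defined.

Definition shift_hom (n : int) X Y (f : dghom X Y) :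
  dghom (dgshift n X) (dgshift n Y).
Proof.
exists (fun i => f (i - n)) => [i x y|i j k e a x|i j e x] /=.
- exact: homD.
- by rewrite (ksign_map _ _ (@homN _ _ f _)) homM.
- by rewrite (ksign_map _ _ (@homN _ _ f _)) hom_dif.
Defined.
End Constructions.
End Morphisms.

Section QisShift.
Variables (A : dgring) (n : int).

Lemma ksign_eq0 (V : zmodType) i (x : V) : ksign i x = 0 -> x = 0.
Proof. by rewrite /ksign; case: ifP => // _ /eqP; rewrite oppr_eq0 => /eqP. Qed.

Section ShiftHomology.
Variables (X : dgmod A) (i : int).

Lemma shift_idxK (j : int) : exists k, j = k - n.
Proof. by exists (j + n); rewrite addrK. Qed.

Lemma shift_cyc (x : X (i - n)) : cyc x -> cyc (x : dgshift n X i).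
Proof. by move=> /asboolP h; apply/asboolP => j e /=; rewrite h ksign0. Qed.

Lemma unshift_cyc (x : X (i - n)) : cyc (x : dgshift n X i) -> cyc x.
Proof.
move=> /asboolP h; apply/asboolP => j e; have [k ej] := shift_idxK j; subst j.
have e' : k + 1 = i by lia.
by have /= /ksign_eq0 := h k e'; rewrite (eq_irrelevance (shift_idx1 n e') e).
Qed.

Definition cyc_shift (z : cycle X (i - n)) : cycle (dgshift n X) i :=
  Cycle (shift_cyc (cycleP z)).
Definition cyc_unshift (z : cycle (dgshift n X) i) : cycle X (i - n) :=
  Cycle (unshift_cyc (cycleP z)).

Lemma bnd_shift z : bnd z -> bnd (cyc_shift z).
Proof.
move=> /asboolP[j [e [y hy]]]; have [k ej] := shift_idxK j.
move: e y hy; rewrite {}ej => e y hy.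
have e' : i + 1 = k by lia.
apply/asboolP; exists k, e', (ksign n y : dgshift n X k) => /=.
rewrite (ksign_map _ _ (difN _)) ksign_add ksign_even; last by lia.
by rewrite hy (eq_irrelevance e (shift_idx1 n e')).
Qed.

Lemma bnd_unshift z : bnd z -> bnd (cyc_unshift z).
Proof.
move=> /asboolP[k [e [y hy]]]; apply/asboolP.
exists (k - n), (shift_idx1 n e), (ksign n y) => /=.
by rewrite (ksign_map _ _ (difN _)) hy.
Qed.
End ShiftHomology.

Lemma qis_shift (X Y : dgmod A) (f : dghom X Y) : qis f -> qis (shift_hom n f).
Proof.
move=> /qisP[hi hs]; apply/qisP; split=> i.
  move=> z /bnd_unshift hz.
  have /bnd_shift : bnd (cyc_unshift z).
    by apply: hi; move: hz; congr (is_true (bnd _)); exact: val_inj.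
  by congr (is_true (bnd _)); exact: val_inj.
move=> w; have [z /bnd_shift hz] := hs _ (cyc_unshift w); exists (cyc_shift z).
by move: hz; congr (is_true (bnd _)); exact: val_inj.
Qed.
End QisShift.

Section Cone.
Variable A : dgring.

Definition gcast (X : dgmod A) i j (e : i = j) (x : X i) : X j :=
  ecast k (X k) e x.

Lemma gcastD (X : dgmod A) i j (e : i = j) (x y : X i) :
  gcast e (x + y) = gcast e x + gcast e y.
Proof. by case: j / e. Qed.
Lemma gcast0 (X : dgmod A) i j (e : i = j) : gcast e (0 : X i) = 0.
Proof. by case: j / e. Qed.
Lemma gcastN (X : dgmod A) i j (e : i = j) (x : X i) :
  gcast e (- x) = - gcast e x.
Proof. by case: j / e. Qed.
Lemma gcast_act (X : dgmod A) i j k j' k' (ej : j = j') (ek : k = k')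
    (e : i + j = k) (e' : i + j' = k') (a : A i) (x : X j) :
  gcast ek (act e a x) = act e' a (gcast ej x).
Proof. by subst j' k'; rewrite (eq_irrelevance e' e). Qed.
Lemma gcast_dif (X : dgmod A) i j i' j' (ei : i = i') (ej : j = j')
    (e : j + 1 = i) (e' : j' + 1 = i') (x : X i) :
  gcast ej (dif e x) = dif e' (gcast ei x).
Proof. by subst i' j'; rewrite (eq_irrelevance e' e). Qed.

Variables (M N : dgmod A) (f : dghom M N).

Lemma cone_idx (i j : int) : j + 1 = i -> i - 1 = j.
Proof. by move<-; rewrite addrK. Qed.

(* The mapping cone of f : M -> N is N (+) Sigma M with d(y, Sigma x) = (d y + f x, - Sigma (d x)) *)
Definition cone : dgmod A.
Proof.
apply: (@DGMod A (fun i => (N i * dgshift 1 M i)%type : zmodType)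
  (fun i j k e a z => (act e a z.1, act e a z.2))
  (fun i j e z =>
    (dif e z.1 + gcast (cone_idx e) (f (i - 1) z.2), dif e z.2))).
- by move=> *; rewrite !actDl.
- by move=> *; congr (_, _); exact: actDr.
- by move=> *; congr (_, _); exact: actA.
- by move=> i e [x y]; rewrite !act1.
- move=> i j e [x y] [x' y']; congr (_, _); last exact: difD.
  by rewrite [(_, _).1]/= [(_, _).2]/= difD homD gcastD addrACA.
- move=> i j k e e' [x y]; congr (_, _); last exact: dif_dif.
  rewrite [(_, _).1]/= [(_, _).2]/= difD dif_dif add0r.
  rewrite (ksign_map _ _ (@homN _ _ _ f _)) hom_dif /ksign /=.
  rewrite gcastN (gcast_dif (cone_idx e) _ _ e') addrN //.
- move=> i j k i' j' k' e ei ej ek e1 e2 a [x y].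
  rewrite [X in _ = _ + X](_ : _ = (ksign i (act e2 a
     (dif ej x + gcast (cone_idx ej) (f (j - 1) y))),
     ksign i (act e2 a (dif (i := j) (d := dgshift 1 M) ej y)))); last first.
    by rewrite /ksign; case: ifP.
  congr (_, _); last exact: leibniz.
  rewrite [(_, _).1]/= [(_, _).2]/= (leibniz e ei ej ek e1 e2).
  rewrite (ksign_map _ _ (@homN _ _ _ f _)) homM.
  rewrite (ksign_map _ _ (gcastN _)) (gcast_act (cone_idx ej) _ _ e2).
  by rewrite actDr ksignD addrA mul1r.
Defined.

Definition cone_in : dghom N cone.
Proof.
exists (fun i y => (y, 0) : cone i) => [i x y|i j k e a x|i j e x].
- by congr (_, _); rewrite addr0.
- by congr (_, _); rewrite [RHS]act0r.
- congr (_, _); last by rewrite [RHS]dif0.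
  by rewrite hom0 gcast0 addr0.
Defined.

Definition cone_out : dghom cone (dgshift 1 M).
Proof. by exists (fun i z => z.2). Defined.
End Cone.

Section DerivedCategory.
Variable A : dgring.
Implicit Types X Y Z : dgmod A.

(* A morphism X -> Y of D(A) is represented by a roof X <- apex -> Y of chain maps
   whose left leg is a quasi-isomorphism. Two roofs represent the same morphism
   when roof_eq holds, and roof_comp F G K means that K represents G o F. *)
Record roof X Y := Roof {
  apex : dgmod A;
  rden : dghom apex X;
  rnum : dghom apex Y;
  rqis : qis rden }.

Definition roof_eq X Y (F G : roof X Y) : Prop :=
  exists (W : dgmod A) (u : dghom W (apex F)) (v : dghom W (apex G)),
    [/\ qis (dgcomp (rden F) u),
        homotopic (dgcomp (rden F) u) (dgcomp (rden G) v) &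
        homotopic (dgcomp (rnum F) u) (dgcomp (rnum G) v)].

Definition roof_comp X Y Z (F : roof X Y) (G : roof Y Z) (K : roof X Z) : Prop :=
  exists (W : dgmod A) (u : dghom W (apex F)) (v : dghom W (apex G)) (qu : qis u),
    homotopic (dgcomp (rnum F) u) (dgcomp (rden G) v) /\
    roof_eq (Roof (dgcomp (rnum G) v) (qis_comp (rqis F) qu)) K.

Definition roof_hom X Y (f : dghom X Y) : roof X Y := Roof f (qis_id X).

Definition roof_shift n X Y (F : roof X Y) : roof (dgshift n X) (dgshift n Y) :=
  Roof (shift_hom n (rnum F)) (qis_shift n (rqis F)).

Definition roof_iso X Y (F : roof X Y) : Prop :=
  exists G : roof Y X, roof_comp F G (roof_hom (dgid X)) /\
                       roof_comp G F (roof_hom (dgid Y)).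

Definition isoD X Y : Prop := exists F : roof X Y, roof_iso F.

(* the square with top F, right G, left F' and bottom G' commutes *)
Definition roof_square X Y X' Y' (F : roof X Y) (G : roof Y Y')
    (F' : roof X X') (G' : roof X' Y') : Prop :=
  exists K : roof X Y', roof_comp F G K /\ roof_comp F' G' K.

Definition exact_triangle X Y Z (u : roof X Y) (v : roof Y Z)
    (w : roof Z (dgshift 1 X)) : Prop :=
  exists (M N : dgmod A) (f : dghom M N)
         (a : roof X M) (b : roof Y N) (c : roof Z (cone f)),
  [/\ roof_iso a, roof_iso b & roof_iso c] /\
  [/\ roof_square u b a (roof_hom f),
      roof_square v c b (roof_hom (cone_in f)) &
      roof_square w (roof_shift 1 a) c (roof_hom (cone_out f))].

Definition Dfb X : Prop :=
  (exists N : nat, forall i, (N < absz i)%N -> forall h : homology X i, h = 0) /\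
  forall i, fin_gen (R := H0 A) (homology X i).

(* S is the ambient triangulated subcategory of D(A), and full subcategories are
   given by predicates on objects (dgmod A does not fit in the universe of the
   argument of `set`). The first level is closed under isomorphism by the last
   clause with X' = 0. *)
Inductive thick1 (S G : dgmod A -> Prop) : dgmod A -> Prop :=
| Thick1_gen X : S X -> G X -> thick1 S G X
| Thick1_zero : thick1 S G (dgzero A)
| Thick1_sum X Y : thick1 S G X -> thick1 S G Y -> thick1 S G (dgsum X Y)
| Thick1_shift n X : thick1 S G X -> thick1 S G (dgshift n X)
| Thick1_summand X X' Y : S X -> S X' -> isoD (dgsum X X') Y ->
    thick1 S G Y -> thick1 S G X.

Fixpoint thick (S G : dgmod A -> Prop) (n : nat) (X : dgmod A) : Prop :=
  match n with
  | 0%N => S X /\ isoD X (dgzero A)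
  | 1%N => thick1 S G X
  | n'.+1 => S X /\ exists X' X1 X2 : dgmod A,
      [/\ S X', thick1 S G X1, thick S G n' X2 &
          exists (u : roof X1 (dgsum X X')) (v : roof (dgsum X X') X2)
            (w : roof X2 (dgshift 1 X1)), exact_triangle u v w]
  end.
End DerivedCategory.
Arguments Dfb : clear implicits.

Definition subcat_at (A : dgring) (p : spec (H0 A)) (G : dgmod A -> Prop) :
  dgmod (dgring_at p) -> Prop := fun Y => exists2 X, G X & Y = dgmod_at p X.
Arguments subcat_at {A} p G Y.

(* Main.v *)
(* Since H(A) is finitely generated over the Noetherian ring H_0(A), every X in
   D^f_b(A) has a resolution P -> X by a sequential colimit of finite cell modules
   whose cells have degrees tending to infinity; up to homotopy, maps from P to a
   module with bounded homology are determined by a finite stage, so Hom_{D(A)}(P, -)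
   commutes with localization on D^f_b(A). Suppose X_p lies in thick^n(G_p). Clearing
   denominators in the triangles that build X_p, by induction on n, makes X_p a
   retract of W_p for an n-fold extension W over A of finite sums of shifts of objects
   of G. Clearing denominators in the retraction gives a : P -> W and x : W -> X with
   x o a homotopic to s times the resolution, for some s outside p. At every prime q
   not containing s this yields W_q = X_q (+) (cone a)_q in D(A_q), so X_q lies in
   thick^n(G_q): a basic open neighbourhood of p is contained in the set. *)
From HB Require Import structures.
Require Import Defs.
From mathcomp Require Import all_boot all_order all_algebra.
From mathcomp Require Import zify ring.
From mathcomp Require Import all_classical.
From mathcomp Require Import topology.

Set Implicit Arguments.
Unset Strict Implicit.
Unset Printing Implicit Defensive.

Import Order.TTheory GRing.Theory Num.Theory Defs.
Local Open Scope classical_set_scope.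
Local Open Scope ring_scope.

Local Notation "f ~ g" := (homotopic f g) (at level 70).

(** * Chain maps, homotopies and quasi-isomorphisms *)

(** Levels are closed under direct summands, and a splitting over the localization need not descend
    to [A]; so the triangles that build [X_p] cannot be lifted one by one. The induction therefore
    carries a factorization property, [approx]: its sources are localizations of tame modules over
    [A], for which denominators can be cleared, and its targets are arbitrary over the localized
    ring. In the same spirit a morphism of the derived category is seen only through its effect on
    homotopy classes of maps from K-projective modules, so that composing needs no common refinement
    of roofs. Since a resolution is infinite in general, bounded homology of the target stands in
    for compactness of the source, and finite generation of the homology is what lets each stage
    kill finitely many cycles. Levels ask for the complement of [X_q] to lie in D^f_b too; a cone
    formed over [A] serves all q at once. *)

Section Homs.
Variable A : dgring.
Implicit Types X Y Z : dgmod A.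

Lemma dghom_ext X Y (f g : dghom X Y) : (forall i x, f i x = g i x) -> f = g.
Proof.
case: f g => [f fD fM fd] [g gD gM gd] /= h.
have e : f = g by apply: functional_extensionality_dep => i; apply/funext => x.
by subst g; congr DGHom; apply: Prop_irrelevance.
Qed.

HB.instance Definition _ X Y := gen_eqMixin (dghom X Y).
HB.instance Definition _ X Y := gen_choiceMixin (dghom X Y).

Definition dghom_zero X Y : dghom X Y.
Proof. by exists (fun _ _ => 0) => *; rewrite ?addr0 ?act0r ?dif0. Defined.

Definition dghom_add X Y (f g : dghom X Y) : dghom X Y.
Proof.
exists (fun i x => f i x + g i x) => *.
- by rewrite !homD addrACA.
- by rewrite !homM actDr.
- by rewrite !hom_dif difD.
Defined.

Definition dghom_opp X Y (f : dghom X Y) : dghom X Y.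
Proof.
exists (fun i x => - f i x) => *.
- by rewrite homD opprD.
- by rewrite homM actNr.
- by rewrite hom_dif difN.
Defined.

Lemma dghom_addA X Y : associative (@dghom_add X Y).
Proof. by move=> f g h; apply: dghom_ext => i x; exact: addrA. Qed.
Lemma dghom_addC X Y : commutative (@dghom_add X Y).
Proof. by move=> f g; apply: dghom_ext => i x; exact: addrC. Qed.
Lemma dghom_add0 X Y : left_id (dghom_zero X Y) (@dghom_add X Y).
Proof. by move=> f; apply: dghom_ext => i x; exact: add0r. Qed.
Lemma dghom_addN X Y :
  left_inverse (dghom_zero X Y) (@dghom_opp X Y) (@dghom_add X Y).
Proof. by move=> f; apply: dghom_ext => i x; exact: addNr. Qed.

HB.instance Definition _ X Y := GRing.isZmodule.Build (dghom X Y)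
  (@dghom_addA X Y) (@dghom_addC X Y) (@dghom_add0 X Y) (@dghom_addN X Y).

Lemma addfE X Y (f g : dghom X Y) i x : (f + g) i x = f i x + g i x.
Proof. by []. Qed.
Lemma oppfE X Y (f : dghom X Y) i x : (- f) i x = - f i x.
Proof. by []. Qed.
Lemma zerofE X Y i x : (0 : dghom X Y) i x = 0.
Proof. by []. Qed.
Definition dghomE := (addfE, oppfE, zerofE).

Lemma dgcompE X Y Z (g : dghom Y Z) (f : dghom X Y) i x :
  dgcomp g f i x = g i (f i x).
Proof. by []. Qed.

Lemma dgcompA X Y Z T (h : dghom Z T) (g : dghom Y Z) (f : dghom X Y) :
  dgcomp h (dgcomp g f) = dgcomp (dgcomp h g) f.
Proof. exact: dghom_ext. Qed.
Lemma comp1f X Y (f : dghom X Y) : dgcomp (dgid Y) f = f.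
Proof. exact: dghom_ext. Qed.
Lemma compf1 X Y (f : dghom X Y) : dgcomp f (dgid X) = f.
Proof. exact: dghom_ext. Qed.
Lemma compDl X Y Z (g h : dghom Y Z) (f : dghom X Y) :
  dgcomp (g + h) f = dgcomp g f + dgcomp h f.
Proof. exact: dghom_ext. Qed.
Lemma compDr X Y Z (g : dghom Y Z) (f h : dghom X Y) :
  dgcomp g (f + h) = dgcomp g f + dgcomp g h.
Proof. by apply: dghom_ext => i x /=; exact: homD. Qed.
Lemma compNr X Y Z (g : dghom Y Z) (f : dghom X Y) :
  dgcomp g (- f) = - dgcomp g f.
Proof. by apply: dghom_ext => i x /=; exact: homN. Qed.
Lemma comp0f X Y Z (f : dghom X Y) : dgcomp (0 : dghom Y Z) f = 0.
Proof. exact: dghom_ext. Qed.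
Lemma compf0 X Y Z (g : dghom Y Z) : dgcomp g (0 : dghom X Y) = 0.
Proof. by apply: dghom_ext => i x /=; exact: hom0. Qed.
Lemma compBl X Y Z (g h : dghom Y Z) (f : dghom X Y) :
  dgcomp (g - h) f = dgcomp g f - dgcomp h f.
Proof. exact: dghom_ext. Qed.
Lemma compBr X Y Z (g : dghom Y Z) (f h : dghom X Y) :
  dgcomp g (f - h) = dgcomp g f - dgcomp g h.
Proof. by rewrite compDr compNr. Qed.

Lemma homB X Y (f : dghom X Y) i x y : f i (x - y) = f i x - f i y.
Proof. by rewrite homD homN. Qed.

(** Chain maps form an abelian group, so statements about homotopies reduce to statements about
    null-homotopies. *)
Lemma htp_sub X Y (f g : dghom X Y) : f ~ g <-> f - g ~ 0.
Proof.
split=> -[h [hD hM hd]]; exists h; split=> // i j k ej ek x.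
  by rewrite zerofE subr0; exact: hd.
by have := hd i j k ej ek x; rewrite zerofE subr0.
Qed.

Lemma htp_refl X Y (f : dghom X Y) : f ~ f.
Proof.
exists (fun _ _ _ _ => 0); split=> *; rewrite ?addr0 ?act0r ?ksign0 //.
by rewrite subrr dif0.
Qed.

Lemma htp0D X Y (f g : dghom X Y) : f ~ 0 -> g ~ 0 -> f + g ~ 0.
Proof.
move=> [h [hD hM hd]] [k [kD kM kd]].
exists (fun i j e x => h i j e x + k i j e x); split.
- by move=> *; rewrite hD kD addrACA.
- by move=> i j l j' l' e ej ek e' a x; rewrite (hM _ _ _ _ _ _ ej _ e')
    (kM _ _ _ _ _ _ ej _ e') actDr ksignD.
- move=> i j l ej el x; have := hd _ _ _ ej el x; have := kd _ _ _ ej el x.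
  rewrite !dghomE !subr0 difD => -> ->; exact: addrACA.
Qed.

Lemma htp0N X Y (f : dghom X Y) : f ~ 0 -> - f ~ 0.
Proof.
move=> [h [hD hM hd]]; exists (fun i j e x => - h i j e x); split.
- by move=> *; rewrite hD opprD.
- by move=> i j l j' l' e ej ek e' a x; rewrite (hM _ _ _ _ _ _ ej _ e')
    actNr (@ksign_map _ _ (@GRing.opp _)).
- move=> i j l ej el x; have := hd _ _ _ ej el x.
  by rewrite !dghomE !subr0 difN => ->; rewrite opprD.
Qed.

Lemma htp_sym X Y (f g : dghom X Y) : f ~ g -> g ~ f.
Proof. by move=> /htp_sub/htp0N; rewrite opprB => h; apply/htp_sub. Qed.

Lemma htp_trans X Y (g f h : dghom X Y) : f ~ g -> g ~ h -> f ~ h.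
Proof.
move=> /htp_sub fg /htp_sub gh; apply/htp_sub.
by have := htp0D fg gh; rewrite addrA subrK.
Qed.

Lemma htpD X Y (f f' g g' : dghom X Y) : f ~ f' -> g ~ g' -> f + g ~ f' + g'.
Proof.
move=> /htp_sub h /htp_sub k; apply/htp_sub.
by have := htp0D h k; rewrite opprD addrACA.
Qed.

Lemma htp_compl X Y Z (g : dghom Y Z) (f f' : dghom X Y) :
  f ~ f' -> dgcomp g f ~ dgcomp g f'.
Proof.
move=> [h [hD hM hd]]; exists (fun i j e x => g j (h i j e x)); split.
- by move=> *; rewrite hD homD.
- by move=> i j l j' l' e ej ek e' a x; rewrite (hM _ _ _ _ _ _ ej _ e')
    (@ksign_map _ _ (g _)) ?homM // => y; exact: homN.
- move=> i j k ej ek x; rewrite !dgcompE -hom_dif -homB.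
  by rewrite (hd _ _ _ ej ek) homD.
Qed.

Lemma htp_compr X Y Z (g g' : dghom Y Z) (f : dghom X Y) :
  g ~ g' -> dgcomp g f ~ dgcomp g' f.
Proof.
move=> [h [hD hM hd]]; exists (fun i j e x => h i j e (f i x)); split.
- by move=> *; rewrite homD hD.
- by move=> i j l j' l' e ej ek e' a x; rewrite homM (hM _ _ _ _ _ _ ej _ e').
- by move=> i j k ej ek x; rewrite !dgcompE hom_dif -hd.
Qed.

End Homs.

(** * Cycles, boundaries and quasi-isomorphisms in terms of elements *)

Section Elements.
Variable A : dgring.
Implicit Types X Y Z : dgmod A.

(** [bnd] is a predicate on packed cycles; this version lives on bare elements and combines with
    sums and chain maps without repacking. *)
Definition isbnd X i (x : X i) : Prop := exists j (e : i + 1 = j) y, x = dif e y.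

Lemma cycP X i j (e : j + 1 = i) (x : X i) : cyc x <-> dif e x = 0.
Proof.
split=> [/asboolP h|h]; first exact: h.
apply/asboolP => k e'; have ekj : k = j by lia.
by subst k; rewrite (eq_irrelevance e' e).
Qed.

Lemma cyc_dif X i (x : X i) : cyc x -> forall j (e : j + 1 = i), dif e x = 0.
Proof. by move=> h j e; apply/cycP. Qed.

Lemma isbndP X i j (e : i + 1 = j) (x : X i) : isbnd x <-> exists y, x = dif e y.
Proof.
split=> [[k [e' [y h]]]|[y h]]; last by exists j, e, y.
by case: k / e' y h => y h; case: j / e; exists y.
Qed.

Lemma bndP X i (z : cycle X i) : bnd z <-> isbnd (cycle_val z).
Proof. by split=> /asboolP. Qed.

Lemma isbnd0 X i : isbnd (0 : X i).
Proof. by exists (i + 1), erefl, 0; rewrite dif0. Qed.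
Lemma isbndD X i (x y : X i) : isbnd x -> isbnd y -> isbnd (x + y).
Proof.
move=> /(isbndP erefl)[u ->] /(isbndP erefl)[v ->].
by exists (i + 1), erefl, (u + v); rewrite difD.
Qed.
Lemma isbndN X i (x : X i) : isbnd x -> isbnd (- x).
Proof.
by move=> /(isbndP erefl)[u ->]; exists (i + 1), erefl, (- u); rewrite difN.
Qed.
Lemma isbndB X i (x y : X i) : isbnd x -> isbnd y -> isbnd (x - y).
Proof. by move=> hx hy; apply: isbndD => //; exact: isbndN. Qed.
Lemma isbnd_subr X i (u v : X i) : isbnd (u - v) -> isbnd u -> isbnd v.
Proof. by move=> h k; rewrite -[v](subKr u); exact: isbndB. Qed.
Lemma isbnd_hom X Y (f : dghom X Y) i (x : X i) : isbnd x -> isbnd (f i x).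
Proof.
by move=> [j [e [y ->]]]; exists j, e, (f j y); rewrite hom_dif.
Qed.
Lemma isbnd_dif X i j (e : j + 1 = i) (x : X i) : isbnd (dif e x).
Proof. by exists i, e, x. Qed.

Lemma cyc0 X i : cyc (0 : X i).
Proof. by apply/asboolP => j e; rewrite dif0. Qed.
Lemma cycD X i (x y : X i) : cyc x -> cyc y -> cyc (x + y).
Proof.
move=> hx hy; apply/asboolP => j e.
by rewrite difD (cyc_dif hx) (cyc_dif hy) addr0.
Qed.
Lemma cycN X i (x : X i) : cyc x -> cyc (- x).
Proof. by move=> hx; apply/asboolP => j e; rewrite difN (cyc_dif hx) oppr0. Qed.
Lemma cycB X i (x y : X i) : cyc x -> cyc y -> cyc (x - y).
Proof. by move=> hx hy; apply: cycD => //; exact: cycN. Qed.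
Lemma cyc_dgdif X i j (e : j + 1 = i) (x : X i) : cyc (dif e x).
Proof. by apply/asboolP => k e'; rewrite dif_dif. Qed.
Lemma cyc_hom X Y (f : dghom X Y) i (x : X i) : cyc x -> cyc (f i x).
Proof. by move=> hx; apply/asboolP => k e'; rewrite -hom_dif (cyc_dif hx) hom0. Qed.

Lemma qisE X Y (f : dghom X Y) : qis f <->
  (forall i x, cyc x -> isbnd (f i x) -> isbnd x) /\
  (forall i y, cyc y -> exists2 x : X i, cyc x & isbnd (y - f i x)).
Proof.
rewrite qisP; split=> -[hi hs]; split.
- by move=> i x cx hb; apply/(bndP (Cycle cx))/hi/bndP.
- move=> i y cy; have [[x cx] /bndP h] := hs i (Cycle cy); by exists x.
- by move=> i [x cx] /bndP hb; apply/bndP/hi.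
- move=> i [y cy]; have [x cx h] := hs i y cy; exists (Cycle cx); exact/bndP.
Qed.

Definition acyclic X : Prop := forall i (x : X i), cyc x -> isbnd x.

Lemma qis_bij X Y (f : dghom X Y) :
  (forall i, injective (f i)) -> (forall i y, exists x, f i x = y) -> qis f.
Proof.
move=> inj sur.
apply/qisE; split=> [i x cx /(isbndP erefl)[y hy]|i y cy].
  have [y' e] := sur _ y; exists (i + 1), erefl, y'.
  by apply: inj; rewrite hom_dif e.
have [x ex] := sur _ y; exists x; last by rewrite ex subrr; exact: isbnd0.
apply/(cycP (subrK 1 i)); apply: inj.
by rewrite hom_dif hom0 ex; apply: cyc_dif.
Qed.

Lemma qis_acyclic X Y (f : dghom X Y) : qis f -> acyclic X <-> acyclic Y.
Proof.
move=> /qisE[hi hs]; split=> h i x cx.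
  have [y cy hy] := hs _ _ cx; rewrite -[x](subrK (f i y)).
  by apply: isbndD => //; apply: isbnd_hom; exact: h.
by apply: hi => //; apply: h; exact: cyc_hom.
Qed.

Lemma htp_bnd X Y (f g : dghom X Y) : f ~ g ->
  forall i (x : X i), cyc x -> isbnd (f i x - g i x).
Proof.
move=> [h [hD _ hd]] i x cx; rewrite (hd _ _ _ erefl (subrK 1 i)) (cyc_dif cx).
by rewrite (add_map0 (hD _ _ _)) addr0; exact: isbnd_dif.
Qed.

Lemma qis_htp X Y (f g : dghom X Y) : f ~ g -> qis f -> qis g.
Proof.
move=> /htp_bnd key /qisE[fi fs].
apply/qisE; split=> [i x cx hb|i y cy].
  by apply: fi => //; rewrite -[f i x](subrK (g i x)); apply: isbndD => //; exact: key.
have [x cx hb] := fs _ _ cy; exists x => //.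
by rewrite -[y](subrK (f i x)) -addrA; apply: isbndD => //; exact: key.
Qed.

Lemma qis2of3l X Y Z (g : dghom Y Z) (f : dghom X Y) :
  qis (dgcomp g f) -> qis f -> qis g.
Proof.
move=> /qisE[gfi gfs] /qisE[fi fs]; apply/qisE; split=> [i y cy hb|i z cz].
  have [x cx hx] := fs _ _ cy; rewrite -[y](subrK (f i x)); apply: isbndD => //.
  apply: isbnd_hom; apply: gfi => //; rewrite dgcompE.
  rewrite -[g i (f i x)](subrK (g i y)); apply: isbndD => //.
  by rewrite -homB -opprB; apply/isbnd_hom/isbndN.
have [x cx hx] := gfs _ _ cz; exists (f i x) => //; exact: cyc_hom.
Qed.

End Elements.

(** * Homotopy fibres, sums and K-projective modules *)

Section Fib.
Variable A : dgring.
Implicit Types X Y Z M N T : dgmod A.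

Lemma fib_idx (i j : int) : j + 1 = i -> i = j - -1.
Proof. by move<-; rewrite opprK. Qed.

Section Def.
Variables (M T : dgmod A) (g : dghom M T).

(* The homotopy fibre M (+) Sigma^-1 T with d(m, t) = (d m, g m - d t); for
   g = id it is the path object of M, contractible and mapping onto M. *)
Definition fib : dgmod A.
Proof.
apply: (@DGMod A (fun i => (M i * dgshift (-1) T i)%type : zmodType)
  (fun i j k e a z => (act e a z.1, act e a z.2))
  (fun i j e z =>
    (dif e z.1, gcast (fib_idx e) (g i z.1) + dif (d := dgshift (-1) T) e z.2))).
- by move=> *; rewrite !actDl.
- by move=> *; congr (_, _); exact: actDr.
- by move=> *; congr (_, _); exact: actA.
- by move=> i e [x y]; rewrite !act1.
- move=> i j e [x y] [x' y']; congr (_, _); first exact: difD.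
  by rewrite [(_, _).1]/= [(_, _).2]/= (difD (d := dgshift (-1) T)) homD gcastD addrACA.
- move=> i j k e e' [x y]; congr (_, _); first exact: dif_dif.
  rewrite [(_, _).1]/= [(_, _).2]/= (difD (d := dgshift (-1) T)) dif_dif addr0.
  rewrite hom_dif /ksign /= -(gcast_dif (fib_idx e) (fib_idx e') _ (shift_idx1 (-1) e')).
  by rewrite subrr.
- move=> i j k i' j' k' e ei ej ek e1 e2 a [x y].
  rewrite [X in _ = _ + X](_ : _ = (ksign i (act e2 a (dif ej x)),
     ksign i (act (d := dgshift (-1) T) e2 a (gcast (fib_idx ej) (g j x) +
       dif (i := j) (d := dgshift (-1) T) ej y)))); last first.
    by rewrite /ksign; case: ifP.
  congr (_, _); first exact: leibniz.
  rewrite [(_, _).1]/= [(_, _).2]/= (leibniz (d := dgshift (-1) T) e ei ej ek e1 e2).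
  rewrite actDr ksignD addrCA; congr (_ + (_ + _)).
  rewrite homM (gcast_act (fib_idx ej) _ _ (shift_idx (-1) e2)) /=.
  by rewrite ksign_add ksign_even //; lia.
Defined.

Definition fib_out : dghom fib M.
Proof. by exists (fun i z => z.1). Defined.

Definition fib_in : dghom (dgshift (-1) T) fib.
Proof.
exists (fun i y => (0, y) : fib i) => [i x y|i j k e a x|i j e x].
- by congr (_, _); rewrite addr0.
- by congr (_, _); rewrite [RHS]act0r.
- congr (_, _); first by rewrite [RHS]dif0.
  by rewrite hom0 gcast0 add0r.
Defined.

End Def.

Lemma gcastE X i j (e e' : i = j) (x : X i) : gcast e x = gcast e' x.
Proof. by rewrite (eq_irrelevance e e'). Qed.
Lemma gcast_id X i (e : i = i) (x : X i) : gcast e x = x.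
Proof. by rewrite (eq_irrelevance e erefl). Qed.
Lemma gcast_trans X i j k (e : i = j) (e' : j = k) (e'' : i = k) (x : X i) :
  gcast e' (gcast e x) = gcast e'' x.
Proof. by subst k j; rewrite !gcast_id. Qed.
Lemma gcast_ksign X i j (e : i = j) n (x : X i) :
  gcast e (ksign n x) = ksign n (gcast e x).
Proof. by subst j; rewrite !gcast_id. Qed.
Lemma hom_gcast X Y (f : dghom X Y) i j (e : i = j) (x : X i) :
  f j (gcast e x) = gcast e (f i x).
Proof. by subst j; rewrite !gcast_id. Qed.
Lemma unfib_idx (i j : int) : i + 1 = j -> i - -1 = j.
Proof. by rewrite opprK. Qed.

(** With [h (m, t) = t] the sum [d h + h d] is [d t + (g m - d t) = g m]. *)
Lemma fib_null M T (g : dghom M T) : dgcomp g (fib_out g) ~ 0.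
Proof.
exists (fun i j e z => gcast (X := T) (unfib_idx e) z.2); split.
- by move=> i j e [x y] [x' y']; rewrite -gcastD.
- move=> i j k j' k' e ej ek e' a [x y] /=.
  by rewrite gcast_ksign mulN1r (gcast_act (unfib_idx ej) _ _ e')
    (@ksign_congr _ (- i) i) //; lia.
- move=> i j k ej ek [x y]; rewrite zerofE subr0 /= gcastD gcast_ksign.
  rewrite (gcast_trans _ _ erefl) (gcast_dif (unfib_idx ej) _ _ ej) gcast_id /ksign /=.
  by rewrite addrCA subrr addr0.
Qed.

(** A map into the fibre is a map into [M] together with a null-homotopy of its composite with [g];
    the homotopy is the second component. *)
Lemma fib_lift X M T (g : dghom M T) (f : dghom X M) :
  dgcomp g f ~ 0 -> exists F : dghom X (fib g), dgcomp (fib_out g) F = f.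
Proof.
move=> [h [hD hM hd]].
have pf (i : int) : i + 1 = i - -1 by rewrite opprK.
unshelve eexists.
  exists (fun i x => (f i x, h i _ (pf i) x) : fib g i) => [i x y|i j k e a x|i j e x].
  - by rewrite homD hD.
  - congr (_, _); first exact: homM.
    rewrite (hM _ _ _ _ _ e (pf j) (pf k) (shift_idx (-1) e)) /=.
    by apply: ksign_congr; lia.
  - congr (_, _); first exact: hom_dif.
    have := hd _ _ _ (pf i) e x; rewrite zerofE subr0 dgcompE /= => ->.
    rewrite gcastD (gcast_dif erefl (fib_idx e) (pf i) (shift_idx1 (-1) e)).
    have hc k l l' (el : k + 1 = l) (el' : k + 1 = l') (c : l = l') y :
        gcast c (h k l el y) = h k l' el' y.
      by case: l' / c el' => el'; rewrite gcast_id (eq_irrelevance el' el).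
    by rewrite (hc _ _ _ _ (pf j)) gcast_id addrAC addrN add0r.
exact: dghom_ext.
Qed.

Section FibElements.
Variables (M T : dgmod A) (g : dghom M T).

(** The second component may sit in any degree [k] with [i + 1 = k] instead of [i - -1]; this
    confines the degree casts to a few lemmas. *)
Definition fibp i k (e : i + 1 = k) (m : M i) (t : T k) : fib g i :=
  (m, gcast (esym (unfib_idx e)) t).

Lemma fibP i k (e : i + 1 = k) (z : fib g i) : exists m t, z = fibp e m t.
Proof.
case: z => m t; exists m, (gcast (unfib_idx e) (t : T (i - -1))).
by rewrite /fibp (gcast_trans _ _ erefl).
Qed.

Lemma fibp_dif i j k (e : j + 1 = i) (e' : i + 1 = k) m t :
  dif e (fibp e' m t) = fibp e (dif e m) (g i m - dif e' t).
Proof.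
congr (_, _); rewrite /= gcastD gcastN /ksign /=; congr (_ + _); first exact: gcastE.
by congr (- _); apply/esym/gcast_dif.
Qed.

Lemma fibp_inj i k (e : i + 1 = k) m t m' t' :
  fibp e m t = fibp e m' t' -> m = m' /\ t = t'.
Proof.
case=> -> h; split=> //.
by have := congr1 (gcast (X := T) (unfib_idx e)) h; rewrite !(gcast_trans _ _ erefl) !gcast_id.
Qed.

Lemma fibp0 i k (e : i + 1 = k) : fibp e 0 0 = 0.
Proof. by rewrite /fibp gcast0. Qed.

Lemma fibpB i k (e : i + 1 = k) m t m' t' :
  fibp e m t - fibp e m' t' = fibp e (m - m') (t - t').
Proof. by rewrite /fibp gcastD gcastN. Qed.

Lemma fibpN i k (e : i + 1 = k) m t : - fibp e m t = fibp e (- m) (- t).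
Proof. by rewrite /fibp gcastN. Qed.

Lemma fibp_cyc i k (e : i + 1 = k) m t :
  cyc (fibp e m t) <-> cyc m /\ g i m = dif e t.
Proof.
split=> [h|[cm h]].
  have := cyc_dif h (subrK 1 i); rewrite fibp_dif -(fibp0 (subrK 1 i)).
  move=> /fibp_inj[hm ht]; split; first by apply/(cycP (subrK 1 i)).
  by apply/eqP; rewrite -subr_eq0 ht.
apply/(cycP (subrK 1 i)); rewrite fibp_dif (cyc_dif cm) h subrr; exact: fibp0.
Qed.

Lemma fibp_bnd i k l (e : i + 1 = k) (e' : k + 1 = l) m t :
  isbnd (fibp e m t) <-> exists m' t', m = dif e m' /\ t = g k m' - dif e' t'.
Proof.
split=> [/(isbndP e)[z]|[m' [t' [-> ->]]]].
  have [m' [t' ->]] := fibP e' z; rewrite fibp_dif => /fibp_inj[-> ->].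
  by exists m', t'.
by apply/(isbndP e); exists (fibp e' m' t'); rewrite fibp_dif.
Qed.

End FibElements.

(** A cycle of the fibre is a cycle [m] with some [t] bounding [g m]. Injectivity of [g] on homology
    bounds [m], surjectivity corrects [t]. *)
Lemma fib_acyclic M T (g : dghom M T) : qis g <-> acyclic (fib g).
Proof.
split=> [/qisE[gi gs] i z|h].
  have [m [t ->]] := fibP erefl z => /fibp_cyc[cm hm].
  have /(isbndP erefl)[m' hm'] : isbnd m.
    by apply: gi => //; rewrite hm; exact: isbnd_dif.
  have cy : cyc (t - g _ m').
    by apply/(cycP erefl); rewrite difD difN -hm -hom_dif hm' subrr.
  have [y cy' /(isbndP erefl)[t' ht']] := gs _ _ cy.
  apply/(fibp_bnd _ _ erefl); exists (m' + y), (- t').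
  split; first by rewrite difD (cyc_dif cy') addr0.
  by rewrite difN opprK homD -ht' [RHS]addrC -[t - _ - _]addrA -opprD subrK.
apply/qisE; split=> [i m cm /(isbndP erefl)[t ht]|k t ct].
  have /h : cyc (fibp g erefl m t) by apply/fibp_cyc.
  by move=> /(fibp_bnd _ _ erefl)[m' [t' [-> _]]]; exact: isbnd_dif.
have /h : cyc (fibp g (subrK 1 k) 0 t).
  by apply/fibp_cyc; rewrite hom0 (cyc_dif ct); split=> //; exact: cyc0.
move=> /(fibp_bnd _ _ erefl)[m' [t' [hm ht]]].
exists m'; first by apply/(cycP (subrK 1 k)).
by rewrite ht addrAC subrr add0r; apply: isbndN; exact: isbnd_dif.
Qed.

Lemma fib_qis M T (g : dghom M T) : acyclic T -> qis (fib_out g).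
Proof.
move=> aT; apply/qisE; split=> [i z|i m cm].
  have [m [t ->]] := fibP erefl z => /fibp_cyc[cm hm] /(isbndP erefl)[/= m' hm'].
  have /aT/(isbndP erefl)[t' ht'] : cyc (t - g _ m').
    by apply/(cycP erefl); rewrite difD difN -hm -hom_dif hm' subrr.
  apply/(fibp_bnd _ _ erefl); exists m', (- t'); split=> //.
  by rewrite difN opprK -ht' [RHS]addrC subrK.
have /aT/(isbndP erefl)[t ht] := cyc_hom g cm.
exists (fibp g erefl m t); first exact/fibp_cyc.
by rewrite subrr; exact: isbnd0.
Qed.

Section Sums.
Variables X Y : dgmod A.
Definition sum_in1 : dghom X (dgsum X Y).
Proof.
exists (fun i x => (x, 0) : dgsum X Y i) => [i x y|i j k e a x|i j e x].
- by congr (_, _); rewrite addr0.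
- by congr (_, _); rewrite act0r.
- by congr (_, _); rewrite dif0.
Defined.
Definition sum_in2 : dghom Y (dgsum X Y).
Proof.
exists (fun i x => (0, x) : dgsum X Y i) => [i x y|i j k e a x|i j e x].
- by congr (_, _); rewrite addr0.
- by congr (_, _); rewrite act0r.
- by congr (_, _); rewrite dif0.
Defined.
Definition sum_pr1 : dghom (dgsum X Y) X.
Proof. by exists (fun i z => z.1). Defined.
Definition sum_pr2 : dghom (dgsum X Y) Y.
Proof. by exists (fun i z => z.2). Defined.
Definition sum_pair Z (f : dghom Z X) (g : dghom Z Y) : dghom Z (dgsum X Y).
Proof.
exists (fun i z => (f i z, g i z) : dgsum X Y i) => *; congr (_, _);
  by rewrite ?homD ?homM ?hom_dif.
Defined.
Definition sum_copair Z (f : dghom X Z) (g : dghom Y Z) : dghom (dgsum X Y) Z :=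
  dgcomp f sum_pr1 + dgcomp g sum_pr2.

Lemma sum_cyc i (x : X i) (y : Y i) :
  cyc ((x, y) : dgsum X Y i) <-> cyc x /\ cyc y.
Proof.
split=> [h|[hx hy]].
  split; apply/(cycP (subrK 1 i)).
    exact: (congr1 fst (cyc_dif h (subrK 1 i))).
  exact: (congr1 snd (cyc_dif h (subrK 1 i))).
by apply/(cycP (subrK 1 i)); congr (_, _); rewrite /= cyc_dif.
Qed.

Lemma sum_bnd i (x : X i) (y : Y i) :
  isbnd ((x, y) : dgsum X Y i) <-> isbnd x /\ isbnd y.
Proof.
split=> [/(isbndP erefl)[[x' y'] [-> ->]]|]; first by split; exact: isbnd_dif.
move=> [/(isbndP erefl)[x' ->] /(isbndP erefl)[y' ->]].
by exists (i + 1), erefl, (x', y').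
Qed.

Lemma sum_id :
  dgcomp sum_in1 sum_pr1 + dgcomp sum_in2 sum_pr2 = dgid (dgsum X Y).
Proof.
by apply: dghom_ext => i [x y]; rewrite !dghomE /=; congr (_, _); rewrite ?addr0 ?add0r.
Qed.
End Sums.

Lemma sum_in1_qis X Y : acyclic Y -> qis (sum_in1 X Y).
Proof.
move=> aY; apply/qisE; split=> [i x cx /sum_bnd[] //|i [x y] /sum_cyc[cx cy]].
exists x => //; have -> : (x, y) - sum_in1 X Y i x = (0, y) :> dgsum X Y i.
  by congr (_, _); rewrite ?subrr ?subr0.
apply/sum_bnd; split; first exact: isbnd0.
exact: aY.
Qed.

(** The strict lifting property of cofibrant modules. Lifting on the nose is what passes through
    cell attachments and colimits; the properties up to homotopy are derived from it. *)
Definition kproj (P : dgmod A) : Prop := forall (E B : dgmod A) (p : dghom E B),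
  (forall i y, exists x, p i x = y) -> qis p ->
  forall f : dghom P B, exists g : dghom P E, dgcomp p g = f.

(** Adding the path module of [N] to the source makes [q] surjective and changes nothing up to
    homotopy: the path module is acyclic and its projection to [N] is null-homotopic. *)
Lemma kproj_lift P M N (q : dghom M N) : kproj P -> qis q ->
  forall f : dghom P N, exists g : dghom P M, dgcomp q g ~ f.
Proof.
move=> kP hq f.
pose p := sum_copair q (fib_out (dgid N)).
have p_surj i y : exists x, p i x = y.
  by exists (0, fibp (dgid N) erefl y 0); rewrite dghomE !dgcompE /= hom0 add0r.
have p_qis : qis p.
  have aN : acyclic (fib (dgid N)) by apply/fib_acyclic/qis_id.
  apply: (qis2of3l (f := sum_in1 M (fib (dgid N)))); last exact: sum_in1_qis.
  have -> // : dgcomp p (sum_in1 M (fib (dgid N))) = q.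
  by apply: dghom_ext => i x; rewrite /p dgcompE dghomE !dgcompE /= addr0.
have [g hg] := kP _ _ p p_surj p_qis f.
exists (dgcomp (sum_pr1 _ _) g); apply: htp_sym; apply/htp_sub.
have -> : f - dgcomp q (dgcomp (sum_pr1 _ _) g) =
    dgcomp (dgcomp (dgid N) (fib_out (dgid N))) (dgcomp (sum_pr2 _ _) g).
  by rewrite -hg /p /sum_copair compDl -dgcompA addrAC subrr add0r comp1f dgcompA.
by rewrite -(comp0f N (dgcomp (sum_pr2 M (fib (dgid N))) g)); apply/htp_compr/fib_null.
Qed.

(** For acyclic [M] the projection from the path module is a surjective quasi-isomorphism; it is
    null-homotopic, hence so is every map that lifts through it. *)
Lemma kproj_null P M : kproj P -> acyclic M -> forall f : dghom P M, f ~ 0.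
Proof.
move=> kP aM f.
have [|F <-] := kP _ _ (fib_out (dgid M)) _ (fib_qis _ aM) f.
  by move=> i y; exists (fibp (dgid M) erefl y 0).
rewrite -[fib_out _]comp1f -(comp0f M F); apply/htp_compr/fib_null.
Qed.

(** The difference [f - g] lifts to the fibre of [q], which is acyclic. *)
Lemma kproj_inj P M N (q : dghom M N) : kproj P -> qis q ->
  forall f g : dghom P M, dgcomp q f ~ dgcomp q g -> f ~ g.
Proof.
move=> kP /fib_acyclic aq f g h.
have /fib_lift[F hF] : dgcomp q (f - g) ~ 0 by rewrite compBr; exact/(proj1 (htp_sub _ _)).
apply/htp_sub; rewrite -hF -(compf0 P (fib_out q)).
by apply: htp_compl; exact: kproj_null.
Qed.

End Fib.

(** * Cones, shifts and retracts *)

Section ConeExact.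
Variables (A : dgring) (M N : dgmod A) (f : dghom M N).

(** Exactness at the cone: a null-homotopy of the [Sigma M] component, pushed along [f], corrects
    the [N] component into a chain map. *)
Lemma cone_lift B (u : dghom B (cone f)) :
  dgcomp (cone_out f) u ~ 0 -> exists v : dghom B N, dgcomp (cone_in f) v ~ u.
Proof.
move=> [h [hD hM hd]].
have c (i : int) : i + 1 - 1 = i by rewrite addrK.
have hm k l (el : k + 1 = l) y : gcast (cone_idx el) (f (l - 1) (h k l el y)) =
    f k (gcast (X := M) (c k) (h k _ erefl y)).
  by case: l / el; rewrite hom_gcast; exact: gcastE.
unshelve eexists.
  exists (fun i x => (u i x).1 - f i (gcast (X := M) (c i) (h i _ erefl x))) =>
    [i x y|i j k e a x|i j e x].
  - by rewrite homD hD gcastD homD /= opprD addrACA.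
  - have e2 : i + (j + 1) = k + 1 by rewrite addrA e.
    rewrite homM /= (hM _ _ _ _ _ e erefl erefl e2) /=.
    rewrite actDr actNr; congr (_ - _); rewrite mul1r ksign_add.
    rewrite ksign_even; last by lia.
    by rewrite (gcast_act (c j) _ _ e) homM.
  - rewrite hom_dif /= difD difN -addrA; congr (_ + _).
    have := hd _ _ _ erefl e x; rewrite zerofE subr0 dgcompE /= => ->.
    rewrite homD gcastD /ksign /= homN gcastN.
    rewrite (hm _ _ e) addrK -hom_dif; congr (- _).
    rewrite -hom_gcast; congr (f j _).
    by rewrite (gcast_dif (c i) (cone_idx e) (shift_idx1 1 erefl) e).
exists (fun i j e x => (0, - h i j e x)); split.
- by move=> i j e x y; congr (_, _); rewrite ?addr0 // hD opprD.
- move=> i j k j' k' e ej ek e' a x.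
  have act2 z : (act (d := cone f) e' a (0, - z)) = (0, - act (d := dgshift 1 M) e' a z).
    by congr (_, _); [exact: act0r | exact: actNr].
  rewrite act2 (hM _ _ _ _ _ _ ej _ e') /ksign.
  by case: ifP => _; congr (_, _); rewrite ?oppr0.
- move=> i j k ej ek x; congr (_, _).
    by rewrite /= addr0 dif0 add0r homN gcastN addrAC subrr add0r hm.
  have := hd _ _ _ ej ek x; rewrite zerofE subr0 dgcompE => h2.
  change (0 - cone_out f i (u i x) =
    dif (d := dgshift 1 M) ej (- h i j ej x) - h k i ek (dif ek x)).
  by rewrite h2 difN opprD add0r.
Qed.

(** Exactness at [N]: the [Sigma M] component of a null-homotopy into the cone is the factorization,
    and its [N] component is the homotopy that compares it with [u]. *)
Lemma cone_fact B (u : dghom B N) :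
  dgcomp (cone_in f) u ~ 0 -> exists v : dghom B M, dgcomp f v ~ u.
Proof.
move=> [h [hD hM hd]].
have c (i : int) : i + 1 - 1 = i by rewrite addrK.
have hm k l (el : k + 1 = l) y : gcast (cone_idx el) (h k l el y).2 =
    gcast (X := M) (c k) (h k _ erefl y).2.
  by case: l / el; exact: gcastE.
unshelve eexists.
  exists (fun i x => gcast (X := M) (c i) (h i _ erefl x).2) =>
    [i x y|i j k e a x|i j e x].
  - by rewrite hD -gcastD.
  - have e2 : i + (j + 1) = k + 1 by rewrite addrA e.
    rewrite (hM _ _ _ _ _ e erefl erefl e2).
    have -> z : (ksign i z : cone f (k + 1)).2 = ksign i z.2.
      by rewrite /ksign; case: ifP.
    rewrite /= mul1r ksign_add ksign_even; last by lia.
    exact: (gcast_act (c j) _ _ e).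
  - have /(congr1 snd) := hd _ _ _ erefl e x; rewrite zerofE subr0 dgcompE /= => /eqP.
    rewrite eq_sym [X in X == 0]addrC addr_eq0 => /eqP h2.
    rewrite -(hm _ _ e) h2 /ksign /= opprK.
    by rewrite (gcast_dif (c i) (cone_idx e) (shift_idx1 1 erefl) e).
apply: htp_sym; exists (fun i j e x => (h i j e x).1); split.
- by move=> *; rewrite hD.
- move=> i j k j' k' e ej ek e' a x; rewrite (hM _ _ _ _ _ _ ej _ e') /ksign.
  by case: ifP.
- move=> i j k ej ek x; have /(congr1 fst) := hd _ _ _ ej ek x.
  rewrite zerofE subr0 dgcompE /= => h1.
  by rewrite h1 -(hm _ _ ej) hom_gcast addrAC addrK.
Qed.

End ConeExact.

Section Shift.
Variable A : dgring.
Implicit Types X Y V U C : dgmod A.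

Lemma shift_hom_comp n X Y V (g : dghom Y V) (f : dghom X Y) :
  shift_hom n (dgcomp g f) = dgcomp (shift_hom n g) (shift_hom n f).
Proof. exact: dghom_ext. Qed.
Lemma shift_hom_id n X : shift_hom n (dgid X) = dgid (dgshift n X).
Proof. exact: dghom_ext. Qed.

Lemma shift_htp n X Y (f g : dghom X Y) : f ~ g -> shift_hom n f ~ shift_hom n g.
Proof.
move=> [h [hD hM hd]]; exists (fun i j e x => ksign n (h _ _ (shift_idx1 n e) x)); split.
- by move=> *; rewrite hD ksignD.
- move=> i j k j' k' e ej ek e' a x.
  rewrite /= (ksign_map _ _ (add_mapN (hD _ _ _))).
  rewrite (hM _ _ _ _ _ (shift_idx n e) (shift_idx1 n ej) (shift_idx1 n ek) (shift_idx n e')).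
  rewrite (ksign_map _ _ (actNr _ a)) !ksign_add.
  by apply: ksign_congr; lia.
- move=> i j k ej ek x.
  rewrite /= (ksign_map _ _ (difN _)) (ksign_map _ _ (add_mapN (hD _ _ _))).
  rewrite !ksign_add ksign_even; last by lia.
  rewrite ksign_even; last by lia.
  exact: hd.
Qed.

Section ShiftK.
Variables (n m : int) (e0 : n + m = 0).

Lemma shiftK_idx (i : int) : i = i - m - n. Proof. by lia. Qed.

Lemma shiftK_even (W : zmodType) i (x : W) : ksign (m * i + n * i) x = x.
Proof. by rewrite -mulrDl [m + n]addrC e0 mul0r ksign_even. Qed.

Definition shift_in X : dghom X (dgshift m (dgshift n X)).
Proof.
exists (fun i x => gcast (shiftK_idx i) x) => [i x y|i j k e a x|i j e x] /=.
- exact: gcastD.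
- rewrite ksign_add shiftK_even.
  exact: gcast_act.
- rewrite ksign_add ksign_even; last by rewrite addrC e0.
  exact: gcast_dif.
Defined.

Definition shift_out X : dghom (dgshift m (dgshift n X)) X.
Proof.
exists (fun i x => gcast (X := X) (esym (shiftK_idx i)) x) => [i x y|i j k e a x|i j e x] /=.
- exact: gcastD.
- rewrite ksign_add shiftK_even.
  exact: gcast_act.
- rewrite ksign_add ksign_even; last by rewrite addrC e0.
  exact: gcast_dif.
Defined.

Lemma shift_in_nat X Y (f : dghom X Y) :
  dgcomp (shift_hom m (shift_hom n f)) (shift_in X) = dgcomp (shift_in Y) f.
Proof. by apply: dghom_ext => i x /=; rewrite hom_gcast. Qed.
Lemma shift_out_nat X Y (f : dghom X Y) :
  dgcomp (shift_out Y) (shift_hom m (shift_hom n f)) = dgcomp f (shift_out X).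
Proof. by apply: dghom_ext => i x /=; rewrite hom_gcast. Qed.
End ShiftK.

Lemma gcast_shift n X i j (e : i = j) (e' : i - n = j - n) (x : dgshift n X i) :
  gcast e x = gcast (X := X) e' x.
Proof. by case: j / e e' => e'; rewrite !gcast_id. Qed.

(** One of the two triangle identities between the shifts by [n] and by [m]. *)
Lemma shift_tri n m (e : n + m = 0) (e' : m + n = 0) X :
  dgcomp (shift_out e' (dgshift n X)) (shift_hom n (shift_in e X)) = dgid (dgshift n X).
Proof.
apply: dghom_ext => i x /=.
have pf : i - n - m - n = i - n by lia.
by rewrite (gcast_shift _ pf) (gcast_trans _ _ erefl).
Qed.

Lemma shift_tri2 n m (e : n + m = 0) (e' : m + n = 0) X :
  dgcomp (shift_hom n (shift_out e X)) (shift_in e' (dgshift n X)) = dgid (dgshift n X).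
Proof.
apply: dghom_ext => i x /=.
have pf : i - n = i - n - m - n by lia.
by rewrite (gcast_shift _ pf) (gcast_trans _ _ erefl).
Qed.

(** The inverse shift moves the lifting problem to [C] and preserves surjections and
    quasi-isomorphisms. *)
Lemma kproj_shift n C : kproj C -> kproj (dgshift n C).
Proof.
move=> kC E B p p_surj p_qis f.
have [g hg] : exists g, dgcomp (shift_hom (- n) p) g =
    dgcomp (shift_hom (- n) f) (shift_in (addrN n) C).
  by apply: kC; [move=> i y; exact: p_surj | exact: qis_shift].
exists (dgcomp (shift_out (addNr n) E) (shift_hom n g)).
rewrite dgcompA -(shift_out_nat (addNr n)) -dgcompA -shift_hom_comp hg.
by rewrite shift_hom_comp dgcompA shift_out_nat -dgcompA shift_tri compf1.
Qed.

End Shift.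

(** * Retracts in the derived category, tested on K-projective modules *)

Section Retract.
Variable A : dgring.
Implicit Types X Y V U C : dgmod A.

(* A morphism V -> U of the derived category, recorded through its action on the
   homotopy classes of maps from K-projective modules. *)
Record nat_map V U := NatMap {
  nmap :> forall C, kproj C -> dghom C V -> dghom C U;
  nmap_htp : forall C (kC : kproj C) f g, f ~ g -> nmap kC f ~ nmap kC g;
  nmap_comp : forall C C' (kC : kproj C) (kC' : kproj C') (u : dghom C' C) f,
    nmap kC' (dgcomp f u) ~ dgcomp (nmap kC f) u }.

Definition retract V U : Prop := exists (i : nat_map V U) (r : nat_map U V),
  forall C (kC : kproj C) f, r C kC (i C kC f) ~ f.

Definition nat_hom V U (g : dghom V U) : nat_map V U.
Proof.
exists (fun C _ f => dgcomp g f) => [C _ f f'|C C' _ _ u f]; first exact: htp_compl.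
rewrite dgcompA; exact: htp_refl.
Defined.

Definition nat_comp V U W (j : nat_map U W) (i : nat_map V U) : nat_map V W.
Proof.
exists (fun C kC f => j C kC (i C kC f)) => [C kC f f' h|C C' kC kC' u f].
  exact/nmap_htp/nmap_htp.
apply: htp_trans (nmap_comp j kC kC' u _); apply: nmap_htp; exact: nmap_comp.
Defined.

Section Lift.
Variables (V U : dgmod A) (q : dghom V U) (hq : qis q).
Definition qlift C (kC : kproj C) (f : dghom C U) : dghom C V :=
  projT1 (cid (kproj_lift kC hq f)).
Lemma qliftP C (kC : kproj C) f : dgcomp q (qlift kC f) ~ f.
Proof. by rewrite /qlift; case: cid. Qed.

Definition nat_lift : nat_map U V.
Proof.
exists qlift => [C kC f g h|C C' kC kC' u f]; apply: (kproj_inj _ hq) => //.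
  apply: htp_trans (qliftP kC f) _; apply: htp_trans h _; exact/htp_sym/qliftP.
apply: htp_trans (qliftP _ _) _; rewrite dgcompA; apply: htp_compr.
exact/htp_sym/qliftP.
Defined.
End Lift.

Lemma retract_qis V U (q : dghom V U) : qis q -> retract U V.
Proof.
move=> hq; exists (nat_lift hq), (nat_hom q) => C kC f; exact: qliftP.
Qed.
Lemma retract_hom V U (i : dghom V U) (r : dghom U V) :
  dgcomp r i = dgid V -> retract V U.
Proof.
move=> ri; exists (nat_hom i), (nat_hom r) => C kC f /=.
rewrite dgcompA ri comp1f; exact: htp_refl.
Qed.
Lemma retract_refl V : retract V V.
Proof. by apply: (retract_hom (i := dgid V) (r := dgid V)); rewrite comp1f. Qed.

Lemma retract_trans U V W : retract V U -> retract U W -> retract V W.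
Proof.
move=> [i [r ri]] [j [s sj]]; exists (nat_comp j i), (nat_comp r s) => C kC f /=.
apply: htp_trans (ri C kC f); apply: nmap_htp; exact: sj.
Qed.

Definition nat_roof V U (F : roof V U) : nat_map V U :=
  nat_comp (nat_hom (rnum F)) (nat_lift (rqis F)).

Lemma nat_roofE V U (F : roof V U) C (kC : kproj C) f l :
  dgcomp (rden F) l ~ f -> nat_roof F C kC f ~ dgcomp (rnum F) l.
Proof.
move=> h; apply: htp_compl; apply: (kproj_inj kC (rqis F)).
exact: htp_trans (qliftP _ _ _) (htp_sym h).
Qed.

Lemma retract_roof V U (F : roof V U) (G : roof U V) :
  roof_comp F G (roof_hom (dgid V)) -> retract V U.
Proof.
move=> [W [u [v [qu [huv [W' [u' [v' /= [q1 h1 h2]]]]]]]]].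
exists (nat_roof F), (nat_roof G) => C kC f.
rewrite comp1f in h1; rewrite comp1f in h2.
(* [v'] is homotopic to the composite of the denominators, hence a quasi-isomorphism; a single lift
   [l] along it evaluates both roofs. *)
have [l hl] := kproj_lift kC (qis_htp h1 q1) f.
have eF : nat_roof F C kC f ~ dgcomp (rnum F) (dgcomp u (dgcomp u' l)).
  apply: nat_roofE; apply: htp_trans hl; rewrite !dgcompA; exact: htp_compr.
have eG : nat_roof G C kC (nat_roof F C kC f) ~ dgcomp (rnum G) (dgcomp v (dgcomp u' l)).
  apply: nat_roofE; apply: htp_sym; apply: htp_trans eF _.
  by rewrite !dgcompA; do 2!apply: htp_compr.
apply: htp_trans eG _; apply: htp_trans hl.
by rewrite !dgcompA; exact: htp_compr.
Qed.

Lemma retract_iso V U (F : roof V U) : roof_iso F -> retract V U /\ retract U V.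
Proof. by move=> [G [FG GF]]; split; [exact: retract_roof FG|exact: retract_roof GF]. Qed.

Lemma sum_pr1K X Y C (f : dghom C X) (g : dghom C Y) :
  dgcomp (sum_pr1 X Y) (sum_pair f g) = f.
Proof. exact: dghom_ext. Qed.
Lemma sum_pr2K X Y C (f : dghom C X) (g : dghom C Y) :
  dgcomp (sum_pr2 X Y) (sum_pair f g) = g.
Proof. exact: dghom_ext. Qed.
Lemma sum_pair_comp X Y C D (f : dghom C X) (g : dghom C Y) (u : dghom D C) :
  dgcomp (sum_pair f g) u = sum_pair (dgcomp f u) (dgcomp g u).
Proof. exact: dghom_ext. Qed.

Lemma sum_pair_htp X Y C (f f' : dghom C X) (g g' : dghom C Y) :
  f ~ f' -> g ~ g' -> sum_pair f g ~ sum_pair f' g'.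
Proof.
have e a b : sum_pair a b = dgcomp (sum_in1 X Y) a + dgcomp (sum_in2 X Y) b :> dghom C _.
  by apply: dghom_ext => i x; rewrite !dghomE /=; congr (_, _); rewrite ?addr0 ?add0r.
by move=> h k; rewrite !e; apply: htpD; exact: htp_compl.
Qed.

Definition nat_sum X1 X2 Y1 Y2 (i1 : nat_map X1 Y1) (i2 : nat_map X2 Y2) :
  nat_map (dgsum X1 X2) (dgsum Y1 Y2).
Proof.
exists (fun C kC f => sum_pair (i1 C kC (dgcomp (sum_pr1 X1 X2) f))
                              (i2 C kC (dgcomp (sum_pr2 X1 X2) f))).
  by move=> C kC f g h; apply: sum_pair_htp; apply: nmap_htp; exact: htp_compl.
move=> C C' kC kC' u f; rewrite sum_pair_comp.
by apply: sum_pair_htp; rewrite !dgcompA; exact: nmap_comp.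
Defined.

Lemma retract_sum V1 V2 U1 U2 : retract V1 U1 -> retract V2 U2 ->
  retract (dgsum V1 V2) (dgsum U1 U2).
Proof.
move=> [i1 [r1 ri1]] [i2 [r2 ri2]].
exists (nat_sum i1 i2), (nat_sum r1 r2) => C kC f; rewrite /= sum_pr1K sum_pr2K.
have e : sum_pair (dgcomp (sum_pr1 _ _) f) (dgcomp (sum_pr2 _ _) f) = f.
  by apply: dghom_ext => i x /=; rewrite -surjective_pairing.
by rewrite -[X in homotopic _ X]e; apply: sum_pair_htp; [exact: ri1 | exact: ri2].
Qed.

(** Conjugation by the shift: a map from [C] to the shift of [X] corresponds to a map to [X] from
    [C] shifted by [- n], to which [i] applies. *)
Definition nat_shift n X Y (i : nat_map X Y) : nat_map (dgshift n X) (dgshift n Y).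
Proof.
exists (fun C kC f => dgcomp (shift_hom n (i _ (kproj_shift (n := - n) kC)
    (dgcomp (shift_out (addrN n) X) (shift_hom (- n) f)))) (shift_in (addNr n) C)).
  by move=> C kC f g h; apply/htp_compr/shift_htp/nmap_htp/htp_compl/shift_htp.
move=> C C' kC kC' u f.
rewrite -dgcompA -(shift_in_nat (addNr n) u) dgcompA -shift_hom_comp.
apply/htp_compr/shift_htp; rewrite shift_hom_comp dgcompA; exact: nmap_comp.
Defined.

Lemma retract_shift n V U : retract V U -> retract (dgshift n V) (dgshift n U).
Proof.
move=> [i [r ri]]; exists (nat_shift n i), (nat_shift n r) => C kC f /=.
set g := dgcomp (shift_out _ V) _.
rewrite shift_hom_comp dgcompA shift_out_nat -dgcompA shift_tri compf1.
have e : dgcomp (shift_hom n g) (shift_in (addNr n) C) = f.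
  by rewrite /g shift_hom_comp -dgcompA shift_in_nat dgcompA shift_tri2 comp1f //.
rewrite -[X in homotopic _ X]e; apply/htp_compr/shift_htp; exact: ri.
Qed.
End Retract.

(** * Localization *)

Section Scale.
Variable A : dgring.
Implicit Types X Y : dgmod A.

(** Denominators are cleared by composing with these endomorphisms, which move freely past chain
    maps. *)
Definition dgscale X (a : ring0 A) : dghom X X.
Proof.
exists (fun i x => act (add0r i) a x) => [i x y|i j k e b x|i j e x].
- exact: actDr.
- have := act_scale0r (X := X) e b a x.
  by rewrite /GRing.scale /= => ->.
- by rewrite (dif_act0 (X := X) (add0r i) (add0r j)).
Defined.

Lemma dgscaleE X (a : ring0 A) i (e : 0 + i = i) (x : X i) :
  dgscale X a i x = act e a x.
Proof. by rewrite /= (eq_irrelevance e (add0r i)). Qed.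

Lemma dgscale_nat X Y (f : dghom X Y) a :
  dgcomp f (dgscale X a) = dgcomp (dgscale Y a) f.
Proof. by apply: dghom_ext => i x /=; rewrite homM. Qed.

Lemma dgscale_hom X Y (f : dghom X Y) a i x : f i (dgscale X a i x) = dgscale Y a i (f i x).
Proof. exact: homM. Qed.

Lemma dgscaleM X a b : dgscale X (a * b) = dgcomp (dgscale X a) (dgscale X b).
Proof. by apply: dghom_ext => i x; exact: actA. Qed.
Lemma dgscaleC X a b i x :
  dgscale X a i (dgscale X b i x) = dgscale X b i (dgscale X a i x).
Proof. by rewrite -!dgcompE -!dgscaleM mulrC. Qed.
Lemma dgscale1 X : dgscale X 1 = dgid X.
Proof. by apply: dghom_ext => i x; exact: act1. Qed.

Lemma isbnd_scale X a i (x : X i) : isbnd x -> isbnd (dgscale X a i x).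
Proof. exact: isbnd_hom. Qed.

End Scale.

Section Loc.
Variables (A : dgring) (S : multset (ring0 A)).
Implicit Types X Y Z : dgmod A.
Local Notation AS := (loc_dgring S).
Local Notation "X '_S'" := (loc_dgmod S X) (at level 2, format "X '_S'").

Definition fr X i (x : X i) (s : set_type S) : X _S i := frac (x : mod0 X i) s.

Lemma frP X i (z : X _S i) : exists x s, z = fr x s.
Proof. exact: (@fracP _ S (mod0 X i) z). Qed.

Lemma frE X i (x y : X i) s t : fr x s = fr y t <->
  exists2 u, mset S u & dgscale X (u * den t) i x = dgscale X (u * den s) i y.
Proof.
rewrite /fr frac_eq; split=> -[u Su h]; exists u => //; move: h.
  by rewrite !scalerA.
by rewrite !scalerA.
Qed.

Lemma fr_eq0 X i (x : X i) s : fr x s = 0 <-> exists2 u, mset S u & dgscale X u i x = 0.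
Proof.
have -> : (0 : X _S i) = fr 0 (den1 S) by rewrite /fr frac0.
rewrite frE; split=> -[u Su]; last first.
  by move=> h; exists u => //; rewrite den_den1 mulr1 h hom0.
by rewrite den_den1 mulr1 hom0 => h; exists u.
Qed.

Lemma frD X i (x y : X i) s : fr (x + y) s = fr x s + fr y s.
Proof. exact: (@fracDr _ S (mod0 X i)). Qed.
Lemma frN X i (x : X i) s : fr (- x) s = - fr x s.
Proof. by rewrite /fr -fracN. Qed.
Lemma fr_dif X i j (e : j + 1 = i) (x : X i) s : dif e (fr x s) = fr (dif e x) s.
Proof. exact: (@ldifE _ S X). Qed.
Lemma fr_act X i j k (e : i + j = k) (a : A i) (x : X j) s t :
  act e (fr (X := dgself A) a s : AS i) (fr x t) = fr (act e a x) (denM s t).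
Proof. exact: (@lactE _ S X). Qed.
Lemma fr_common X i (z w : X _S i) : exists x y s, z = fr x s /\ w = fr y s.
Proof. exact: (@loc_common _ S (mod0 X i) z w). Qed.
Lemma fr_mul X i (x : X i) s t : fr x s = fr (dgscale X (den t) i x) (denM t s).
Proof. exact: (@frac_mul _ S (mod0 X i)). Qed.

Lemma fr_cyc X i (x : X i) s : cyc (fr x s) <-> exists2 u, mset S u & cyc (dgscale X u i x).
Proof.
rewrite (cycP (subrK 1 i)) fr_dif fr_eq0.
by split=> -[u Su h]; exists u => //; [apply/(cycP (subrK 1 i)); rewrite -hom_dif|
  rewrite hom_dif; exact: cyc_dif].
Qed.

Lemma fr_bnd X i (x : X i) s : isbnd (fr x s) <-> exists2 u, mset S u & isbnd (dgscale X u i x).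
Proof.
split=> [/(isbndP erefl)[z]|[u Su /(isbndP erefl)[y hy]]].
  have [y [t ->]] := frP z; rewrite fr_dif => /frE[u Su h].
  exists (u * den t); first by apply: msetM => //; exact: denP.
  by rewrite h hom_dif; exact: isbnd_dif.
pose v : set_type S := exist _ u (mem_set Su).
have hv : dgscale X (den v) i x = dif erefl y := hy.
rewrite (fr_mul x s v) hv -fr_dif; exact: isbnd_dif.
Qed.

Lemma scalableP X Y (f : dghom X Y) i : scalable (f i : mod0 X i -> mod0 Y i).
Proof. by move=> a x; exact: homM. Qed.

Definition locf X Y (f : dghom X Y) i : X _S i -> Y _S i :=
  loc_map (M := mod0 X i) (N := mod0 Y i) (f i).

Lemma locfE X Y (f : dghom X Y) i x s : locf f (fr x s) = fr (f i x) s.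
Proof. exact: (@loc_mapE _ S (mod0 X i) (mod0 Y i) _ (@scalableP _ _ f i)). Qed.

Definition loc_hom X Y (f : dghom X Y) : dghom X _S Y _S.
Proof.
exists (locf f) => [i z w|i j k e a z|i j e z].
- by have [x [y [s [-> ->]]]] := fr_common z w; rewrite -frD !locfE homD frD.
- have [x [s ->]] := frP z; have [b [t ->]] := frP (X := dgself A) a.
  by rewrite fr_act !locfE homM fr_act.
- by have [x [s ->]] := frP z; rewrite fr_dif !locfE hom_dif fr_dif.
Defined.

Lemma loc_homE X Y (f : dghom X Y) i x s : loc_hom f i (fr x s) = fr (f i x) s.
Proof. exact: locfE. Qed.

Lemma loc_ext X (Y : dgmod AS) (f g : dghom X _S Y) :
  (forall i x s, f i (fr x s) = g i (fr x s)) -> f = g.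
Proof. by move=> h; apply: dghom_ext => i z; have [x [s ->]] := frP z. Qed.

Lemma loc_hom_comp X Y Z (g : dghom Y Z) (f : dghom X Y) :
  loc_hom (dgcomp g f) = dgcomp (loc_hom g) (loc_hom f).
Proof. by apply: loc_ext => i x s; rewrite dgcompE !loc_homE. Qed.
Lemma loc_hom_id X : loc_hom (dgid X) = dgid X _S.
Proof. by apply: loc_ext => i x s; rewrite !loc_homE. Qed.
Lemma loc_homD X Y (f g : dghom X Y) : loc_hom (f + g) = loc_hom f + loc_hom g.
Proof. by apply: loc_ext => i x s; rewrite addfE !loc_homE frD. Qed.
Lemma loc_homN X Y (f : dghom X Y) : loc_hom (- f) = - loc_hom f.
Proof. by apply: loc_ext => i x s; rewrite oppfE !loc_homE frN. Qed.
Lemma loc_hom0 X Y : loc_hom (0 : dghom X Y) = 0.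
Proof. by apply: loc_ext => i x s; rewrite loc_homE /fr frac0. Qed.

Lemma loc_htp X Y (f g : dghom X Y) : f ~ g -> loc_hom f ~ loc_hom g.
Proof.
move=> [h [hD hM hd]].
have hZ i j (e : i + 1 = j) : scalable (h i j e : mod0 X i -> mod0 Y j).
  by move=> a x; rewrite {1}/GRing.scale /= /scale0 (hM _ _ _ _ _ _ e e (add0r j)).
pose H i j (e : i + 1 = j) : X _S i -> Y _S j :=
  loc_map (M := mod0 X i) (N := mod0 Y j) (h i j e).
have HE i j e x s : H i j e (fr x s) = fr (h i j e x) s by exact/loc_mapE/hZ.
exists H; split.
- by move=> i j e z w; have [x [y [s [-> ->]]]] := fr_common z w; rewrite -frD !HE hD frD.
- move=> i j k j' k' e ej ek e' a z.
  have [x [s ->]] := frP z; have [b [t ->]] := frP (X := dgself A) a.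
  rewrite fr_act !HE (hM _ _ _ _ _ _ ej _ e') fr_act.
  by rewrite /ksign; case: ifP; rewrite ?frN.
- move=> i j k ej ek z; have [x [s ->]] := frP z.
  by rewrite fr_dif !HE fr_dif !loc_homE -frN -!frD (hd _ _ _ ej ek).
Qed.

(** Homology commutes with localization, so both halves need hold only up to a factor from [S]; they
    are stated over [A], where elements carry no denominators. *)
Lemma loc_qis X Y (f : dghom X Y) :
  (forall i x, cyc x -> isbnd (f i x) -> exists2 u, mset S u & isbnd (dgscale X u i x)) ->
  (forall i y, cyc y -> exists2 u, mset S u &
     exists2 x, cyc x & isbnd (dgscale Y u i y - f i x)) ->
  qis (loc_hom f).
Proof.
move=> fi fs; apply/qisE; split=> i z; have [x [s ->]] := frP z.
  rewrite loc_homE => /fr_cyc[u Su cu] /fr_bnd[v Sv bv].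
  have [|w Sw] := fi _ (dgscale X v i (dgscale X u i x)) (cyc_hom _ cu).
    by rewrite dgscaleC 2!(dgscale_hom f); exact: isbnd_scale.
  move=> h; apply/fr_bnd; exists (w * (v * u)).
    by apply: msetM => //; exact: msetM.
  by rewrite !dgscaleM.
move=> /fr_cyc[u Su /fs[v Sv [y cy hy]]].
pose t : set_type S := exist _ (v * u) (mem_set (msetM Sv Su)).
exists (fr y (denM t s)); first by apply/fr_cyc; exists 1; [exact: mset1|rewrite dgscale1].
have -> : fr x s = fr (dgscale Y v i (dgscale Y u i x)) (denM t s).
  by rewrite -dgcompE -dgscaleM; exact: (fr_mul x s t).
rewrite loc_homE -frN -frD; apply/fr_bnd.
by exists 1; [exact: mset1 | rewrite dgscale1].
Qed.

Lemma loc_qis0 X Y (f : dghom X Y) : qis f -> qis (loc_hom f).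
Proof.
move=> /qisE[fi fs]; apply: loc_qis => [i x cx /fi h|i y /fs[x cx h]];
  exists 1; rewrite ?dgscale1; try exact: mset1; first exact: h.
by exists x.
Qed.

Lemma loc_acyclic X : acyclic X -> acyclic X _S.
Proof.
move=> aX i z; have [x [s ->]] := frP z => /fr_cyc[u Su /aX h].
by apply/fr_bnd; exists u.
Qed.

Definition fr0 (a : ring0 A) (s : set_type S) : ring0 AS :=
  fr (X := dgself A) (a : A 0) s.

Lemma loc_dgscale X a : loc_hom (dgscale X a) =
  dgscale X _S (fr0 a (den1 S)).
Proof.
apply: loc_ext => i x s; rewrite loc_homE (dgscaleE _ (add0r i)); apply/esym.
apply: etrans (fr_act (add0r i) (a : A 0) x (den1 S) s) _; by rewrite den1M.
Qed.

Lemma fr0K (s : set_type S) : fr0 (den s) (den1 S) * fr0 1 s = 1.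
Proof.
rewrite (ring0M _ _ (addr0 0)).
apply: etrans (fr_act (X := dgself A) (addr0 0) (den s : A 0) (rone A) (den1 S) s) _.
apply/frE; exists 1; first exact: mset1.
rewrite den1M den_den1 mulr1 mul1r dgscale1 /=.
by rewrite (rmulC _ (addr0 0)) ksign_even // rmul1 (rmulC _ (addr0 0)) ksign_even // rmul1.
Qed.

End Loc.

(** * Extension and restriction of scalars along the localization *)

Section Restriction.
Variables (A : dgring) (S : multset (ring0 A)).
Implicit Types X Y Z : dgmod A.
Local Notation AS := (loc_dgring S).
Local Notation "X '_S'" := (loc_dgmod S X) (at level 2, format "X '_S'").
Implicit Types V U : dgmod AS.

Definition fr1 i (a : A i) : AS i := fr (X := dgself A) a (den1 S).

Lemma fr1D i (a b : A i) : fr1 (a + b) = fr1 a + fr1 b.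
Proof. exact: (frD (X := dgself A)). Qed.
Lemma fr1M i j k (e : i + j = k) (a : A i) (b : A j) :
  fr1 (rmul e a b) = rmul e (fr1 a) (fr1 b).
Proof.
apply/esym; apply: etrans (fr_act (X := dgself A) e a b (den1 S) (den1 S)) _.
by rewrite den1M.
Qed.
Lemma fr1_dif i j (e : j + 1 = i) (a : A i) : rdif e (fr1 a) = fr1 (rdif e a).
Proof. exact: (fr_dif (X := dgself A)). Qed.

(** The right adjoint of localization, with [flat] and [sharp] as the two directions of the
    adjunction: a map out of [X_S] is handled as a map out of [X]. *)
Definition res V : dgmod A.
Proof.
apply: (@DGMod A V (fun i j k e a x => act e (fr1 a) x) (@dif _ V)).
- by move=> *; rewrite fr1D actDl.
- by move=> *; rewrite actDr.
- by move=> i j k ij jk l e1 e2 e3 e4 a b x; rewrite fr1M; exact: actA.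
- by move=> i e x; exact: act1.
- exact: difD.
- exact: dif_dif.
- move=> i j k i' j' k' e ei ej ek e1 e2 a x.
  by rewrite -fr1_dif; exact: leibniz.
Defined.

Definition res_hom V U (f : dghom V U) : dghom (res V) (res U).
Proof.
apply: (@DGHom _ (res V) (res U) (fun i (x : V i) => (f i x : U i))) => [i x y|i j k e a x|i j e x];
  [exact: (homD f)|exact: (homM f)|exact: (hom_dif f)].
Defined.

Lemma res_qis V U (f : dghom V U) : qis f -> qis (res_hom f).
Proof. by move=> /qisE h; apply/qisE. Qed.

Definition flat X V (f : dghom X _S V) : dghom X (res V).
Proof.
exists (fun i x => f i (fr x (den1 S))) => [i x y|i j k e a x|i j e x].
- by rewrite frD homD.
- rewrite -[RHS]homM; congr (f k _).
  by apply/esym; apply: etrans (fr_act _ _ _ _ _) _; rewrite den1M.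
- by rewrite -fr_dif hom_dif.
Defined.

Lemma fr0M a b : fr0 (S := S) (a * b) (den1 S) = fr0 a (den1 S) * fr0 b (den1 S).
Proof. by rewrite !(ring0M _ _ (addr0 0)); exact: fr1M. Qed.

Section Ext.
Variables (X : dgmod A) (V : dgmod AS) (i j : int) (h : X i -> V j).
Hypothesis hD : forall x y, h (x + y) = h x + h y.
Hypothesis hZ : forall a x, h (dgscale X a i x) = dgscale V (fr0 a (den1 S)) j (h x).

(** The only possible extension to fractions, [x / s] to [(1 / s) h x]. It concerns a single map
    between two degrees, so that chain maps and homotopies can share it. *)
Definition ext (z : X _S i) : V j :=
  dgscale V (fr0 1 (repr z).2) j (h (repr z).1).

Lemma extE x s : ext (fr x s) = dgscale V (fr0 1 s) j (h x).
Proof.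
rewrite /ext; set x' := (repr _).1; set s' := (repr _).2.
have /frE[u Su e] : fr x' s' = fr x s.
  by rewrite /x' /s' /fr /frac -surjective_pairing reprK.
pose v : set_type S := exist _ u (mem_set Su).
have {}e : dgscale V (fr0 (den v * den s) (den1 S)) j (h x') =
           dgscale V (fr0 (den v * den s') (den1 S)) j (h x) by rewrite -!hZ e.
(* Multiplying by the inverses of [v], [s] and [s'] leaves the factor [1 / s'] on the left and
   [1 / s] on the right. *)
have := congr1 (dgscale V (fr0 1 v * fr0 1 s * fr0 1 s') j) e.
rewrite !fr0M -!dgcompE -!dgscaleM.
have key (t t' : set_type S) : fr0 1 v * fr0 1 t * fr0 1 t' *
    (fr0 (den v) (den1 S) * fr0 (den t) (den1 S)) = fr0 1 t'.
  transitivity ((fr0 (den v) (den1 S) * fr0 1 v) *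
    (fr0 (den t) (den1 S) * fr0 1 t) * fr0 1 t'); first by ring.
  by rewrite !fr0K !mul1r.
by rewrite key [fr0 1 v * _ * _]mulrAC key.
Qed.

Lemma extD z w : ext (z + w) = ext z + ext w.
Proof.
have [x [y [s [-> ->]]]] := fr_common z w.
by rewrite -frD !extE hD homD.
Qed.
End Ext.

Lemma fr_split X i (x : X i) s :
  fr x s = dgscale X _S (fr0 1 s) i (fr x (den1 S)).
Proof.
apply/esym; apply: etrans (fr_act (add0r i) _ x s (den1 S)) _.
by rewrite denMC den1M act1.
Qed.

Lemma loc_ext1 X V (f g : dghom X _S V) :
  (forall i x, f i (fr x (den1 S)) = g i (fr x (den1 S))) -> f = g.
Proof. by move=> h; apply: loc_ext => i x s; rewrite fr_split !dgscale_hom h. Qed.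

Lemma fr_split_alg i (a : A i) s (e : 0 + i = i) :
  fr (X := dgself A) a s = rmul e (fr0 1 s) (fr1 a) :> AS i.
Proof.
rewrite (eq_irrelevance e (add0r i)); exact: (fr_split (X := dgself A)).
Qed.

Definition semilin X V i j (h : X i -> V j) : Prop :=
  forall a x, h (dgscale X a i x) = dgscale V (fr0 a (den1 S)) j (h x).

(** The exponent [m] is 0 for chain maps and the degree [i] of the scalar for homotopies. *)
Lemma ext_act X V m i j k j' k' (e : i + j = k) (e' : i + j' = k')
    (h : X j -> V j') (h' : X k -> V k') : semilin h -> semilin h' ->
  (forall a x, h' (act e a x) = ksign m (act e' (fr1 a) (h x))) ->
  forall (a : AS i) (z : X _S j),
    ext h' (act e a z) = ksign m (act e' a (ext h z)).
Proof.
move=> hZ hZ' H a z.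
have [x [s ->]] := frP z; have [b [t ->]] := frP (X := dgself A) a.
rewrite fr_act (extE hZ) (extE hZ') H.
rewrite (ksign_map _ _ (@homN _ _ _ (dgscale V (fr0 1 (denM t s))) _)); congr ksign.
have -> : fr0 1 (denM t s) = fr0 1 t * fr0 1 s :> ring0 AS.
  by rewrite (ring0M _ _ (addr0 0)); apply/esym; apply: etrans
    (fr_act (X := dgself A) (addr0 0) (rone A) (rone A) t s) _; rewrite act1.
rewrite (fr_split_alg _ _ (add0r i)).
by rewrite (actA _ _ e' (add0r k')) dgscaleM dgcompE (homM (dgscale V (fr0 1 s))).
Qed.

Lemma ext_dif X V m i j k l (ei : k + 1 = i) (ej : l + 1 = j)
    (h : X i -> V j) (h' : X k -> V l) : semilin h -> semilin h' ->
  (forall x, h' (dif ei x) = ksign m (dif ej (h x))) ->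
  forall z : X _S i, ext h' (dif ei z) = ksign m (dif ej (ext h z)).
Proof.
move=> hZ hZ' H z; have [x [s ->]] := frP z.
rewrite fr_dif (extE hZ) (extE hZ') H.
by rewrite (ksign_map _ _ (@homN _ _ _ (dgscale V (fr0 1 s)) _)) hom_dif.
Qed.

Section Sharp.
Variables (X : dgmod A) (V : dgmod AS).

Lemma semilin_hom (g : dghom X (res V)) i : semilin (V := V) (g i).
Proof. by move=> a x; exact: (homM g (add0r i) a x). Qed.

Definition sharp (g : dghom X (res V)) : dghom X _S V.
Proof.
exists (fun i z => ext (V := V) (g i) z) => [i z w|i j k e a z|i j e z].
- by apply: extD => [x y|]; [exact: (homD g)|exact: semilin_hom].
- apply: (ext_act (m := 0) (h := g j) (h' := g k)); try exact: semilin_hom.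
  by move=> b x; exact: (homM g).
- apply: (ext_dif (m := 0) (h := g i) (h' := g j)); try exact: semilin_hom.
  by move=> x; exact: (hom_dif g).
Defined.

Lemma sharpE (g : dghom X (res V)) i x : sharp g i (fr x (den1 S)) = g i x.
Proof.
rewrite (_ : sharp g i _ = ext (V := V) (g i) (fr x (den1 S))) //.
rewrite extE; last exact: semilin_hom.
by rewrite -[LHS]/(act (add0r i) (rone AS) (g i x)) act1.
Qed.

Lemma flatK (f : dghom X _S V) : sharp (flat f) = f.
Proof. by apply: loc_ext1 => i x; rewrite sharpE. Qed.
(** A homotopy out of [X_S] restricts along [X -> X_S]; conversely a homotopy from [X] to the
    restriction of [V] is semilinear and extends to fractions. *)
Lemma flat_htp (f g : dghom X _S V) : f ~ g <-> flat f ~ flat g.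
Proof.
split=> -[h [hD hM hd]].
  exists (fun i j e x => h i j e (fr x (den1 S))); split.
  - by move=> i j e x y; rewrite frD hD.
  - move=> i j k j' k' e ej ek e' a x /=.
    rewrite -(hM _ _ _ _ _ e _ ek); congr h.
    by apply/esym; apply: etrans (fr_act _ _ _ _ _) _; rewrite den1M.
  - by move=> i j k ej ek x; rewrite -fr_dif; exact: hd.
have hZ i j (e : i + 1 = j) : semilin (V := V) (h i j e).
  by move=> a x; apply: etrans (hM _ _ _ _ _ (add0r i) e e (add0r j) a x) _.
exists (fun i j e z => ext (V := V) (h i j e) z); split.
- by move=> i j e z w; apply: extD => [x y|]; [exact: hD|exact: hZ].
- move=> i j k j' k' e ej ek e' a z; apply: ext_act; try exact: hZ.
  by move=> b x; rewrite (hM _ _ _ _ _ _ ej _ e').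
- move=> i j k ej ek z; have [x [s ->]] := frP z.
  rewrite fr_dif !extE; try exact: hZ.
  rewrite fr_split !dgscale_hom -homB -!(hom_dif (dgscale _ _)) -homD; congr (dgscale _ _ _ _).
  exact: hd.
Qed.
End Sharp.

Lemma flat_comp X Y V (g : dghom Y _S V) (f : dghom X Y) :
  flat (dgcomp g (loc_hom S f)) = dgcomp (flat g) f.
Proof. by apply: dghom_ext => i x /=; rewrite -loc_homE. Qed.
Definition loc_unit X : dghom X (res X _S) := flat (dgid X _S).

Lemma flat_loc X Y (f : dghom X Y) : flat (loc_hom S f) = dgcomp (loc_unit Y) f.
Proof. by apply: dghom_ext => i x; exact: loc_homE. Qed.

(** Localization is left adjoint to restriction, and restriction preserves surjective
    quasi-isomorphisms. *)
Lemma kproj_loc P : kproj P -> kproj P _S.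
Proof.
move=> kP E B p ps pq f.
have [g hg] := kP _ _ (res_hom p) ps (res_qis pq) (flat f).
exists (sharp g); rewrite -[RHS]flatK -hg.
by apply: loc_ext1 => i x; rewrite dgcompE !sharpE.
Qed.

Section Comparison.
Variables X Y : dgmod A.

Lemma loc_sum_iso1 : dgcomp
  (sum_copair (loc_hom S (sum_in1 X Y)) (loc_hom S (sum_in2 X Y)))
  (sum_pair (loc_hom S (sum_pr1 X Y)) (loc_hom S (sum_pr2 X Y))) = dgid (dgsum X Y) _S.
Proof.
rewrite compDl -!dgcompA sum_pr1K sum_pr2K -!loc_hom_comp -loc_homD sum_id.
exact: loc_hom_id.
Qed.

Lemma loc_sum_iso2 : dgcomp
  (sum_pair (loc_hom S (sum_pr1 X Y)) (loc_hom S (sum_pr2 X Y)))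
  (sum_copair (loc_hom S (sum_in1 X Y)) (loc_hom S (sum_in2 X Y))) = dgid (dgsum X _S Y _S).
Proof.
have e11 : dgcomp (sum_pr1 X Y) (sum_in1 X Y) = dgid X by exact: dghom_ext.
have e12 : dgcomp (sum_pr1 X Y) (sum_in2 X Y) = 0 by exact: dghom_ext.
have e21 : dgcomp (sum_pr2 X Y) (sum_in1 X Y) = 0 by exact: dghom_ext.
have e22 : dgcomp (sum_pr2 X Y) (sum_in2 X Y) = dgid Y by exact: dghom_ext.
rewrite sum_pair_comp !compDr !dgcompA -!loc_hom_comp e11 e12 e21 e22.
rewrite !loc_hom0 !loc_hom_id !comp0f !comp1f addr0 add0r.
by apply: dghom_ext => i x; rewrite [RHS]surjective_pairing.
Qed.

Lemma loc_sum_qis : qis (sum_pair (loc_hom S (sum_pr1 X Y)) (loc_hom S (sum_pr2 X Y))).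
Proof.
apply: qis_bij => i.
  move=> x y h; rewrite -[x]/(dgid _ i x) -[y]/(dgid _ i y) -loc_sum_iso1.
  by rewrite !dgcompE h.
move=> y; exists (sum_copair (loc_hom S (sum_in1 X Y)) (loc_hom S (sum_in2 X Y)) i y).
by rewrite -dgcompE loc_sum_iso2.
Qed.

Lemma retract_loc_sum : retract (dgsum X _S Y _S) (dgsum X Y) _S.
Proof. exact: retract_hom loc_sum_iso2. Qed.

End Comparison.

End Restriction.

(** * Localization commutes with shifts and cones *)

Section Comparison.
Variables (A : dgring) (S : multset (ring0 A)).
Implicit Types X Y Z : dgmod A.
Local Notation AS := (loc_dgring S).
Local Notation "X '_S'" := (loc_dgmod S X) (at level 2, format "X '_S'").

Section ShiftComparison.
Variables (n : int) (X : dgmod A).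

Lemma dgscale_shift (B : dgring) (Y : dgmod B) (a : ring0 B) i (x : Y (i - n)) :
  dgscale (dgshift n Y) a i x = dgscale Y a (i - n) x.
Proof. by rewrite /= mulr0 ksign_even //; congr (act _ a x); exact: eq_irrelevance. Qed.

(** It sends [x / s] to [x / s]; obtaining it by adjunction leaves linearity to be checked only on
    numerators. *)
Definition loc_shift : dghom (dgshift n X) _S (dgshift n X _S).
Proof.
apply: sharp; apply: (@DGHom _ (dgshift n X) (res (dgshift n X _S))
  (fun i (x : X (i - n)) => fr (X := X) x (den1 S))) => [i x y|i j k e a x|i j e x].
- exact: (frD (X := X)).
- have /= h := fr_act (X := X) (shift_idx n e) a x (den1 S) (den1 S).
  rewrite den1M in h; rewrite /= h /ksign.
  by case: ifP => // _; rewrite frN.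
- have /= h := fr_dif (X := X) (shift_idx1 n e) x (den1 S).
  by rewrite /= h /ksign; case: ifP => // _; rewrite frN.
Defined.

Lemma loc_shiftE i (x : X (i - n)) s :
  loc_shift i (fr (X := dgshift n X) x s) = fr (X := X) x s.
Proof. by rewrite fr_split dgscale_hom /loc_shift sharpE dgscale_shift -fr_split. Qed.

Lemma loc_shift_inj i : injective (loc_shift i).
Proof.
move=> z w; have [x [s ->]] := frP z; have [y [t ->]] := frP w.
by rewrite !loc_shiftE => /frE[u Su h]; apply/frE; exists u; rewrite // !dgscale_shift.
Qed.

Lemma loc_shift_sur i y : exists x, loc_shift i x = y.
Proof.
have [x [s e]] := frP (X := X) (i := i - n) y.
by exists (fr (X := dgshift n X) x s); rewrite loc_shiftE e.
Qed.

Lemma loc_shift_qis : qis loc_shift.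
Proof. exact: qis_bij loc_shift_inj loc_shift_sur. Qed.

End ShiftComparison.

Section ConeComparison.
Variables (M N : dgmod A) (f : dghom M N).

Lemma dgscale_cone (B : dgring) (K L : dgmod B) (g : dghom K L) (a : ring0 B) i
    (z : cone g i) :
  dgscale (cone g) a i z = (dgscale L a i z.1, dgscale K a (i - 1) z.2).
Proof. by rewrite -(dgscale_shift (n := 1)). Qed.

Lemma fr_gcast (X : dgmod A) i j (e : i = j) (x : X i) s :
  fr (S := S) (gcast e x) s = gcast (X := X _S) e (fr x s).
Proof. by case: j / e. Qed.

Definition loc_cone : dghom (cone f) _S (cone (loc_hom S f)).
Proof.
apply: sharp; apply: (@DGHom _ (cone f) (res (cone (loc_hom S f)))
  (fun i (z : cone f i) => (fr (X := N) z.1 (den1 S), fr (X := M) (i := i - 1) z.2 (den1 S))))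
  => [i x y|i j k e a x|i j e x].
- congr (_, _); exact: (frD (X := _)).
- congr (_, _).
    have /= h := fr_act (X := N) e a x.1 (den1 S) (den1 S).
    by rewrite /= h den1M.
  have /= h := fr_act (X := M) (shift_idx 1 e) a x.2 (den1 S) (den1 S).
  rewrite den1M in h; rewrite /= h /ksign.
  by case: ifP => // _; rewrite frN.
- congr (_, _).
    have /= h := fr_dif (X := N) e x.1 (den1 S).
    by rewrite /= h frD fr_gcast locfE.
  have /= h := fr_dif (X := M) (shift_idx1 1 e) x.2 (den1 S).
  rewrite /= h /ksign /=; exact: (frN (X := M)).
Defined.

Lemma loc_coneE i (z : cone f i) s :
  loc_cone i (fr z s) = (fr (X := N) z.1 s, fr (X := M) (i := i - 1) z.2 s).
Proof.
rewrite fr_split dgscale_hom /loc_cone sharpE dgscale_cone.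
by congr (_, _); exact/esym/fr_split.
Qed.

Lemma loc_cone_in : dgcomp loc_cone (loc_hom S (cone_in f)) = cone_in (loc_hom S f).
Proof.
apply: loc_ext => i x s; rewrite dgcompE loc_homE loc_coneE.
by congr (_, _); exact: frac0.
Qed.

Lemma loc_cone_qis : qis loc_cone.
Proof.
apply: qis_bij => [i z w|i [y1 y2]].
  have [x [y [s [-> ->]]]] := fr_common z w.
  rewrite !loc_coneE => -[/frE[u Su h] /frE[v Sv k]]; apply/frE; exists (u * v).
    exact: msetM.
  rewrite !dgscale_cone; congr (_, _).
    have -> : u * v * den s = v * (u * den s) by ring.
    by rewrite !(dgscaleM _ v) !dgcompE h.
  by rewrite -mulrA !(dgscaleM _ u) !dgcompE k.
have [x1 [s1 ->]] := frP (X := N) y1.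
have [x2 [s2 e2]] := frP (X := M) (i := i - 1) y2.
(* Both components are brought to the common denominator [s1 s2]. *)
pose x : cone f i := (dgscale N (den s2) i x1, dgscale M (den s1) (i - 1) x2).
exists (fr x (denM s1 s2)); rewrite loc_coneE e2; congr (_, _).
  by rewrite denMC -fr_mul.
by rewrite -fr_mul.
Qed.
End ConeComparison.
End Comparison.

(** * Finitely generated homology *)

Section Span.
Variables (R : comPzRingType).

(** Membership in the span by recursion on the list of generators, which turns the arguments below
    into inductions on that list. *)
Fixpoint inspan (M : lmodType R) (s : seq M) (x : M) : Prop :=
  if s is g :: s' then exists c : R, inspan s' (x - c *: g) else x = 0.

Section Basic.
Variable M : lmodType R.
Implicit Types (s t : seq M) (x y : M).

Lemma inspan0 s : inspan s 0.
Proof. by elim: s => //= g s h; exists 0; rewrite scale0r subr0. Qed.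

Lemma inspanD s x y : inspan s x -> inspan s y -> inspan s (x + y).
Proof.
elim: s x y => [x y -> ->|g s IH x y [c h] [d k]] /=; first exact: addr0.
by exists (c + d); rewrite scalerDl opprD addrACA; exact: IH.
Qed.

Lemma inspanZ s a x : inspan s x -> inspan s (a *: x).
Proof.
elim: s x => [x -> |g s IH x [c h]] /=; first exact: scaler0.
by exists (a * c); rewrite -scalerA -scalerBr; exact: IH.
Qed.

Lemma inspanN s x : inspan s x -> inspan s (- x).
Proof. by rewrite -scaleN1r; exact: inspanZ. Qed.

Lemma inspan_cat s t x y : inspan s x -> inspan t (y - x) -> inspan (s ++ t) y.
Proof.
elim: s x y => [x y -> |g s IH x y [c h] k] /=; first by rewrite subr0.
by exists c; apply: IH h _; rewrite opprB addrA subrK.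
Qed.

Lemma inspan_sum (n : nat) (g : 'I_n -> M) (c : 'I_n -> R) (r : seq 'I_n) :
  inspan (map g r) (\sum_(k <- r) c k *: g k).
Proof.
elim: r => [|k r IH] /=; first by rewrite big_nil.
by exists (c k); rewrite big_cons addrAC subrr add0r.
Qed.

Lemma inspan_nth s x : inspan s x -> exists c : 'I_(size s) -> R,
  x = \sum_(k < size s) c k *: s`_k.
Proof.
elim: s x => [x /= ->|g s IH x [c /IH[d hd]]].
  by exists (fun=> 0); rewrite big_ord0.
exists (fun k => if unlift ord0 k is Some j then d j else c).
rewrite big_ord_recl unlift_none /= -[LHS](subrK (c *: g)) hd addrC; congr (_ + _).
by apply: eq_bigr => j _; rewrite liftK.
Qed.

Lemma fin_genP : fin_gen M <-> exists s, forall x, inspan s x.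
Proof.
split=> [[n [g hg]]|[s hs]].
  exists (map g (index_enum 'I_n)) => x; have [c ->] := hg x; exact: inspan_sum.
exists (size s), (fun k => s`_k) => x; exact/inspan_nth/hs.
Qed.
End Basic.

Section Maps.
Variables (M N : lmodType R) (v : M -> N).
Hypotheses (vD : {morph v : x y / x + y}) (vZ : scalable v).

Let vN : {morph v : x / - x}. Proof. exact: add_mapN. Qed.

Lemma inspan_map s x : inspan s x -> inspan (map v s) (v x).
Proof.
elim: s x => [x -> |g s IH x [c /IH h]] /=; first exact: add_map0.
by exists c; rewrite -vZ -vN -vD.
Qed.

Lemma inspan_unmap s y : inspan (map v s) y -> exists2 x, inspan s x & v x = y.
Proof.
elim: s y => [y /= ->|g s IH y [c /IH[x h e]]]; first by exists 0 => //; exact: add_map0.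
exists (x + c *: g); first by exists c; rewrite addrK.
by rewrite vD e vZ subrK.
Qed.
End Maps.

Definition is_submod (M : lmodType R) (N : M -> Prop) : Prop :=
  [/\ N 0, forall x y, N x -> N y -> N (x + y) & forall a x, N x -> N (a *: x)].

(** Induction on the generators: modulo the span of [s], the coefficients at [g] of elements of [N]
    form an ideal, and finitely many elements of [N] realize generators of it. *)
Lemma noetherian_submod (M : lmodType R) (N : M -> Prop) (s : seq M) :
  noetherian R -> is_submod N ->
  exists2 t : seq M, (forall y, y \in t -> N y) & forall x, N x -> inspan s x -> inspan t x.
Proof.
move=> nR [N0 ND NZ]; elim: s => [|g s [t' Nt' ht']]; first by exists [::].
pose I : set R := [set c | exists2 y, N y & inspan s (y - c *: g)].
have [|n [r hr]] := nR I.
  split=> [|c d [y Ny hy] [z Nz hz]|a c [y Ny hy]].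
  - by exists 0; rewrite // scale0r subr0; exact: inspan0.
  - exists (y + z); first exact: ND.
    by rewrite scalerDl opprD addrACA; exact: inspanD.
  - by exists (a *: y); [exact: NZ | rewrite -scalerA -scalerBr; exact: inspanZ].
have Ir k : I (r k).
  rewrite hr; exists (fun j => (j == k)%:R).
  by rewrite (bigD1 k) //= eqxx mul1r big1 ?addr0 // => j /negbTE ->; rewrite mul0r.
have /choice[y hy] : forall k, exists y, N y /\ inspan s (y - r k *: g).
  by move=> k; have [y Ny h] := Ir k; exists y.
exists (map y (index_enum 'I_n) ++ t') => [z|x Nx [c hc]].
  by rewrite mem_cat => /orP[/mapP[k _ ->]|/Nt' //]; exact: (hy k).1.
have : I c by exists x.
rewrite hr => -[d hd].
apply: (inspan_cat (inspan_sum y d _)); apply: ht'.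
  apply: (ND _ _ Nx); rewrite -scaleN1r; apply: (NZ _ _).
  by apply: (big_ind N); [exact: N0|exact: ND|] => k _; apply: (NZ _ _); exact: (hy k).1.
(* Modulo the span of [s], both [x] and the [y k] are multiples of [g], and the coefficients [d]
   make these multiples cancel. *)
have -> : x - \sum_k d k *: y k =
    (x - c *: g) - \sum_k d k *: (y k - r k *: g).
  have -> : \sum_k d k *: (y k - r k *: g) = \sum_k d k *: y k - c *: g.
    by rewrite hd scaler_suml -sumrB; apply: eq_bigr => k _; rewrite scalerBr scalerA.
  by rewrite opprB addrA subrK.
apply: inspanD => //; apply: inspanN.
apply: (big_ind (inspan s)); [exact: inspan0|exact: inspanD|] => k _.
by apply: inspanZ; exact: (hy k).2.
Qed.

(** The image of [v] is finitely generated as a submodule of [L]. Lifts of its generators, together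
    with the images of generators of [M], span [N]. *)
Lemma fin_gen_exact (M N L : lmodType R) (u : M -> N) (v : N -> L) :
  noetherian R ->
  {morph u : x y / x + y} -> scalable u -> {morph v : x y / x + y} -> scalable v ->
  (forall x, v x = 0 -> exists m, x = u m) ->
  fin_gen M -> fin_gen L -> fin_gen N.
Proof.
move=> nR uD uZ vD vZ ex /fin_genP[sM hM] /fin_genP[sL hL]; apply/fin_genP.
have [|t Nt ht] := @noetherian_submod L (fun y => exists x, v x = y) sL nR.
  split; first by exists 0; exact: add_map0.
    by move=> _ _ [x <-] [y <-]; exists (x + y); rewrite vD.
  by move=> a _ [x <-]; exists (a *: x); rewrite vZ.
have [t2 e2] : exists t2, map v t2 = t.
  elim: t Nt {ht} => [|y t IH] Nt; first by exists [::].
  have [|t2 <-] := IH; first by move=> z hz; apply: Nt; rewrite inE hz orbT.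
  by have [|x <-] := Nt y; [rewrite inE eqxx | exists (x :: t2)].
exists (t2 ++ map u sM) => x.
have /ht : exists z, v z = v x by exists x.
move=> /(_ (hL _)); rewrite -e2 => /(inspan_unmap vD vZ)[z hz ez].
apply: inspan_cat hz _; have [|m ->] := ex (x - z).
  by rewrite vD (add_mapN vD) ez subrr.
exact/inspan_map/hM.
Qed.

End Span.

Section HMapLinear.
Variables (A : dgring) (X Y : dgmod A) (f : dghom X Y) (i : int).

Lemma hmapD : {morph hmap f (i := i) : h k / h + k}.
Proof.
move=> h k; rewrite -(hclass_repr h) -(hclass_repr k) -hclassD !hmapE -hclassD.
by congr hclass; apply: val_inj; exact: homD.
Qed.

Lemma hmapZ : scalable (hmap f (i := i)).
Proof.
move=> c h; rewrite -(hclass_repr h) -(pi0_repr c) pi0_scale !hmapE pi0_scale.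
by congr hclass; apply: val_inj; exact: homM.
Qed.

Lemma hclass_eq0 (z : cycle X i) : hclass z = 0 <-> isbnd (cycle_val z).
Proof.
rewrite -bndP -[z in bnd z]subr0 -hclass_eq.
suff -> : hclass (0 : cycle X i) = 0 by [].
apply: (addrI (hclass (0 : cycle X i))); rewrite -hclassD !addr0 //.
Qed.
End HMapLinear.

(** * Closure properties of D^f_b *)

Section HGen.
Variable A : dgring.
Implicit Types X Y : dgmod A.

(** Generation of the homology in terms of cycles, coefficients in [A_0] and congruence modulo
    boundaries; this avoids the quotients [H0] and [homology]. *)
Fixpoint hspan X i (s : seq (X i)) (x : X i) : Prop :=
  if s is g :: s' then exists a : ring0 A, hspan s' (x - dgscale X a i g) else isbnd x.

Definition hgen X i : Prop := exists2 s : seq (X i),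
  (forall g, g \in s -> cyc g) & forall x, cyc x -> hspan s x.

Lemma hspanP X i (s : seq (cycle X i)) (z : cycle X i) :
  inspan (map (@hclass _ X i) s) (hclass z) <-> hspan (map val s) (val z).
Proof.
elim: s z => [|g s IH] z /=; first exact: hclass_eq0.
have key a : hclass z - pi0 a *: hclass g = hclass (z - cyc_scale a g).
  rewrite pi0_scale hclassD; congr (_ + _).
  by apply/esym; apply: (@add_mapN _ _ _ (@hclassD _ X i)).
split=> -[a h].
  exists (repr a); move: h; rewrite -{1}(pi0_repr a) key => /IH; exact.
by exists (pi0 a); rewrite key; apply/IH.
Qed.

Lemma hgenP X i : fin_gen (R := H0 A) (homology X i) <-> hgen X i.
Proof.
split=> [/fin_genP[s hs]|[s cs hs]].
  exists (map (val \o repr) s) => [g /mapP[h _ ->]|x cx]; first exact: cycleP.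
  have /= := hspanP (map repr s) (Cycle cx); rewrite -!map_comp => h; apply/h.
  have -> : map (@hclass _ X i \o repr) s = s by apply: map_id_in => k _; exact: hclass_repr.
  exact: hs.
apply/fin_genP.
have [t et] : exists t : seq (cycle X i), map val t = s.
  elim: s cs {hs} => [|y s IH] cs; first by exists [::].
  have [|t <-] := IH; first by move=> z hz; apply: cs; rewrite inE hz orbT.
  have cy : cyc y by apply: cs; rewrite inE eqxx.
  by exists (Cycle cy :: t).
exists (map (@hclass _ X i) t) => h; rewrite -(hclass_repr h); apply/hspanP.
by rewrite et; apply: hs; exact: cycleP.
Qed.

Definition hbounded X (N : nat) : Prop :=
  forall i, (N < absz i)%N -> forall x : X i, cyc x -> isbnd x.

Lemma DfbP X : Dfb A X <-> (exists N, hbounded X N) /\ forall i, hgen X i.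
Proof.
split=> -[[N hN] hg]; (split; last by move=> i; exact/hgenP); exists N => i hi.
  by move=> x cx; apply/(hclass_eq0 (Cycle cx)); exact: hN.
move=> h; rewrite -(hclass_repr h); apply/hclass_eq0.
by apply: hN => //; exact: cycleP.
Qed.

Section Exact.
Hypothesis nH : noetherian (H0 A).

(** Exactness of homology at the middle term suffices, so no connecting map is set up; sums, fibres,
    cones and attached cells are all instances. *)
Lemma Dfb_exact M N L (u : dghom M N) (v : dghom N L) :
  (forall i (x : N i), cyc x -> isbnd (v i x) ->
     exists2 m, cyc m & isbnd (x - u i m)) ->
  Dfb A M -> Dfb A L -> Dfb A N.
Proof.
move=> ex DM DL; split; last first.
  move=> i; apply: (fin_gen_exact (u := hmap u (i := i)) (v := hmap v (i := i)) nH);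
    [exact: hmapD|exact: hmapZ|exact: hmapD|exact: hmapZ| |exact: DM.2|exact: DL.2].
  move=> h; rewrite -(hclass_repr h) hmapE => /hclass_eq0/(ex _ _ (cycleP _))[m cm hm].
  by exists (hclass (Cycle cm)); rewrite hmapE; apply/hclass_eq/bndP.
have /DfbP[[m hm] _] := DM; have /DfbP[[l hl] _] := DL.
suff hb : hbounded N (maxn m l).
  exists (maxn m l) => i hi h; rewrite -(hclass_repr h).
  by apply/hclass_eq0; apply: hb => //; exact: cycleP.
move=> i; rewrite gtn_max => /andP[im il] x cx.
have [y cy hy] := ex _ _ cx (hl _ il _ (cyc_hom v cx)).
rewrite -[x](subrK (u i y)); apply: isbndD => //; apply: isbnd_hom; exact: hm.
Qed.

Lemma Dfb_acyclic X : acyclic X -> Dfb A X.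
Proof.
move=> aX; apply/DfbP; split; first by exists 0%N => i _ x; exact: aX.
by move=> i; exists [::] => // x; exact: aX.
Qed.

Lemma acyclic_zero : acyclic (dgzero A).
Proof.
by move=> i x _; have -> : x = 0; [exact: (ord1 x) | exact: isbnd0].
Qed.

Lemma Dfb_qis X Y (q : dghom X Y) : qis q -> Dfb A X <-> Dfb A Y.
Proof.
move=> /qisE[qi qs]; have D0 := Dfb_acyclic acyclic_zero.
split=> D.
  apply: (Dfb_exact (u := q) (v := (0 : dghom Y (dgzero A)))) D D0 => i x cx _.
  exact: qs.
apply: (Dfb_exact (u := (0 : dghom (dgzero A) X)) (v := q)) D0 D => i x cx h.
by exists 0; [exact: cyc0 | rewrite zerofE subr0; exact: qi].
Qed.

Lemma Dfb_sum X Y : Dfb A X -> Dfb A Y -> Dfb A (dgsum X Y).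
Proof.
apply: (Dfb_exact (u := sum_in1 X Y) (v := sum_pr2 X Y)) => i [x y] /sum_cyc[cx cy] h.
exists x => //.
have -> : (x, y) - sum_in1 X Y i x = (0, y) :> dgsum X Y i.
  by congr (_, _); rewrite ?subrr ?subr0.
by apply/sum_bnd; split=> //; exact: isbnd0.
Qed.

Lemma cyc_shiftE n X i (x : X (i - n)) : cyc (x : dgshift n X i) <-> cyc x.
Proof. by split=> [|h]; [exact: unshift_cyc | exact: shift_cyc]. Qed.

Lemma isbnd_shiftE n X i (x : X (i - n)) : isbnd (x : dgshift n X i) <-> isbnd x.
Proof.
split=> [/(isbndP erefl)[y h]|/(isbndP (shift_idx1 n erefl))[y h]].
  rewrite h; exists (i + 1 - n), (shift_idx1 n erefl), (ksign n y).
  by rewrite /= (ksign_map _ _ (difN _)).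
exists (i + 1), erefl, (ksign n y : dgshift n X (i + 1)) => /=.
by rewrite (ksign_map _ _ (difN _)) ksign_add ksign_even //; lia.
Qed.

Lemma Dfb_shift n X : Dfb A X -> Dfb A (dgshift n X).
Proof.
move=> /DfbP[[N hN] hg]; apply/DfbP; split.
  exists (N + absz n)%N => i hi x /cyc_shiftE cx; apply/isbnd_shiftE.
  by apply: hN => //; lia.
move=> i; have [s cs hs] := hg (i - n); exists s => [g /cs h|x /cyc_shiftE/hs].
  exact/cyc_shiftE.
elim: s {cs hs} x => [x /isbnd_shiftE //|g s IH x [a h]].
by exists a; apply: IH; rewrite dgscale_shift.
Qed.

Lemma Dfb_fib M T (g : dghom M T) : Dfb A M -> Dfb A T -> Dfb A (fib g).
Proof.
move=> DM DT; apply: (Dfb_exact (u := fib_in g) (v := fib_out g)) (Dfb_shift (-1) DT) DM.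
move=> i z; have [m [t ->]] := fibP erefl z.
move=> /fibp_cyc[cm hm] /(isbndP erefl)[m' /= hm'].
(* Subtracting the boundary of [(m', 0)] from the cycle removes its component in [M]. *)
pose w := fibp g erefl m' (0 : T (i + 1 + 1)).
have ew : fibp g erefl m t - dif erefl w = fibp g erefl 0 (t - g _ m').
  by rewrite fibp_dif fibpB dif0 subr0 hm' subrr.
exists ((fibp g erefl 0 (t - g _ m')).2).
  have : cyc (fibp g erefl 0 (t - g _ m')).
    by rewrite -ew; apply: cycB; [exact/fibp_cyc | exact: cyc_dgdif].
  move=> /cyc_dif h; apply/(cycP (subrK 1 i)).
  have := congr1 snd (h _ (subrK 1 i)); rewrite /= hom0 gcast0 add0r; exact.
change (isbnd (fibp g erefl m t - fibp g erefl 0 (t - g (i + 1) m'))).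
by rewrite -ew opprB addrC subrK; exact: isbnd_dif.
Qed.

Lemma Dfb_cone M N (f : dghom M N) : Dfb A M -> Dfb A N -> Dfb A (cone f).
Proof.
move=> DM DN; apply: (Dfb_exact (u := cone_in f) (v := cone_out f)) DN (Dfb_shift 1 DM).
move=> i [n m] cz /(isbndP erefl)[w hw].
pose z : cone f i := (n, m) - dif erefl ((0, w) : cone f (i + 1)).
have ez : z = cone_in f i z.1.
  by congr (_, _); apply/eqP; rewrite subr_eq0; apply/eqP.
exists z.1; last by rewrite -ez /z opprB addrC subrK; exact: isbnd_dif.
have : cyc z by apply: cycB => //; exact: cyc_dgdif.
rewrite ez => /cyc_dif h; apply/(cycP (subrK 1 i)).
by have := congr1 fst (h _ (subrK 1 i)); rewrite /= hom0 gcast0 addr0.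
Qed.
End Exact.

Lemma Dfb_self : gr_fin_gen (R := H0 A) (fun i => homology (dgself A) i) ->
  Dfb A (dgself A).
Proof.
move=> [n [deg [g hg]]]; split.
  (* The sum of the absolute degrees of the generators is at least each of them, so no generator
     contributes beyond it. *)
  exists (\sum_k absz (deg k))%N => i hi h; have [c ->] := hg i h.
  apply: big1 => k _; rewrite /homog; case: eqP => [e|_]; last exact: scaler0.
  by exfalso; move: hi; rewrite -e (bigD1 k) //= ltnNge leq_addr.
by move=> i; exists n, (fun k => homog (M := fun i => homology (dgself A) i) i (g k)); exact: hg.
Qed.

End HGen.

Section DfbLoc.
Variable A : dgring.
Implicit Types X Y : dgmod A.

Lemma hgen_loc (S : multset (ring0 A)) X i : hgen X i -> hgen (loc_dgmod S X) i.
Proof.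
move=> [s cs hs].
exists (map (fun x => fr x (den1 S)) s) => [g /mapP[x /cs cx ->]|z].
  by apply/fr_cyc; exists 1; [exact: mset1|rewrite dgscale1].
have [x [t ->]] := frP z => /fr_cyc[u Su /hs hx].
pose v : set_type S := exist _ u (mem_set Su).
have -> : fr x t = fr (dgscale X u i x) (denM v t) by exact: (fr_mul x t v).
move: {x u Su v t z}(dgscale X u i x) hx (denM v t) => x hx t.
elim: s {cs hs} x hx => [x hx|g s IH x [a /IH h]] /=.
  by apply/fr_bnd; exists 1; [exact: mset1|rewrite dgscale1].
have e : dgscale (loc_dgmod S X) (fr0 a t) i (fr g (den1 S)) = fr (dgscale X a i g) t.
  by apply: etrans (fr_act (add0r i) _ g t (den1 S)) _; rewrite denMC den1M.
exists (fr0 a t).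
change (hspan (map (fun x => fr x (den1 S)) s)
  (fr x t - dgscale (loc_dgmod S X) (fr0 a t) i (fr g (den1 S)))).
by rewrite e -frN -frD.
Qed.

Lemma Dfb_loc (S : multset (ring0 A)) X : Dfb A X -> Dfb (loc_dgring S) (loc_dgmod S X).
Proof.
move=> /DfbP[[N hN] hg]; apply/DfbP; split; last by move=> i; exact: hgen_loc.
exists N => i hi z; have [x [s ->]] := frP z => /fr_cyc[u Su cu].
by apply/fr_bnd; exists u => //; exact: hN.
Qed.

End DfbLoc.

(** * Cell modules and their colimits *)

Section Attach.
Variable A : dgring.

Section Def.
Variables (F : dgmod A) (m n : int) (e0 : n + 1 = m) (z : F n) (cz : cyc z).

Lemma attach_idx (i j : int) : j + 1 = i -> i - m + n = j.
Proof. by lia. Qed.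

(* F (+) A e with e free of degree m and d e = z; the coefficient of e is on its
   left, hence no Koszul sign in the action. *)
Definition attach : dgmod A.
Proof.
apply: (@DGMod A (fun i => (F i * A (i - m))%type : zmodType)
  (fun i j k e a w => (act e a w.1, rmul (shift_idx m e) a w.2))
  (fun i j e w =>
    (dif e w.1 + ksign (i - m) (act (attach_idx e) w.2 z), rdif (shift_idx1 m e) w.2))).
- by move=> *; rewrite !actDl rmulDl.
- by move=> *; rewrite !actDr rmulDr.
- by move=> *; congr (_, _); [exact: actA | exact: rmulA].
- by move=> i e [x y]; congr (_, _); [exact: act1 | exact: rmul1].
- move=> i j e [x y] [x' y']; congr (_, _); last exact: rdifD.
  by rewrite /= difD actDl ksignD addrACA.
- move=> i j k e e' [x y]; congr (_, _); last exact: rdif_dif.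
  rewrite /= difD dif_dif add0r (ksign_map _ _ (difN _)).
  have e2 : i - m + (n - 1) = k by lia.
  rewrite (leibniz (attach_idx e) (shift_idx1 m e) (subrK 1 n) e' (attach_idx e') e2).
  rewrite (cyc_dif cz) act0r ksign0 addr0 /ksign.
  have -> : odd (absz (j - m)) = ~~ odd (absz (i - m)) by lia.
  by case: odd; rewrite /= ?addNr ?addrN.
- move=> i j k i' j' k' e ei ej ek e1 e2 a [x y].
  rewrite [X in _ = _ + X](_ : _ = (ksign i (act e2 a
      (dif ej x + ksign (j - m) (act (attach_idx ej) y z))),
    ksign i (rmul (shift_idx m e2) a (rdif (shift_idx1 m ej) y)))); last first.
    by rewrite /ksign; case: ifP.
  congr (_, _); last exact: rleibniz.
  rewrite /= (leibniz e ei ej ek e1 e2).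
  have pf : j - m + n = j' by exact: attach_idx.
  rewrite actDr ksignD.
  rewrite (actA _ (attach_idx ek) pf e2) (ksign_map _ _ (actNr _ a)) ksign_add.
  rewrite (_ : act (attach_idx ej) y z = act pf y z); last first.
    by congr (act _ _ _); exact: eq_irrelevance.
  by rewrite addrA; congr (_ + _); apply: ksign_congr; lia.
Defined.

Definition attach_in : dghom F attach.
Proof.
exists (fun i x => (x, 0) : attach i) => [i x y|i j k e a x|i j e x].
- by congr (_, _); rewrite addr0.
- by congr (_, _); exact/esym/(act0r (dgself A)).
- by congr (_, _); [rewrite /= act0l ksign0 addr0 | rewrite [RHS]rdif0].
Defined.

Lemma cell_idx : 0 = m - m. Proof. by rewrite subrr. Qed.

Definition cell : attach m := (0, gcast (X := dgself A) cell_idx (rone A)).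

Lemma act_cell i (a : A (i - m)) : act (d := attach) (subrK m i) a cell = (0, a).
Proof.
congr (_, _); first exact: act0r.
rewrite /=.
move: (shift_idx m _) (cell_idx) => p q; move: p; case: (m - m) / q => p.
by rewrite gcast_id (rmulC _ (add0r _)) rmul1 mulr0 ksign_even.
Qed.

Lemma attachE i (w : attach i) :
  w = attach_in i w.1 + act (d := attach) (subrK m i) w.2 cell.
Proof.
by rewrite act_cell; case: w => x a; congr (_, _); rewrite /= ?addr0 ?add0r.
Qed.

Lemma dif_cell : dif e0 cell = attach_in n z.
Proof.
congr (_, _).
  rewrite /= dif0 add0r ksign_even; last by rewrite subrr.
  move: (attach_idx e0) cell_idx => p q; move: p; case: (m - m) / q => p.
  by rewrite gcast_id act1.
rewrite /=; move: (shift_idx1 m e0) cell_idx => p q; move: p; case: (m - m) / q => p.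
by rewrite gcast_id rdif_deg0.
Qed.

Lemma attach_ext Y (g : dghom F Y) (y : Y m) : dif e0 y = g n z ->
  exists2 h : dghom attach Y, dgcomp h attach_in = g & h m cell = y.
Proof.
move=> hy.
unshelve eexists.
- exists (fun i w => g i w.1 + act (subrK m i) w.2 y) => [i u v|i j k e a u|i j e u].
  + by rewrite /= homD actDl addrACA.
  + by rewrite /= homM (actA _ _ (subrK m j) e) actDr.
  + have e1 : i - m + n = j by lia.
    rewrite /= homD difD hom_dif -addrA; congr (_ + _).
    rewrite (leibniz (subrK m i) (shift_idx1 m e) e0 e (subrK m j) e1) hy addrC.
    congr (_ + _); rewrite (ksign_map _ _ (@homN _ _ _ g _)) homM; congr ksign.
    by congr (act _ _ _); exact: eq_irrelevance.
- by apply: dghom_ext => i x; rewrite /= act0l addr0.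
- rewrite /= hom0 add0r; move: (subrK m m) cell_idx => p q; move: p; case: (m - m) / q => p.
  by rewrite gcast_id act1.
Qed.

Lemma attach_eq Y (f g : dghom attach Y) :
  dgcomp f attach_in = dgcomp g attach_in -> f m cell = g m cell -> f = g.
Proof.
move=> h k; apply: dghom_ext => i w; rewrite (attachE w) !homD -!dgcompE h.
by rewrite !homM k.
Qed.

End Def.

Implicit Types E B F X Y : dgmod A.

(** Acyclicity of the kernel of [p] from degree [c] on, with bounding elements again in the kernel.
    The bound lets maps that are not quasi-isomorphisms admit lifts against cells of high degree. *)
Definition ker_acyclic E B (p : dghom E B) (c : int) : Prop :=
  forall i, c <= i -> forall x : E i, cyc x -> p i x = 0 ->
  exists y : E (i + 1), x = dif erefl y /\ p _ y = 0.

Lemma surj_qis_ker E B (p : dghom E B) c :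
  (forall i y, exists x, p i x = y) -> qis p -> ker_acyclic p c.
Proof.
move=> ps /qisE[pi pq] i _ x cx px.
have /(isbndP erefl)[y hy] : isbnd x by apply: pi => //; rewrite px; exact: isbnd0.
have cpy : cyc (p _ y) by apply/(cycP erefl); rewrite -hom_dif -hy.
have [w cw /(isbndP erefl)[b hb]] := pq _ _ cpy.
have [v hv] := ps _ b.
exists (y - w - dif erefl v); split.
  by rewrite !difD !difN -hy (cyc_dif cw) dif_dif !subr0.
by rewrite !homB hom_dif hv hb subrr.
Qed.

Lemma attach_lift F m n (e0 : n + 1 = m) (z : F n) (cz : cyc z) E B (p : dghom E B)
    (f : dghom (attach e0 cz) B) (g : dghom F E) :
  (forall i y, exists x, p i x = y) -> ker_acyclic p n ->
  dgcomp p g = dgcomp f (attach_in e0 cz) ->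
  exists2 h, dgcomp h (attach_in e0 cz) = g & dgcomp p h = f.
Proof.
move=> ps pk pg.
have [y0 hy0] := ps _ (f m (cell e0 cz)).
(* For an arbitrary preimage [y0] the obstruction [d y0 - g z] is a cycle of the kernel in degree
   [n]; an element [w] of the kernel bounding it corrects [y0]. *)
have [||w] := pk n (lexx n) (dif e0 y0 - g n z).
- by apply: cycB; [exact: cyc_dgdif | exact: cyc_hom].
- by rewrite homB hom_dif hy0 -hom_dif dif_cell -!dgcompE pg subrr.
move: w; case: m / e0 f y0 pg hy0 => f y0 pg hy0 w [hw pw].
have [|h hi hc] := @attach_ext _ _ _ erefl _ cz _ g (y0 - w).
  by rewrite difD difN -hw opprB addrC subrK.
exists h => //; apply: attach_eq; first by rewrite -dgcompA hi.
by rewrite dgcompE hc homB pw subr0.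
Qed.

(** A property of the inclusion rather than of the module, because lifts are always extended from
    [F]; the lifting lemmas consume the bound [c] on the degrees of the cells. *)
Inductive cells (c : int) : forall F F', dghom F F' -> Prop :=
| cells_id F : cells c (dgid F)
| cells_attach F F' (u : dghom F F') m n (e0 : n + 1 = m) (z : F' n) (cz : cyc z) :
    c <= m -> cells c u -> cells c (dgcomp (attach_in e0 cz) u).

Inductive fincell : dgmod A -> Prop :=
| fincell0 : fincell (dgzero A)
| fincell_attach F m n (e0 : n + 1 = m) (z : F n) (cz : cyc z) :
    fincell F -> fincell (attach e0 cz).

Lemma cells_fincell c F F' (u : dghom F F') : cells c u -> fincell F -> fincell F'.
Proof.
by elim=> {F F' u} [F|F F' u m n e0 z cz _ _ IH /IH h] //; exact: fincell_attach.
Qed.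

Lemma cells_lift c F F' (u : dghom F F') : cells c u ->
  forall E B (p : dghom E B) (f : dghom F' B) (g : dghom F E),
  (forall i y, exists x, p i x = y) -> ker_acyclic p (c - 1) ->
  dgcomp p g = dgcomp f u -> exists2 h, dgcomp h u = g & dgcomp p h = f.
Proof.
elim=> {F F' u} [F|F F' u m n e0 z cz cm _ IH] E B p f g ps pk pg.
  by exists g; rewrite ?pg compf1.
rewrite dgcompA in pg; have [h hu ph] := IH _ _ _ _ _ ps pk pg.
have [|k ki pk'] := attach_lift ps _ ph; last by exists k; rewrite // dgcompA ki.
(* A cell of degree [m] meets its obstruction in degree [m - 1], hence the bound [c - 1]. *)
by move=> i ni; apply: pk; apply: le_trans ni; lia.
Qed.

Lemma zero_hom_eq Y (f g : dghom (dgzero A) Y) : f = g.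
Proof.
by apply: dghom_ext => i x; have -> : x = 0; [exact: (ord1 x) | rewrite !hom0].
Qed.

Lemma fincell_lift F : fincell F -> forall E B (p : dghom E B) (f : dghom F B),
  (forall i y, exists x, p i x = y) -> qis p -> exists h, dgcomp p h = f.
Proof.
elim=> {F} [|F m n e0 z cz _ IH] E B p f ps pq.
  by exists 0; exact: zero_hom_eq.
have [g hg] := IH _ _ _ (dgcomp f (attach_in e0 cz)) ps pq.
have [h _ ph] := attach_lift ps (surj_qis_ker ps pq) hg; by exists h.
Qed.

End Attach.

(** * Clearing denominators on finite cell modules *)

Section FinLoc.
Variables (A : dgring) (S : multset (ring0 A)).
Implicit Types E B F V W X Y : dgmod A.

Lemma dgscaleA X a b i x : dgscale X a i (dgscale X b i x) = dgscale X (a * b) i x.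
Proof. by rewrite dgscaleM. Qed.

Lemma dgscale_eq X a b i (x : X i) : a = b -> dgscale X a i x = dgscale X b i x.
Proof. by move->. Qed.

(** The kernel is [S]-torsion; [loc_sur] says the same of the cokernel. *)
Definition loc_inj X Y (f : dghom X Y) : Prop :=
  forall i x, f i x = 0 -> exists2 s, mset S s & dgscale X s i x = 0.
Definition loc_sur X Y (f : dghom X Y) : Prop :=
  forall i y, exists2 s, mset S s & exists x, dgscale Y s i y = f i x.

(** Each cell costs finitely many denominators, and there are finitely many cells. With [q = 0] this
    clears the denominators of a map, with path modules those of a null-homotopy. *)
Lemma fincell_loc E B V W (p : dghom E B) (q : dghom V W)
    (l : dghom E V) (l' : dghom B W) :
  loc_inj l -> loc_sur l -> loc_inj l' -> dgcomp q l = dgcomp l' p ->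
  forall F, fincell F -> forall (g : dghom F B) (f : dghom F V),
  dgcomp q f = dgcomp l' g ->
  exists2 t, mset S t & exists2 h : dghom F E,
    dgcomp p h = dgcomp g (dgscale F t) & dgcomp l h = dgcomp f (dgscale F t).
Proof.
move=> li ls l'i sq F; elim=> {F} [|F m n e0 z cz _ IH] g f hfg.
  by exists 1; [exact: mset1 | exists 0; exact: zero_hom_eq].
have [|t St [h ph lh]] := IH (dgcomp g (attach_in e0 cz)) (dgcomp f (attach_in e0 cz)).
  by rewrite !dgcompA hfg.
pose c := cell e0 cz.
(* [s] is the denominator of the value at the cell, [u] kills the failure of [x] to lie over [g],
   and [w] the failure of its boundary to match [h z]. *)
have [s Ss [x hx]] := ls m (f m c).
have [u Su hu] : exists2 u, mset S u & dgscale B u m (p m x - dgscale B s m (g m c)) = 0.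
  apply: l'i; rewrite homB -[l' m (p m x)]dgcompE -sq dgcompE -hx (dgscale_hom q) (dgscale_hom l').
  by rewrite -[q m (f m c)]dgcompE -[l' m (g m c)]dgcompE hfg subrr.
have [w Sw hw] : exists2 w, mset S w &
    dgscale E w n (dgscale E s n (h n z) - dgscale E t n (dif e0 x)) = 0.
  apply: li; rewrite homB !(dgscale_hom l) (hom_dif l) -hx.
  rewrite -[dif e0 (dgscale _ _ _ _)]hom_dif -[dif e0 (f m c)]hom_dif dif_cell.
  rewrite -[l n (h n z)]dgcompE lh !dgcompE (dgscale_hom (attach_in e0 cz)).
  by rewrite (dgscale_hom f) !dgscaleA mulrC subrr.
have {}hu : dgscale B u m (p m x) = dgscale B (u * s) m (g m c).
  by apply/eqP; rewrite -subr_eq0 -dgscaleA -homB hu.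
have {}hw : dgscale E (w * s) n (h n z) = dgscale E (w * t) n (dif e0 x).
  by apply/eqP; rewrite -subr_eq0 -!dgscaleA -homB hw.
(* Rescaling [h] by [w s u] and [x] by [w u t] makes [t (w s u)] the denominator both on [F] and at
   the cell. *)
have [|k ki kc] := @attach_ext _ _ _ _ e0 _ cz _ (dgcomp h (dgscale F (w * s * u)))
    (dgscale E (w * u * t) m x).
  rewrite dgcompE -hom_dif (dgscale_hom h).
  transitivity (dgscale E u n (dgscale E (w * t) n (dif e0 x))).
    by rewrite dgscaleA; apply: dgscale_eq; ring.
  by rewrite -hw dgscaleA; apply: dgscale_eq; ring.
exists (t * (w * s * u)); first by do ![apply: msetM => //].
exists k; apply: attach_eq.
- rewrite -!dgcompA ki (dgcompA p) ph -dgcompA -dgscaleM.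
  by rewrite -dgcompA (dgscale_nat (attach_in e0 cz)).
- rewrite !dgcompE kc !(dgscale_hom p) !(dgscale_hom g) -/c.
  transitivity (dgscale B (t * w) m (dgscale B u m (p m x))).
    by rewrite dgscaleA; apply: dgscale_eq; ring.
  by rewrite hu dgscaleA; apply: dgscale_eq; ring.
- rewrite -!dgcompA ki (dgcompA l) lh -dgcompA -dgscaleM.
  by rewrite -dgcompA (dgscale_nat (attach_in e0 cz)).
- rewrite !dgcompE kc (dgscale_hom l) (dgscale_hom f) -/c -hx dgscaleA.
  by apply: dgscale_eq; ring.
Qed.

End FinLoc.

(** * Sequential colimits of DG modules *)

Section Colimit.
Local Open Scope quotient_scope.
Variables (A : dgring) (F : nat -> dgmod A) (u : forall k, dghom (F k) (F k.+1)).
Arguments u : clear implicits.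

Section Degree.
Variable i : int.

(** The colimit is modelled as eventually compatible families modulo eventually zero ones, a
    subquotient of the product; only the maps between consecutive stages enter the definition. *)
Definition fam : Type := forall k, F k i.
HB.instance Definition _ := gen_eqMixin fam.
HB.instance Definition _ := gen_choiceMixin fam.

Let fam_ext (x y : fam) : (forall k, x k = y k) -> x = y.
Proof. exact: functional_extensionality_dep. Qed.

Definition fam_add (x y : fam) : fam := fun k => x k + y k.
Definition fam_opp (x : fam) : fam := fun k => - x k.
Definition fam_zero : fam := fun=> 0.

Lemma fam_addA : associative fam_add.
Proof. by move=> x y z; apply: fam_ext => k; exact: addrA. Qed.
Lemma fam_addC : commutative fam_add.
Proof. by move=> x y; apply: fam_ext => k; exact: addrC. Qed.
Lemma fam_add0 : left_id fam_zero fam_add.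
Proof. by move=> x; apply: fam_ext => k; exact: add0r. Qed.
Lemma fam_addN : left_inverse fam_zero fam_opp fam_add.
Proof. by move=> x; apply: fam_ext => k; exact: addNr. Qed.

HB.instance Definition _ :=
  GRing.isZmodule.Build fam fam_addA fam_addC fam_add0 fam_addN.

Definition threaded (x : fam) : bool :=
  `[< exists K, forall k, (K <= k)%N -> u k i (x k) = x k.+1 >].

Lemma threaded_zmod : zmod_closed threaded.
Proof.
split=> [|x y /asboolP[K hK] /asboolP[L hL]]; apply/asboolP.
  by exists 0%N => k _; exact: hom0.
exists (maxn K L) => k; rewrite geq_max => /andP[Kk Lk].
by apply: etrans (homB (u k) (x k) (y k)) _; rewrite hK // hL.
Qed.
HB.instance Definition _ := GRing.isZmodClosed.Build fam threaded threaded_zmod.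

Record thread := Thread { thread_val :> fam; threadP : threaded thread_val }.
HB.instance Definition _ := [isSub for thread_val].
HB.instance Definition _ := [Choice of thread by <:].
HB.instance Definition _ := [SubChoice_isSubZmodule of thread by <:].

Definition ev0 (x : thread) : bool :=
  `[< exists K, forall k, (K <= k)%N -> thread_val x k = 0 >].

Lemma ev0_zmod : zmod_closed ev0.
Proof.
split=> [|x y /asboolP[K hK] /asboolP[L hL]]; apply/asboolP; first by exists 0%N.
exists (maxn K L) => k; rewrite geq_max => /andP[Kk Lk].
rewrite [LHS]/(thread_val x k - thread_val y k) hK // hL //; exact: subr0.
Qed.
HB.instance Definition _ := GRing.isZmodClosed.Build thread ev0 ev0_zmod.

Definition colim_at := Quotient.quot (GRing.ZmodClosed.clone thread ev0 _).
HB.instance Definition _ := GRing.Zmodule.on colim_at.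

Definition germ (x : thread) : colim_at := \pi_colim_at x.

Lemma germ_eq x y : germ x = germ y <->
  exists K, forall k, (K <= k)%N -> thread_val x k = thread_val y k.
Proof.
have -> : germ x = germ y <-> ev0 (x - y).
  by rewrite /germ; split=> [/eqP|h]; [|apply/eqP]; rewrite -Quotient.idealrBE.
split=> [/asboolP[K h]|[K h]]; last apply/asboolP; exists K => k Kk.
  by apply/eqP; rewrite -subr_eq0; apply/eqP; exact: h.
rewrite [LHS]/(thread_val x k - thread_val y k) h //; exact: subrr.
Qed.
Lemma germ_repr c : germ (repr c) = c. Proof. exact: reprK. Qed.
Lemma germD : {morph germ : x y / x + y}.
Proof. by move=> x y; rewrite /germ !piE. Qed.
Lemma germ0 : germ 0 = 0.
Proof. exact: (add_map0 germD). Qed.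
End Degree.

Section Map.
Variables (i j : int) (h : forall k, F k i -> F k j).
Arguments h : clear implicits.
Hypotheses (hD : forall k x y, h k (x + y) = h k x + h k y).
Hypotheses (hu : forall k x, u k j (h k x) = h k.+1 (u k i x)).

Lemma thread_map_subproof (x : thread i) : threaded (fun k => h k (thread_val x k)).
Proof.
have /asboolP[K hK] := threadP x; apply/asboolP; exists K => k Kk.
by rewrite hu hK.
Qed.
Definition thread_map x : thread j := Thread (thread_map_subproof x).

Definition colim_map (c : colim_at i) : colim_at j := germ (thread_map (repr c)).

Lemma colim_mapE x : colim_map (germ x) = germ (thread_map x).
Proof.
have /germ_eq[K hK] : germ (repr (germ x)) = germ x by exact: germ_repr.
by apply/germ_eq; exists K => k Kk /=; rewrite hK.
Qed.

Lemma colim_mapD : {morph colim_map : c d / c + d}.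
Proof.
move=> c d; rewrite -(germ_repr c) -(germ_repr d) -germD !colim_mapE -germD.
by congr germ; apply: val_inj; apply: functional_extensionality_dep => k; exact: hD.
Qed.
End Map.

Definition colim_act i j k (e : i + j = k) (a : A i) : colim_at j -> colim_at k :=
  colim_map (h := fun l => act e a) (fun l x => homM (u l) e a x).
Definition colim_dif i j (e : j + 1 = i) : colim_at i -> colim_at j :=
  colim_map (h := fun l => dif e) (fun l x => hom_dif (u l) e x).

Lemma germ_ext i (x y : thread i) :
  (forall k, thread_val x k = thread_val y k) -> germ x = germ y.
Proof. by move=> h; apply/germ_eq; exists 0%N => k _. Qed.

Definition colim : dgmod A.
Proof.
apply: (@DGMod A (fun i => colim_at i : zmodType) colim_act colim_dif).
- move=> i j k e a b c; rewrite -(germ_repr c) /colim_act /colim_dif !colim_mapE -germD.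
  by apply: germ_ext => l; exact: actDl.
- move=> i j k e a c d; apply: colim_mapD => l x y; exact: actDr.
- move=> i j k ij jk l e1 e2 e3 e4 a b c; rewrite -(germ_repr c) /colim_act /colim_dif !colim_mapE.
  by apply: germ_ext => n; exact: actA.
- move=> i e c; rewrite -[RHS]germ_repr -{1}(germ_repr c) /colim_act /colim_dif !colim_mapE.
  by apply: germ_ext => n; exact: act1.
- move=> i j e c d; apply: colim_mapD => l x y; exact: difD.
- move=> i j k e e' c; rewrite -(germ_repr c) /colim_act /colim_dif !colim_mapE.
  by rewrite -[RHS]germ0; apply: germ_ext => n; exact: dif_dif.
- move=> i j k i' j' k' e ei ej ek e1 e2 a c.
  rewrite -(germ_repr c) /colim_act /colim_dif !colim_mapE.
  have kg n l (x : thread l) : exists2 y : thread l, ksign n (germ x) = germ y &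
      forall m, thread_val y m = ksign n (thread_val x m).
    rewrite /ksign; case: ifP => _; last by exists x.
    exists (- x) => //; apply/esym; apply: (@add_mapN _ _ _ (@germD l)).
  have [y -> hy] := kg i _ (thread_map (fun l x => homM (u l) e2 a x)
    (thread_map (fun l x => hom_dif (u l) ej x) (repr c))).
  rewrite -germD; apply: germ_ext => n.
  by rewrite [RHS]/(_ + thread_val y n) hy; exact: leibniz.
Defined.

End Colimit.

(** Recursion on [k] along the shifted tower avoids casts along equations such as [k + d = l]. For
    [l < k] the value is the dummy 0. *)
Fixpoint push (A : dgring) (k : nat) : forall (F : nat -> dgmod A)
    (u : forall k, dghom (F k) (F k.+1)) (l : nat), dghom (F k) (F l) :=
  match k with
  | 0 => fun F u l => nat_rect (fun l => dghom (F 0) (F l)) (dgid _)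
      (fun l g => dgcomp (u l) g) l
  | k'.+1 => fun F u l => match l with
      | 0 => 0
      | l'.+1 => push k' (fun l => u l.+1) l'
      end
  end.

Section ColimitTheory.
Variables (A : dgring) (F : nat -> dgmod A) (u : forall k, dghom (F k) (F k.+1)).

Lemma push_id k : push k u k = dgid (F k).
Proof. by elim: k F u => //= k IH G v; exact: (IH (fun l => G l.+1)). Qed.

Lemma pushS k l : (k <= l)%N -> push k u l.+1 = dgcomp (u l) (push k u l).
Proof.
elim: k l F u => [//|k IH] [//|l] G v kl.
exact: (IH l (fun l => G l.+1) (fun l => v l.+1)).
Qed.

Lemma pushSl k l : (k < l)%N -> dgcomp (push k.+1 u l) (u k) = push k u l.
Proof.
elim: l => // l IH; rewrite ltnS leq_eqVlt => /orP[/eqP ->|kl].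
  by rewrite push_id comp1f pushS // push_id compf1.
by rewrite pushS // -dgcompA IH // pushS // ltnW.
Qed.

Lemma push_push k l m : (k <= l)%N -> (l <= m)%N ->
  dgcomp (push l u m) (push k u l) = push k u m.
Proof.
move=> kl; elim: m => [|m IH]; first by rewrite leqn0 => /eqP ?; subst l; rewrite push_id comp1f.
rewrite leq_eqVlt => /orP[/eqP ->|lm]; first by rewrite push_id comp1f.
by rewrite pushS // -dgcompA IH // pushS // (leq_trans kl).
Qed.

Lemma push_threaded k i (x : F k i) : threaded u (fun l => push k u l i x).
Proof. by apply/asboolP; exists k => l kl; rewrite pushS. Qed.

Definition colim_in k : dghom (F k) (colim u).
Proof.
exists (fun i x => germ (Thread (push_threaded x)) : colim u i).
- move=> i x y; rewrite -[RHS]germD; apply: germ_ext => l; exact: homD.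
- move=> i j l e a x; rewrite [RHS]colim_mapE; apply: germ_ext => n; exact: homM.
- move=> i j e x; rewrite [RHS]colim_mapE; apply: germ_ext => n; exact: hom_dif.
Defined.

Lemma colim_in_u k : dgcomp (colim_in k.+1) (u k) = colim_in k.
Proof.
apply: dghom_ext => i x; apply/germ_eq; exists k.+1 => l kl /=.
by rewrite -dgcompE pushSl.
Qed.

Lemma colim_in_push k l : (k <= l)%N -> dgcomp (colim_in l) (push k u l) = colim_in k.
Proof.
elim: l => [|l IH]; first by rewrite leqn0 => /eqP ->; rewrite push_id compf1.
rewrite leq_eqVlt => /orP[/eqP ->|kl]; first by rewrite push_id compf1.
by rewrite pushS // dgcompA colim_in_u IH.
Qed.

Lemma colimP i (c : colim u i) : exists k x, c = colim_in k i x.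
Proof.
rewrite -(germ_repr c); have /asboolP[K hK] := threadP (repr c).
exists K, (thread_val (repr c) K); apply/germ_eq; exists K => l Kl /=.
elim: l Kl => [|l IH]; first by rewrite leqn0 => /eqP ->; rewrite push_id.
rewrite leq_eqVlt => /orP[/eqP <-|Kl]; first by rewrite push_id.
by rewrite pushS // dgcompE -IH // hK.
Qed.

Lemma colim_in_eq0 k i (x : F k i) : colim_in k i x = 0 ->
  exists2 l, (k <= l)%N & push k u l i x = 0.
Proof.
rewrite -[X in _ = X]/(0 : colim_at u i) -germ0 => /germ_eq[K hK].
exists (maxn k K); first exact: leq_maxl.
exact: (hK _ (leq_maxr k K)).
Qed.

Lemma colim_common i (c d : colim u i) : exists k x y,
  c = colim_in k i x /\ d = colim_in k i y.
Proof.
have [k [x ->]] := colimP c; have [l [y ->]] := colimP d.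
exists (maxn k l), (push k u _ i x), (push l u _ i y).
by rewrite -!dgcompE !colim_in_push ?leq_maxl ?leq_maxr.
Qed.

Lemma colim_ext Y (f g : dghom (colim u) Y) :
  (forall k, dgcomp f (colim_in k) = dgcomp g (colim_in k)) -> f = g.
Proof.
move=> h; apply: dghom_ext => i c; have [k [x ->]] := colimP c.
by rewrite -!dgcompE h.
Qed.

Lemma colim_glue Y (f : forall k, dghom (F k) Y) :
  (forall k, dgcomp (f k.+1) (u k) = f k) ->
  exists g : dghom (colim u) Y, forall k, dgcomp g (colim_in k) = f k.
Proof.
move=> fu.
have fp k l : (k <= l)%N -> dgcomp (f l) (push k u l) = f k.
  elim: l => [|l IH]; first by rewrite leqn0 => /eqP ->; rewrite push_id compf1.
  rewrite leq_eqVlt => /orP[/eqP ->|kl]; first by rewrite push_id compf1.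
  by rewrite pushS // dgcompA fu IH.
have f0 k i x : colim_in k i x = 0 -> f k i x = 0.
  by move=> /colim_in_eq0[l kl hl]; rewrite -(fp k l kl) dgcompE hl hom0.
have ex i (c : colim u i) : exists y, forall k x, c = colim_in k i x -> f k i x = y.
  have [k [x ->]] := colimP c; exists (f k i x) => l y.
  rewrite -(colim_in_push (leq_maxl k l)) -(colim_in_push (leq_maxr k l)) !dgcompE.
  move=> /eqP; rewrite -subr_eq0 -homB => /eqP/f0/eqP.
  by rewrite homB subr_eq0 -!dgcompE !fp ?leq_maxl ?leq_maxr // => /eqP.
pose g i c := projT1 (cid (ex i c)).
have gE k i x : g i (colim_in k i x) = f k i x.
  by rewrite /g; case: cid => y /= hy; rewrite (hy k x).
have gD i c d : g i (c + d) = g i c + g i d.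
  by have [k [x [y [-> ->]]]] := colim_common c d; rewrite -homD !gE homD.
have gM i j l (e : i + j = l) a c : g l (act e a c) = act e a (g j c).
  by have [k [x ->]] := colimP c; rewrite -homM !gE homM.
have gd i j (e : j + 1 = i) c : g j (dif e c) = dif e (g i c).
  by have [k [x ->]] := colimP c; rewrite -hom_dif !gE hom_dif.
exists (DGHom gD gM gd) => k; apply: dghom_ext => i x; exact: gE.
Qed.

End ColimitTheory.

(** Dependent choice for types that vary with the index, with an invariant [P] and a step relation
    [R]; towers and compatible families of lifts come from it. *)
Lemma dep_seq (T : nat -> Type) (P : forall k, T k -> Prop)
    (R : forall k, T k -> T k.+1 -> Prop) (x0 : T 0%N) : P 0%N x0 ->
  (forall k x, P k x -> exists2 y, P k.+1 y & R k x y) ->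
  exists2 s : forall k, T k, s 0%N = x0 & forall k, P k (s k) /\ R k (s k) (s k.+1).
Proof.
move=> P0 PS.
pose next k (x : {x | P k x}) : {y | P k.+1 y} :=
  let y := cid2 (PS k (sval x) (svalP x)) in exist _ (s2val y) (s2valP y).
pose s := nat_rect (fun k => {x | P k x}) (exist _ x0 P0) next.
exists (fun k => sval (s k)) => // k; split; first exact: svalP.
by rewrite /= /next /=; case: cid2.
Qed.

Section FibMap.
Variables (A : dgring) (M T M' T' : dgmod A) (g : dghom M T) (g' : dghom M' T').
Variables (a : dghom M M') (b : dghom T T').
Hypothesis sq : dgcomp g' a = dgcomp b g.

Definition fib_map : dghom (fib g) (fib g').
Proof.
exists (fun i z => (a i z.1, b (i - -1) z.2) : fib g' i) => [i x y|i j k e r x|i j e x].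
- by congr (_, _); [exact: (homD a)|exact: (homD b)].
- congr (_, _); first exact: homM.
  by rewrite /= (ksign_map _ _ (@homN _ _ _ b _)) homM.
- congr (_, _); first exact: hom_dif.
  rewrite /= homD (ksign_map _ _ (@homN _ _ _ b _)) hom_dif; congr (_ + _).
  by rewrite hom_gcast; congr (gcast _ _); rewrite -!dgcompE sq.
Defined.

Lemma fib_mapE i k (e : i + 1 = k) x t :
  fib_map i (fibp g e x t) = fibp g' e (a i x) (b k t).
Proof. by congr (_, _); rewrite /= hom_gcast. Qed.

Lemma fib_out_map : dgcomp (fib_out g') fib_map = dgcomp a (fib_out g).
Proof. exact: dghom_ext. Qed.

End FibMap.

Lemma dgscale_gcast (A : dgring) (X : dgmod A) a i j (e : i = j) (x : X i) :
  dgscale X a j (gcast e x) = gcast e (dgscale X a i x).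
Proof. by case: j / e. Qed.

Lemma dgscale_fibp (A : dgring) (M T : dgmod A) (g : dghom M T) a i k (e : i + 1 = k) x t :
  dgscale (fib g) a i (fibp g e x t) = fibp g e (dgscale M a i x) (dgscale T a k t).
Proof.
congr (_, _); rewrite -dgscale_gcast; exact: (dgscale_shift (n := -1) (Y := T)).
Qed.

(** * Colimits of cells of increasing degree *)

Section Tower.
Variable A : dgring.
Implicit Types X Y V E B : dgmod A.

Definition acyclic_from Y (m : int) : Prop :=
  forall i, m <= i -> forall x : Y i, cyc x -> isbnd x.

(** Lifting against [Y -> 0] amounts to extending maps into [Y], and the kernel is all of [Y]. *)
Lemma ker_acyclic_zero Y m c : acyclic_from Y m -> m <= c ->
  ker_acyclic (0 : dghom Y (dgzero A)) c.
Proof.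
move=> aY mc i ci x cx _; have /(isbndP erefl)[y hy] := aY _ (le_trans mc ci) _ cx.
by exists y.
Qed.

(** The kernel is the desuspension of [V], acyclic from one degree lower; hence [c + 1]. *)
Lemma ker_acyclic_fib V m c : acyclic_from V m -> m <= c + 1 ->
  ker_acyclic (fib_out (dgid V)) c.
Proof.
move=> aV mc i ci z; have [x [t ->]] := fibP erefl z.
move=> /fibp_cyc[_ h] /= x0; move: h; rewrite {}x0 /= => /esym/cycP h.
have mi : m <= i + 1 by lia.
have /(isbndP erefl)[y hy] := aV _ mi _ h.
exists (fibp (dgid V) erefl 0 (- y)); split=> //; apply/esym.
apply: etrans (fibp_dif (dgid V) _ _ _ _) _.
by rewrite dif0 hom0 sub0r difN opprK hy.
Qed.

Lemma fib_out_sur V i y : exists x, fib_out (dgid V) i x = y.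
Proof. by exists (fibp (dgid V) erefl y 0). Qed.

Lemma zero_sur Y i y : exists x, (0 : dghom Y (dgzero A)) i x = y.
Proof. by exists 0; exact: etrans (ord1 _) (esym (ord1 _)). Qed.

(** Null-homotopies become strict lifts to the path module, so the lifting lemmas also produce
    homotopies. *)
Lemma null_out X V (f : dghom X V) :
  f ~ 0 <-> exists F, dgcomp (fib_out (dgid V)) F = f.
Proof.
split=> [h|[F <-]]; first by apply: fib_lift; rewrite comp1f.
rewrite -[fib_out _]comp1f -(comp0f V F); apply/htp_compr/fib_null.
Qed.

Variables (F : nat -> dgmod A) (u : forall k, dghom (F k) (F k.+1)) (c : int).
Hypotheses (Ffin : forall k, fincell (F k)) (uc : forall k : nat, cells (c + k%:Z) (u k)).

(** Cells attached after stage [k0] have degree at least [c + k0], so their obstructions lie where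
    the kernel of [p] is acyclic. *)
Lemma colim_lift_from E B (p : dghom E B) (f : dghom (colim u) B) (k0 : nat)
    (g : dghom (F k0) E) :
  (forall i y, exists x, p i x = y) -> ker_acyclic p (c + k0%:Z - 1) ->
  dgcomp p g = dgcomp f (colim_in u k0) ->
  exists2 h, dgcomp h (colim_in u k0) = g & dgcomp p h = f.
Proof.
move=> ps pk pg.
(* Up to stage [k0] the lift has to be the restriction of [g]; beyond it one more stage is lifted at
   a time. *)
pose P k (h : dghom (F k) E) := dgcomp p h = dgcomp f (colim_in u k) /\
  ((k <= k0)%N -> h = dgcomp g (push k u k0)).
pose R k (h : dghom (F k) E) (h' : dghom (F k.+1) E) := dgcomp h' (u k) = h.
have [||s _ hs] := @dep_seq _ P R (dgcomp g (push 0 u k0)).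
- by split=> //; rewrite dgcompA pg -dgcompA colim_in_push.
- move=> k h [ph hk]; case: (ltnP k k0) => kk0.
    exists (dgcomp g (push k.+1 u k0)).
      by split=> //; rewrite dgcompA pg -dgcompA colim_in_push.
    by rewrite /R -dgcompA pushSl // hk // ltnW.
  have [||h' hu ph'] := cells_lift (uc k) (p := p) (f := dgcomp f (colim_in u k.+1)) ps _ (g := h).
  - by move=> i ci; apply: pk; apply: le_trans ci; lia.
  - by rewrite ph -dgcompA colim_in_u.
  by exists h' => //; split=> // k1; move: kk0; rewrite leqNgt k1.
have [h hh] := colim_glue (fun k => (hs k).2).
exists h; first by rewrite hh (hs k0).1.2 // push_id compf1.
by apply: colim_ext => k; rewrite -dgcompA hh (hs k).1.1.
Qed.

Lemma kproj_colim : kproj (colim u).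
Proof.
move=> E B p ps pq f.
have [g hg] := fincell_lift (Ffin 0) (dgcomp f (colim_in u 0)) ps pq.
by have [h _ ph] := colim_lift_from ps (surj_qis_ker ps pq) hg; exists h.
Qed.

Lemma colim_stage (m : int) : exists k : nat, m <= c + k%:Z - 1.
Proof. by exists (absz m + absz c + 1)%N; lia. Qed.

Section Loc.
Variable S : multset (ring0 A).

Lemma loc_unit_inj X : loc_inj S (loc_unit S X).
Proof. by move=> i x /fr_eq0. Qed.

Lemma dgscale_res (V : dgmod (loc_dgring S)) a i (x : V i) :
  dgscale (res V) a i x = dgscale V (fr0 a (den1 S)) i x.
Proof. by []. Qed.

Lemma loc_unit_sur X : loc_sur S (loc_unit S X).
Proof.
move=> i z; have [x [s ->]] := frP z; exists (den s); first exact: denP.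
exists x; rewrite dgscale_res fr_split -!dgcompE -dgscaleM fr0K dgscale1 //.
Qed.

Lemma res_acyclic_from X m : acyclic_from X m -> acyclic_from (res (loc_dgmod S X)) m.
Proof.
move=> aX i mi z; have [x [s ->]] := frP (X := X) z => /fr_cyc[v Sv cv].
by apply/(fr_bnd (X := X)); exists v => //; exact: aX.
Qed.

(** Denominators are cleared on a finite stage [k]; the later cells lie above the homology of [Y],
    so that maps extend over them, uniquely up to homotopy. *)
Lemma colim_loc_lift Y m (f : dghom (loc_dgmod S (colim u)) (loc_dgmod S Y)) :
  acyclic_from Y m -> exists2 t, mset S t & exists g : dghom (colim u) Y,
  loc_hom S g ~ dgcomp f (dgscale _ (fr0 t (den1 S))).
Proof.
move=> aY; have [k hk] := colim_stage m.
have l0 : loc_inj S (dgid (dgzero A)).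
  by move=> i x _; exists 1; [exact: mset1 | exact: (etrans (ord1 _) (esym (ord1 _)))].
have sq0 : dgcomp 0 (loc_unit S Y) = dgcomp (dgid (dgzero A)) 0 by rewrite comp0f compf0.
have [|t St [g0 _ hg0]] := fincell_loc (@loc_unit_inj Y) (@loc_unit_sur Y) l0 sq0 (Ffin k)
    (g := 0) (f := dgcomp (flat f) (colim_in u k)); first by rewrite comp0f compf0.
have [|g hg _] := colim_lift_from (f := 0) (@zero_sur Y)
    (ker_acyclic_zero aY hk) (g := g0); first by rewrite comp0f comp0f.
exists t => //; exists g; apply/flat_htp; rewrite flat_loc.
rewrite -loc_dgscale flat_comp; apply/htp_sub/null_out.
have mk : m <= c + k%:Z - 1 + 1 by lia.
(* The two maps agree strictly on stage [k], and the zero lift there of their difference to the path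
   module extends to the whole colimit. *)
have [|h _ <-] := colim_lift_from (f := dgcomp (loc_unit S Y) g - dgcomp (flat f) (dgscale _ t))
    (@fib_out_sur _) (ker_acyclic_fib (res_acyclic_from aY) mk) (g := 0) (k0 := k).
  rewrite compf0 compBl -!dgcompA hg hg0 -(dgscale_nat (colim_in u k)).
  by rewrite -dgcompA subrr.
by exists h.
Qed.

(** A null-homotopy after localization is a lift to a localized path module; its denominators are
    cleared on a finite stage and the result extends over the remaining cells. *)
Lemma colim_loc_inj Y m (g : dghom (colim u) Y) :
  acyclic_from Y m -> loc_hom S g ~ 0 ->
  exists2 t, mset S t & dgcomp g (dgscale _ t) ~ 0.
Proof.
move=> aY /flat_htp; rewrite flat_loc.
have -> : flat (0 : dghom (loc_dgmod S (colim u)) (loc_dgmod S Y)) = 0 by exact: dghom_ext.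
move=> /null_out[H hH]; have [k hk] := colim_stage m.
pose l := loc_unit S Y.
have sq : dgcomp (dgid (res (loc_dgmod S Y))) l = dgcomp l (dgid Y) by rewrite comp1f compf1.
have li : loc_inj S (fib_map sq).
  move=> i z; have [x [y ->]] := fibP erefl z.
  rewrite fib_mapE -(fibp0 _ erefl) => /fibp_inj[/loc_unit_inj[s Ss hs] /loc_unit_inj[t St ht]].
  exists (s * t); first exact: msetM.
  have h1 : dgscale Y (s * t) i x = 0 by rewrite mulrC -dgscaleA hs hom0.
  have h2 : dgscale Y (s * t) (i + 1) y = 0 by rewrite -dgscaleA ht hom0.
  by rewrite dgscale_fibp h1 h2 fibp0.
have ls : loc_sur S (fib_map sq).
  move=> i z; have [x [y ->]] := fibP erefl z.
  have [s Ss [x' hx]] := loc_unit_sur x; have [t St [y' hy]] := loc_unit_sur y.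
  exists (s * t); first exact: msetM.
  exists (fibp (dgid Y) erefl (dgscale Y t i x') (dgscale Y s _ y')).
  rewrite fib_mapE dgscale_fibp !(dgscale_hom (loc_unit S Y)) -hx -hy !dgscaleA.
  by rewrite mulrC.
have [|t St [h0 ph0 _]] := fincell_loc li ls (loc_unit_inj (X := Y)) (fib_out_map sq) (Ffin k)
    (g := dgcomp g (colim_in u k)) (f := dgcomp H (colim_in u k)).
  by rewrite !dgcompA hH.
exists t => //; apply/null_out.
have mk : m <= c + k%:Z - 1 + 1 by lia.
have [|h _ <-] := colim_lift_from (f := dgcomp g (dgscale _ t)) (@fib_out_sur _)
    (ker_acyclic_fib aY mk) (g := h0) (k0 := k).
  by rewrite ph0 -!dgcompA (dgscale_nat (colim_in u k)).
by exists h.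
Qed.

End Loc.
End Tower.

(** * Elements and functoriality of mapping cones *)

Section ConeElements.
Variables (A : dgring) (M N : dgmod A) (f : dghom M N).

(** The analogue of [fibp]: the component in [M] may sit in any degree [k] with [k + 1 = i]. *)
Definition conep i k (e : k + 1 = i) (y : N i) (x : M k) : cone f i :=
  (y, gcast (X := M) (esym (cone_idx e)) x).

Lemma coneP i k (e : k + 1 = i) (z : cone f i) : exists y x, z = conep e y x.
Proof.
case: z => y x; exists y, (gcast (cone_idx e) (x : M (i - 1))).
by rewrite /conep (gcast_trans _ _ erefl).
Qed.

Lemma conep_dif i j k (e : j + 1 = i) (e' : k + 1 = j) y x :
  dif e (conep e y x) = conep e' (dif e y + f j x) (- dif e' x).
Proof.
congr (_, _); rewrite /=.
  by rewrite hom_gcast (gcast_trans _ _ erefl) gcast_id.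
by rewrite gcastN /ksign /=; congr (- _); apply/esym/gcast_dif.
Qed.

Lemma conep_inj i k (e : k + 1 = i) y x y' x' :
  conep e y x = conep e y' x' -> y = y' /\ x = x'.
Proof.
case=> -> h; split=> //.
by have := congr1 (gcast (X := M) (cone_idx e)) h; rewrite !(gcast_trans _ _ erefl) !gcast_id.
Qed.

Lemma conep0 i k (e : k + 1 = i) : conep e 0 0 = 0.
Proof. by rewrite /conep gcast0. Qed.

Lemma conepN i k (e : k + 1 = i) y x : - conep e y x = conep e (- y) (- x).
Proof. by rewrite /conep gcastN. Qed.

Lemma conepB i k (e : k + 1 = i) y x y' x' :
  conep e y x - conep e y' x' = conep e (y - y') (x - x').
Proof. by rewrite /conep gcastD gcastN. Qed.

Lemma cone_inE i k (e : k + 1 = i) y : cone_in f i y = conep e y 0.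
Proof. by rewrite /conep gcast0. Qed.

Lemma conep_cyc i k (e : k + 1 = i) y x :
  cyc (conep e y x) <-> cyc x /\ dif e y = - f k x.
Proof.
split=> [h|[cx h]].
  have := cyc_dif h e; rewrite (conep_dif _ (subrK 1 k)) -(conep0 (subrK 1 k)).
  move=> /conep_inj[h1 h2]; split; last by apply/eqP; rewrite -addr_eq0 h1.
  by apply/(cycP (subrK 1 k)); apply/eqP; rewrite -oppr_eq0 h2.
apply/(cycP e); rewrite (conep_dif _ (subrK 1 k)) (cyc_dif cx) h addNr oppr0.
exact: conep0.
Qed.

Lemma conep_bnd i k l (e : k + 1 = i) (e' : i + 1 = l) y x :
  isbnd (conep e y x) <-> exists y' x', y = dif e' y' + f i x' /\ x = - dif e x'.
Proof.
split=> [/(isbndP e')[z]|[y' [x' [-> ->]]]].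
  have [y' [x' ->]] := coneP e' z; rewrite (conep_dif e' e) => /conep_inj[-> ->].
  by exists y', x'.
by apply/(isbndP e'); exists (conep e' y' x'); rewrite (conep_dif e' e).
Qed.

Lemma cone_acyclic_qis : acyclic (cone f) -> qis f.
Proof.
move=> h; apply/qisE; split=> [k x cx /(isbndP erefl)[y hy]|i y cy].
  have /h : cyc (conep erefl (- y) x) by apply/conep_cyc; rewrite difN hy.
  move=> /(conep_bnd _ erefl)[y' [x' [_ ->]]]; apply: isbndN; exact: isbnd_dif.
have /h : cyc (conep (subrK 1 i) y 0).
  by apply/conep_cyc; rewrite hom0 oppr0 (cyc_dif cy); split=> //; exact: cyc0.
move=> /(conep_bnd _ erefl)[y' [x' [-> /eqP]]]; rewrite eq_sym oppr_eq0 => /eqP dx.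
exists x'; first exact/(cycP (subrK 1 i)).
by rewrite addrK; exact: isbnd_dif.
Qed.

End ConeElements.

Section ConeMap.
Variables (A : dgring) (X F F' : dgmod A) (f : dghom F X) (f' : dghom F' X).
Variables (u : dghom F F') (fu : dgcomp f' u = f).

Definition cone_map : dghom (cone f) (cone f').
Proof.
exists (fun i z => (z.1, u (i - 1) z.2) : cone f' i) => [i x y|i j k e r x|i j e x].
- by congr (_, _); exact: (homD u).
- congr (_, _).
  by rewrite /= (ksign_map _ _ (@homN _ _ _ u _)) homM.
- congr (_, _); last by rewrite /= (ksign_map _ _ (@homN _ _ _ u _)) hom_dif.
  by rewrite /= -fu.
Defined.

Lemma cone_mapE i k (e : k + 1 = i) y x :
  cone_map i (conep f e y x) = conep f' e y (u k x).
Proof. by congr (_, _); rewrite /= hom_gcast. Qed.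

End ConeMap.

(** * Resolutions *)

Section Resolution.
Variable A : dgring.
Implicit Types X Y F : dgmod A.

(** Since [A] is non-negative, a free cell of degree [m] lives in degrees at least [m], so nothing
    changes below [c]. *)
Lemma cells_deg c F F' (u : dghom F F') : cells c u ->
  (forall i, injective (u i)) /\ forall i, i < c -> forall y, exists x, u i x = y.
Proof.
elim=> {F F' u} [F|F F' u m n e0 z cz cm _ [inj sur]].
  by split=> [i x y|i _ y] //; exists y.
split=> [i x y /= [] /inj //|i ic [y a]].
have [x <-] := sur i ic y; exists x; congr (_, _).
by apply/esym/rnonneg; rewrite subr_lt0; apply: lt_le_trans cm.
Qed.

Section Kill.
Variables (F X : dgmod A) (f : dghom F X) (m : int).

Lemma cells_kill (s : seq (cone f m)) : (forall z, z \in s -> cyc z) ->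
  exists F' (u : dghom F F') (f' : dghom F' X) (fu : dgcomp f' u = f),
  cells m u /\ forall z, z \in s -> isbnd (cone_map fu m z).
Proof.
elim: s => [_|z s IH cs].
  exists F, (dgid F), f, (compf1 f); split=> //; exact: cells_id.
have [|F1 [u [f1 [fu [cu hs]]]]] := IH.
  by move=> w ws; apply: cs; rewrite inE ws orbT.
have cz : cyc (cone_map fu m z) by apply/cyc_hom/cs; rewrite inE eqxx.
have [x [y ez]] := coneP (subrK 1 m) (cone_map fu m z).
move: cz; rewrite ez => /conep_cyc[cy dx].
(* The cycle has components [x] in [X] and [y] in [F1]; a cell [e] with [d e = y] and value [- x]
   makes [- (x, y)] the boundary of [(0, e)]. *)
have [|g gi gc] := @attach_ext _ F1 m (m - 1) (subrK 1 m) y cy X f1 (- x).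
  by rewrite difN dx opprK.
have gu : dgcomp g (dgcomp (attach_in (subrK 1 m) cy) u) = f by rewrite dgcompA gi.
exists _, (dgcomp (attach_in (subrK 1 m) cy) u), g, gu; split.
  by apply: cells_attach => //; exact: lexx.
have e w : cone_map gu m w = cone_map gi m (cone_map fu m w) by [].
move=> w; rewrite inE => /orP[/eqP -> {w}|/hs h]; last by rewrite e; exact: isbnd_hom.
rewrite e ez cone_mapE -[X in isbnd X]opprK conepN; apply: isbndN.
apply/(conep_bnd _ _ erefl); exists 0, (cell (subrK 1 m) cy).
by rewrite dif0 add0r gc dif_cell.
Qed.
End Kill.

(** The quotient by [F] is a shifted copy of [A]; the sign turns a coefficient written to the left
    of the cell into the convention of [dgshift]. *)
Definition attach_out F m n (e0 : n + 1 = m) (z : F n) (cz : cyc z) :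
  dghom (attach e0 cz) (dgshift m (dgself A)).
Proof.
exists (fun i w => ksign (m * i) w.2 : dgshift m (dgself A) i) => [i x y|i j k e a x|i j e x].
- exact: ksignD.
- rewrite /= (@ksign_map _ _ (rmul (shift_idx m e) a) _ _ (actNr (X := dgself A) _ a)).
  have em : m * k = m * i + m * j by rewrite -e mulrDr.
  by rewrite ksign_add; apply: ksign_congr; rewrite em.
- rewrite /= (@ksign_map _ _ (rdif (shift_idx1 m e)) _ _ (rdifN _)) ksign_add.
  have em : m * i = m * j + m by rewrite -e mulrDr mulr1.
  by apply: ksign_congr; rewrite em; lia.
Defined.

Hypotheses (nH : noetherian (H0 A)) (DA : Dfb A (dgself A)).

Lemma Dfb_attach F m n (e0 : n + 1 = m) (z : F n) (cz : cyc z) :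
  Dfb A F -> Dfb A (attach e0 cz).
Proof.
move=> DF.
apply: (Dfb_exact nH (u := attach_in e0 cz) (v := attach_out e0 cz)) DF (Dfb_shift m DA).
move=> i [x a] cw h.
have [b hb] : exists b, a = rdif (shift_idx1 m erefl) b.
  have /isbnd_shiftE/(isbndP (shift_idx1 m erefl))[b /= hb] := h.
  exists (ksign (m * i) b).
  rewrite (@ksign_map _ _ (rdif (shift_idx1 m erefl)) _ _ (rdifN _)) -hb /=.
  by rewrite ksign_add ksign_even //; lia.
pose w : attach e0 cz i := (x, a) - dif erefl ((0, b) : attach e0 cz (i + 1)).
have ew : w = attach_in e0 cz i w.1.
  by congr (_, _); apply/eqP; rewrite subr_eq0; apply/eqP.
exists w.1; last by rewrite -ew /w opprB addrC subrK; exact: isbnd_dif.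
have : cyc w by apply: cycB => //; exact: cyc_dgdif.
rewrite ew => /cyc_dif hw; apply/(cycP (subrK 1 i)).
by have := congr1 fst (hw _ (subrK 1 i)); rewrite /= act0l ksign0 addr0.
Qed.

Lemma fincell_Dfb F : fincell F -> Dfb A F.
Proof.
elim=> {F} [|F m n e0 z cz _]; last exact: Dfb_attach.
exact: (Dfb_acyclic (@acyclic_zero A)).
Qed.

(** The homology of the cone in degree [m] is finitely generated because [F] and [X] lie in D^f_b;
    killing generators of it needs only cells of degree [m]. *)
Lemma resolution_step F X (f : dghom F X) (m : int) : fincell F -> Dfb A X ->
  (forall l, l < m -> forall z : cone f l, cyc z -> isbnd z) ->
  exists F' (u : dghom F F') (f' : dghom F' X), [/\ dgcomp f' u = f, cells m u &
    forall l, l < m + 1 -> forall z : cone f' l, cyc z -> isbnd z].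
Proof.
move=> fF DX h.
have /DfbP[_ hg] := Dfb_cone nH f (fincell_Dfb fF) DX.
have [s cs hs] := hg m.
have [F' [u [f' [fu [cu ks]]]]] := cells_kill cs.
exists F', u, f'; split=> // l lm z' cz'.
have [inj sur] := cells_deg cu.
have [x [y' ez]] := coneP (subrK 1 l) z'.
(* The component in [F'] has degree [l - 1 < m], where nothing was attached, so the cycle comes from
   the cone of [f]. *)
have [|y ey] := sur (l - 1) _ y'; first by lia.
have em : z' = cone_map fu l (conep f (subrK 1 l) x y) by rewrite cone_mapE ey.
have cz : cyc (conep f (subrK 1 l) x y).
  move: cz'; rewrite ez => /conep_cyc[cy' dx]; apply/conep_cyc; split.
    apply/(cycP (subrK 1 (l - 1))); apply: inj.
    by rewrite hom_dif hom0 ey; exact: cyc_dif.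
  by rewrite dx -ey -dgcompE fu.
rewrite em; have [/h hl|ml] := ltP l m; first exact/isbnd_hom/hl.
have elm : l = m by lia.
move: (conep _ _ _ _) cz; rewrite elm => w /hs {em ez cz'}.
elim: s cs ks {hs} w => [_ _ w h0|g s IH cs ks w [a /IH hw]]; first exact: isbnd_hom.
rewrite -[w](subrK (dgscale _ a m g)) homD; apply: isbndD.
  by apply: hw => v vs; [apply: cs|apply: ks]; rewrite inE vs orbT.
by rewrite dgscale_hom; apply/isbnd_scale/ks; rewrite inE eqxx.
Qed.

Theorem resolution X : Dfb A X ->
  exists (F : nat -> dgmod A) (u : forall k, dghom (F k) (F k.+1)) (c : int),
  [/\ forall k, fincell (F k), forall k : nat, cells (c + k%:Z) (u k) &
      exists e : dghom (colim u) X, qis e].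
Proof.
move=> DX; have /DfbP[[N hN] _] := DX.
(* The homology of [X] vanishes below [- N], so the zero module is a valid start with cells of
   degree at least [- N]. *)
pose c : int := - N%:Z.
pose T := {F : dgmod A & dghom F X}.
pose P (k : nat) (x : T) := fincell (projT1 x) /\
  forall l, l < c + k%:Z -> forall z : cone (projT2 x) l, cyc z -> isbnd z.
pose R (k : nat) (x y : T) := exists2 u : dghom (projT1 x) (projT1 y), cells (c + k%:Z) u &
  dgcomp (projT2 y) u = projT2 x.
have [||s _ hs] := @dep_seq (fun=> T) P R
  (existT (fun F => dghom F X) (dgzero A) (0 : dghom (dgzero A) X)).
- split; first exact: fincell0.
  change (forall l, l < c + 0%:Z ->
    forall z : cone (0 : dghom (dgzero A) X) l, cyc z -> isbnd z).
  move=> l lc z; have [x [y ->]] := coneP (subrK 1 l) z.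
  move=> /conep_cyc[_]; rewrite zerofE oppr0 => /cycP cx.
  have /(isbndP erefl)[x' hx'] : isbnd x by apply: hN => //; lia.
  apply/(conep_bnd _ _ erefl); exists x', 0; split; first by rewrite zerofE addr0.
  exact: etrans (ord1 _) (esym (ord1 _)).
- move=> k [F f] [fF h]; have [F' [u [f' [fu cu h']]]] := resolution_step fF DX h.
  exists (existT (fun F => dghom F X) F' f'); last by exists u.
  split; first exact: cells_fincell cu fF.
  by move=> l lc; apply: h'; lia.
pose F k := projT1 (s k).
pose u k : dghom (F k) (F k.+1) := s2val (cid2 (hs k).2).
have cu k : cells (c + k%:Z) (u k) by exact: (s2valP (cid2 (hs k).2)).
have fu k : dgcomp (projT2 (s k.+1)) (u k) = projT2 (s k) by exact: (s2valP' (cid2 (hs k).2)).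
exists F, u, c; split=> // [k|]; first exact: (hs k).1.1.
have [e he] := colim_glue fu; exists e; apply: cone_acyclic_qis => l z.
have [x [y ->]] := coneP (subrK 1 l) z => /conep_cyc[cy dx].
have [k0 [y0 ey0]] := colimP y.
have [k1 k01 hk1] : exists2 k, (k0 <= k)%N & dif (subrK 1 (l - 1)) (push k0 u k _ y0) = 0.
  have : colim_in u k0 _ (dif (subrK 1 (l - 1)) y0) = 0.
    by rewrite hom_dif -ey0; exact: cyc_dif.
  by move=> /colim_in_eq0[k k0k hk]; exists k; rewrite // -hom_dif.
(* A stage so late that the lift of [y] is a cycle there and that the cone is already acyclic in
   degree [l]. *)
pose k := maxn k1 (absz l + N + 1)%N.
have k0k : (k0 <= k)%N by apply: leq_trans k01 _; exact: leq_maxl.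
pose yk := push k0 u k _ y0.
have eyk : y = colim_in u k _ yk by rewrite -dgcompE colim_in_push.
have cyk : cyc yk.
  apply/(cycP (subrK 1 (l - 1))); rewrite /yk -(push_push u k01 (leq_maxl _ _)) dgcompE.
  by rewrite -hom_dif hk1 hom0.
have /((hs k).1.2 l) hb : cyc (conep (projT2 (s k)) (subrK 1 l) x yk).
  by apply/conep_cyc; split=> //; rewrite dx eyk -dgcompE he.
rewrite eyk -(cone_mapE (he k)); apply/isbnd_hom/hb.
have : (absz l + N + 1 <= k)%N by exact: leq_maxr.
by rewrite /c; lia.
Qed.

End Resolution.

(** * Extensions and levels *)

Section Roofs.
Variable A : dgring.
Implicit Types X Y Z V W : dgmod A.

Lemma roof_comp_strict X Y Z (F : roof X Y) (G : roof Y Z) (K : roof X Z) W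
    (u : dghom W (apex F)) (v : dghom W (apex G)) (t : dghom W (apex K)) : qis u ->
  dgcomp (rnum F) u = dgcomp (rden G) v -> dgcomp (rden F) u = dgcomp (rden K) t ->
  dgcomp (rnum G) v = dgcomp (rnum K) t -> roof_comp F G K.
Proof.
move=> qu e1 e2 e3; exists W, u, v, qu; split; first by rewrite e1; exact: htp_refl.
exists W, (dgid W), t; split; rewrite /= !compf1 ?e2 ?e3; try exact: htp_refl.
by rewrite -e2; apply: qis_comp => //; exact: rqis.
Qed.

Lemma roof_iso_qis X Y (F : roof X Y) : qis (rnum F) -> roof_iso F.
Proof.
move=> qn; pose G : roof Y X := Roof (rden F) qn; exists G; split.
  by apply: (@roof_comp_strict _ _ _ F G (roof_hom (dgid X)) (apex F) (dgid _) (dgid _) (rden F));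
    rewrite /= ?compf1 ?comp1f //; exact: qis_id.
by apply: (@roof_comp_strict _ _ _ G F (roof_hom (dgid Y)) (apex F) (dgid _) (dgid _) (rnum F));
  rewrite /= ?compf1 ?comp1f //; exact: qis_id.
Qed.

Lemma isoD_span X Y W (u : dghom W X) (v : dghom W Y) : qis u -> qis v -> isoD X Y.
Proof. by move=> qu qv; exists (Roof v qu); exact: roof_iso_qis. Qed.

Lemma thick1_span (S G : dgmod A -> Prop) X Y W (u : dghom W X) (v : dghom W Y) :
  S X -> S (dgzero A) -> qis u -> qis v -> thick1 S G Y -> thick1 S G X.
Proof.
move=> SX S0 qu qv; apply: (Thick1_summand SX S0).
apply: isoD_span qv; apply: qis_comp qu; apply: sum_in1_qis; exact: acyclic_zero.
Qed.

End Roofs.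

Section ConeFib.
Variables (A : dgring) (W Z : dgmod A) (g : dghom W Z).

Lemma cone_fib_idx (i : int) : i - 1 - -1 = i. Proof. by lia. Qed.

Lemma snd_ksign (V U : zmodType) n (z : V * U) : (ksign n z).2 = ksign n z.2.
Proof. by rewrite /ksign; case: ifP. Qed.

(** This quasi-isomorphism identifies the cone of [fib g -> W] with [Z]; through it fibre sequences
    become exact triangles. *)
Definition cone_fib : dghom (cone (fib_out g)) Z.
Proof.
exists (fun i z => g i z.1 + gcast (X := Z) (cone_fib_idx i) z.2.2).
- by move=> i [w [w' z]] [v [v' y]]; rewrite /= homD gcastD addrACA.
- move=> i j k e a [w [w' z]].
  rewrite /= homM actDr; congr (_ + _).
  rewrite snd_ksign gcast_ksign mul1r /= gcast_ksign ksign_add ksign_even; last by lia.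
  exact: gcast_act.
- move=> i j e [w [w' z]].
  rewrite /= difD homD -addrA hom_dif; congr (_ + _).
  rewrite hom_gcast gcastN gcastD (gcast_trans _ _ (cone_idx e)) opprD addrA subrr add0r.
  by rewrite /ksign /= gcastN opprK; exact: gcast_dif.
Defined.

Lemma cone_fibE i k (e : k + 1 = i) w w' z :
  cone_fib i (conep (fib_out g) e w (fibp g e w' z)) = g i w + z.
Proof.
rewrite /=; congr (_ + _); case: i / e w z => w z /=.
rewrite [X in gcast _ X](_ : _ = gcast (X := Z) (esym (unfib_idx (subrK 1 (k + 1)))) z).
  by rewrite (gcast_trans _ _ erefl).
have h (a b : int) (q : a = b) (x : fib g a) (p : a - -1 = b - -1) :
    (gcast q x).2 = gcast (X := Z) p x.2.
  by case: b / q p => p; rewrite !gcast_id.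
have p : k - -1 = k + 1 - 1 - -1 by lia.
by rewrite (h _ _ _ _ p) /=; apply: gcast_trans.
Qed.

Lemma cone_fib_in : dgcomp cone_fib (cone_in (fib_out g)) = g.
Proof. by apply: dghom_ext => i x; rewrite /= gcast0 addr0. Qed.

Lemma cone_fib_qis : qis cone_fib.
Proof.
apply/qisE; split=> [i c|i y cy].
  have [w [m ->]] := coneP (subrK 1 i) c; have [w' [z ->]] := fibP (subrK 1 i) m.
  rewrite cone_fibE => /conep_cyc[_ hw] /(isbndP erefl)[y hy].
  apply/(conep_bnd _ _ erefl); exists 0, (fibp g erefl w y); split.
    by rewrite dif0 add0r.
  apply/esym; rewrite (fibp_dif g (subrK 1 i) erefl) -hy opprD addrA subrr add0r hw.
  by rewrite fibpN !opprK.
exists (conep (fib_out g) (subrK 1 i) 0 (fibp g (subrK 1 i) 0 y)).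
  apply/conep_cyc; split; last by rewrite /= dif0 oppr0.
  by apply/fibp_cyc; rewrite hom0 (cyc_dif cy); split=> //; exact: cyc0.
by rewrite cone_fibE hom0 add0r subrr; exact: isbnd0.
Qed.

End ConeFib.

(** * Levels of localized extensions *)

Section SumsOfShifts.
Variable A : dgring.
Implicit Types X Y Z W : dgmod A.

(** Direct summands are left out on purpose, since those of a localized module need not come from
    [A]; [retract] takes care of them. *)
Inductive sums (G : dgmod A -> Prop) : dgmod A -> Prop :=
| sums_gen X : G X -> sums G X
| sums_zero : sums G (dgzero A)
| sums_sum X Y : sums G X -> sums G Y -> sums G (dgsum X Y)
| sums_shift n X : sums G X -> sums G (dgshift n X)
| sums_qis X Y (q : dghom X Y) : qis q -> sums G X -> sums G Y
| sums_qis' X Y (q : dghom X Y) : qis q -> sums G Y -> sums G X.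

(* W is an n-fold extension of objects of [sums G]: the fibre of g : W -> Z is the
   piece that is split off. *)
Fixpoint built (G : dgmod A -> Prop) (n : nat) (W : dgmod A) : Prop :=
  if n is n'.+1 then exists Z (g : dghom W Z), [/\ Dfb A Z, sums G (fib g) & built G n' Z]
  else acyclic W.

Variable G : dgmod A -> Prop.
Hypothesis DG : forall Y, G Y -> Dfb A Y.
Hypothesis nH : noetherian (H0 A).

Lemma sums_Dfb Y : sums G Y -> Dfb A Y.
Proof.
elim=> {Y} [X /DG //||X Y _ DX _ DY|n X _ DX|X Y q qq _|X Y q qq _].
- exact: (Dfb_acyclic (@acyclic_zero A)).
- exact: Dfb_sum.
- exact: Dfb_shift.
- by move/(Dfb_qis nH qq).
- by move/(Dfb_qis nH qq).
Qed.

Variable S : multset (ring0 A).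
Local Notation AS := (loc_dgring S).
Local Notation "X '_S'" := (loc_dgmod S X) (at level 2, format "X '_S'").

(** When [S] is the complement of a prime, this unfolds to [subcat_at]. *)
Definition loc_class : dgmod AS -> Prop := fun V => exists2 X, G X & V = X _S.

Lemma Dfb_zero (B : dgring) : Dfb B (dgzero B).
Proof. exact: (Dfb_acyclic (@acyclic_zero B)). Qed.

Lemma thick1_loc Y : sums G Y -> thick1 (Dfb AS) loc_class Y _S.
Proof.
have span X Z (q : dghom X Z) : sums G X -> sums G Z -> qis q ->
    thick1 (Dfb AS) loc_class X _S <-> thick1 (Dfb AS) loc_class Z _S.
  move=> sX sZ qq; split.
    apply: (thick1_span (u := loc_hom S q) (v := dgid _)) (Dfb_loc S (sums_Dfb sZ)) _ _ _.
    - exact: Dfb_zero.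
    - exact: loc_qis0.
    - exact: qis_id.
  apply: (thick1_span (u := dgid _) (v := loc_hom S q)) (Dfb_loc S (sums_Dfb sX)) _ _ _.
  - exact: Dfb_zero.
  - exact: qis_id.
  - exact: loc_qis0.
have aux X (V : dgmod AS) (q : dghom X _S V) : sums G X -> qis q ->
    thick1 (Dfb AS) loc_class V -> thick1 (Dfb AS) loc_class X _S.
  move=> sX qq; apply: (thick1_span (u := dgid _) (v := q)) (Dfb_loc S (sums_Dfb sX)) _ _ qq.
    exact: Dfb_zero.
  exact: qis_id.
elim=> {Y} [X GX||X Y sX tX sY tY|n X sX tX|X Y q qq sX tX|X Y q qq sY tY].
- by apply: Thick1_gen; [exact/Dfb_loc/DG | exists X].
- apply: (aux _ _ (0 : dghom _ (dgzero AS))); [exact: sums_zero| |exact: Thick1_zero].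
  apply/qisE; split=> [i x cx _|i y _]; first exact: (loc_acyclic (@acyclic_zero A)).
  by exists 0; [exact: cyc0 | have -> : y = 0; [exact: (ord1 y)| rewrite subrr; exact: isbnd0]].
- exact: (aux _ _ _ (sums_sum sX sY) (loc_sum_qis S X Y) (Thick1_sum tX tY)).
- exact: (aux _ _ _ (sums_shift n sX) (loc_shift_qis S n X) (Thick1_shift n tX)).
- exact: ((span _ _ q sX (sums_qis qq sX) qq).1 tX).
- exact: ((span _ _ q (sums_qis' qq sY) sY qq).2 tY).
Qed.

(** The complement [C] is carried along because levels above 1 are defined by triangles whose middle
    term is [X] plus a complement in D^f_b. *)
Lemma thick_loc n W X C (q : dghom W _S (dgsum X _S C _S)) :
  Dfb A X -> Dfb A C -> built G n W -> qis q ->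
  thick (Dfb AS) loc_class n X _S.
Proof.
elim: n W X C q => [|[|n] IH] W X C q DX DC.
- move=> aW qq /=; split; first exact: Dfb_loc.
  have aS : acyclic X _S.
    move=> i x cx; have := (qis_acyclic qq).1 (loc_acyclic aW).
    move=> /(_ i (x, 0)) h; have [|//] := (sum_bnd x (0 : C _S i)).1 (h _).
    by apply/sum_cyc; split=> //; exact: cyc0.
  apply: (isoD_span (u := dgid _) (v := (0 : dghom _ (dgzero AS)))); first exact: qis_id.
  apply/qisE; split=> [i x cx _|i y _]; first exact: aS.
  by exists 0; [exact: cyc0 | have -> : y = 0; [exact: (ord1 y)| rewrite subrr; exact: isbnd0]].
- move=> [Z [g [DZ sg aZ]]] qq /=.
  apply: (Thick1_summand (Dfb_loc S DX) (Dfb_loc S DC) _ (thick1_loc sg)).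
  apply: (isoD_span (u := dgcomp q (loc_hom S (fib_out g))) (v := dgid _)); last exact: qis_id.
  by apply: qis_comp => //; apply/loc_qis0/fib_qis.
- move=> [Z [g [DZ sg bZ]]] qq.
  change (Dfb AS X _S /\ exists X' X1 X2 : dgmod AS,
    [/\ Dfb AS X', thick1 (Dfb AS) loc_class X1, thick (Dfb AS) loc_class n.+1 X2 &
        exists (u : roof X1 (dgsum X _S X')) (v : roof (dgsum X _S X') X2)
          (w : roof X2 (dgshift 1 X1)), exact_triangle u v w]).
  split; first exact: Dfb_loc.
  exists C _S, (fib g) _S, Z _S; split; [exact: Dfb_loc | exact: thick1_loc | |].
    (* The quotient [Z] is itself an extension with one layer less, so its complement is 0. *)
    apply: (IH Z Z (dgzero A) (dgcomp (sum_pair (loc_hom S (sum_pr1 _ _)) (loc_hom S (sum_pr2 _ _)))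
      (loc_hom S (sum_in1 Z (dgzero A))))) => //; first exact: Dfb_zero.
    apply: qis_comp; first exact: loc_sum_qis.
    by apply/loc_qis0/sum_in1_qis; exact: acyclic_zero.
  (* The model triangle is the cone sequence of the localized [fib g -> W]; [v] and [w] are proper
     roofs, because [q] and the comparison of the cone with [Z] are inverted in them. *)
  pose f := loc_hom S (fib_out g).
  pose k : dghom (cone (fib_out g)) _S (cone f) := loc_cone S (fib_out g).
  have qk : qis k by exact: loc_cone_qis.
  have qc : qis (loc_hom S (cone_fib g)) by exact/loc_qis0/cone_fib_qis.
  pose u := roof_hom (dgcomp q f).
  pose v := Roof (loc_hom S g) qq.
  pose w := Roof (dgcomp (cone_out f) k) qc.
  exists u, v, w, (fib g) _S, W _S, f, (roof_hom (dgid _)), (Roof (dgid _) qq), (Roof k qc).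
  split; split; try by apply: roof_iso_qis => //; exact: qis_id.
  + exists (roof_hom f); split.
      by apply: (@roof_comp_strict _ _ _ _ u (Roof (dgid _) qq) (roof_hom f) _ (dgid _) f (dgid _));
        rewrite /= ?compf1 ?comp1f //; exact: qis_id.
    by apply: (@roof_comp_strict _ _ _ _ (roof_hom (dgid _)) (roof_hom f) (roof_hom f) _
        (dgid _) (dgid _) (dgid _)); rewrite /= ?compf1 ?comp1f //; exact: qis_id.
  + exists (Roof (cone_in f) qq); split.
      apply: (@roof_comp_strict _ _ _ _ v (Roof k qc) (Roof (cone_in f) qq) _
        (dgid _) (loc_hom S (cone_in (fib_out g))) (dgid _)); rewrite /= ?compf1 ?comp1f //.
      * exact: qis_id.
      * by rewrite -loc_hom_comp cone_fib_in.
      * exact: loc_cone_in.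
    by apply: (@roof_comp_strict _ _ _ _ (Roof (dgid _) qq) (roof_hom (cone_in f))
        (Roof (cone_in f) qq) _ (dgid _) (dgid _) (dgid _));
      rewrite /= ?compf1 ?comp1f //; exact: qis_id.
  + exists w; split.
      by apply: (@roof_comp_strict _ _ _ _ w (roof_shift 1 (roof_hom (dgid _))) w _
        (dgid _) (rnum w) (dgid _)); rewrite /= ?shift_hom_id ?compf1 ?comp1f //; exact: qis_id.
    by apply: (@roof_comp_strict _ _ _ _ (Roof k qc) (roof_hom (cone_out f)) w _
        (dgid _) k (dgid _)); rewrite /= ?compf1 ?comp1f //; exact: qis_id.
Qed.

End SumsOfShifts.

Section FibQis.
Variable A : dgring.
Implicit Types X Y Z W K M T : dgmod A.

Lemma fib_map_qis M M' T (g : dghom M T) (g' : dghom M' T) (a : dghom M M')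
    (sq : dgcomp g' a = dgcomp (dgid T) g) : qis a -> qis (fib_map sq).
Proof.
move=> /qisE[ai aS].
have gE i x : g i x = g' i (a i x) by rewrite -dgcompE sq comp1f.
apply/qisE; split=> [i c|i c].
  have [w [t ->]] := fibP erefl c; rewrite fib_mapE => /fibp_cyc[cw hw].
  move=> /(fibp_bnd _ _ erefl)[w1 [t1 [e1 e2]]].
  have /(isbndP erefl)[w0 e0] : isbnd w.
    by apply: ai => //; rewrite e1; exact: isbnd_dif.
  have [|c0 cc0 /(isbndP erefl)[e he]] := aS _ (w1 - a _ w0).
    by apply/(cycP erefl); rewrite difD difN -hom_dif -e0 e1 subrr.
  apply/(fibp_bnd _ _ erefl); exists (w0 + c0), (t1 - g' _ e); split.
    by rewrite difD (cyc_dif cc0) addr0.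
  have aux (p q r D : T (i + 1)) : p - D = q + r - (D - (p - q - r)).
    by rewrite opprB -[p - q - r]addrA -opprD addrA [q + r + _]addrC subrK.
  rewrite -[t]/(dgid T _ t) e2 difD difN -hom_dif -he homD !homB !gE; exact: aux.
have [w' [t' ->]] := fibP erefl c => /fibp_cyc[cw' ht'].
have [w cw /(isbndP erefl)[e he]] := aS _ _ cw'.
exists (fibp g erefl w (t' - g' _ e)).
  apply/fibp_cyc; split=> //.
  by rewrite difD difN -ht' -hom_dif -he homB subKr gE.
rewrite fib_mapE fibpB; apply/(fibp_bnd _ _ erefl); exists e, 0.
by rewrite he dif0 subr0 subKr.
Qed.

(** Surjectivity of [g] lets the second component of a fibre cycle be absorbed into [W] modulo
    boundaries; what remains lies in the kernel. *)
Lemma ses_fib K W Z (k : dghom K W) (g : dghom W Z) : dgcomp g k = 0 ->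
  (forall i, injective (k i)) -> (forall i w, g i w = 0 -> exists x, k i x = w) ->
  (forall i z, exists w, g i w = z) -> exists q : dghom K (fib g), qis q.
Proof.
move=> gk ki kex gs.
have gk0 i x : g i (k i x) = 0 by rewrite -dgcompE gk.
unshelve eexists.
  exists (fun i x => (k i x, 0) : fib g i) => [i x y|i j l e a x|i j e x].
  - by congr (_, _); [exact: homD | rewrite addr0].
  - by congr (_, _); [exact: homM | exact/esym/act0r].
  - by congr (_, _); [exact: hom_dif | rewrite /= gk0 gcast0 dif0 ksign0 addr0].
have qE i x : (k i x, 0) = fibp g erefl (k i x) 0 :> fib g i by rewrite /fibp gcast0.
apply/qisE; split=> [i x cx|i c] /=.
  rewrite qE => /(fibp_bnd _ _ erefl)[w [z [ew ez]]].
  have [w2 ew2] := gs _ z.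
  have [|x' ex'] := kex _ (w - dif erefl w2); first by rewrite homB hom_dif ew2 -ez.
  apply/(isbndP erefl); exists x'; apply: ki.
  by rewrite hom_dif ex' difD difN dif_dif subr0.
have [w [z ->]] := fibP erefl c => /fibp_cyc[cw hw].
have [w2 ew2] := gs _ z.
have [|x ex] := kex _ (w - dif erefl w2); first by rewrite homB hom_dif ew2 hw subrr.
exists x.
  apply/(cycP (subrK 1 i)); apply: ki; rewrite hom_dif hom0 ex.
  by apply: cyc_dif; apply: cycB => //; exact: cyc_dgdif.
rewrite qE fibpB; apply/(fibp_bnd _ _ erefl); exists w2, 0.
by rewrite ex dif0 !subr0 subKr.
Qed.

Lemma cone_id_acyclic M : acyclic (cone (dgid M)).
Proof.
move=> i c; have [y [x ->]] := coneP (subrK 1 i) c => /conep_cyc[_ /= hy].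
by apply/(conep_bnd _ _ erefl); exists 0, y; rewrite dif0 add0r hy opprK.
Qed.
End FibQis.

(** * Spreading out *)

Section Forward.
Variables (A : dgring) (S : multset (ring0 A)).
Implicit Types X Y Z W P Q : dgmod A.
Local Notation AS := (loc_dgring S).
Local Notation "X '_S'" := (loc_dgmod S X) (at level 2, format "X '_S'").
Implicit Types V U M N : dgmod AS.
Local Notation den1S := (den1 S).

(* The last two conditions say that Hom_{D(A)}(P, Y) localizes to
   Hom_{D(A_S)}(P_S, Y_S) for every Y in D^f_b(A). *)
Record tame P : Prop := Tame {
  tame_Dfb : Dfb A P;
  tame_kproj : kproj P;
  tame_lift : forall Y, Dfb A Y -> forall f : dghom P _S Y _S,
    exists2 t, mset S t & exists g : dghom P Y,
      loc_hom S g ~ dgcomp f (dgscale _ (fr0 t den1S));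
  tame_inj : forall Y, Dfb A Y -> forall g : dghom P Y, loc_hom S g ~ 0 ->
    exists2 t, mset S t & dgcomp g (dgscale _ t) ~ 0 }.

Lemma hbounded_from Y n : hbounded Y n -> acyclic_from Y (n%:Z + 1).
Proof. by move=> h i ni; apply: h; lia. Qed.

Hypotheses (nH : noetherian (H0 A)) (DA : Dfb A (dgself A)).

Lemma tame_resolution X : Dfb A X -> exists2 P, tame P & exists e : dghom P X, qis e.
Proof.
move=> DX; have [F [u [c [fF cu [e qe]]]]] := resolution nH DA DX.
exists (colim u); last by exists e.
split.
- exact/(Dfb_qis nH qe).
- exact: kproj_colim fF cu.
- move=> Y /DfbP[[n hn] _] f; exact: (colim_loc_lift fF cu _ (hbounded_from hn)).
- move=> Y /DfbP[[n hn] _] g; exact: (colim_loc_inj fF cu (hbounded_from hn)).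
Qed.

Lemma fr0_inv t : mset S t -> exists2 c : ring0 AS, fr0 t den1S * c = 1 & c * fr0 t den1S = 1.
Proof.
move=> St; pose v : set_type S := exist _ t (mem_set St).
by exists (fr0 1 v); [|rewrite mulrC]; exact: (fr0K v).
Qed.

Variable G : dgmod A -> Prop.
Hypothesis DG : forall Y, G Y -> Dfb A Y.

(* A test for V to be a retract of a localized n-fold extension: every map from a
   tame module to V factors, up to homotopy, through such an extension. *)
Definition approx n V : Prop := forall P, tame P -> forall f : dghom P _S V,
  exists W, [/\ tame W, built G n W & exists (a : dghom P W) (b : dghom W _S V),
    f ~ dgcomp b (loc_hom S a)].

(** [nat_map] does not include additivity; naturality along the zero endomorphism of [C] gives the
    claim. *)
Lemma nat_map0 V U (i : nat_map V U) C (kC : kproj C) f : f ~ 0 -> i C kC f ~ 0.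
Proof.
move=> /(nmap_htp i kC) h; apply: htp_trans h _.
have := nmap_comp i kC kC (0 : dghom C C) (0 : dghom C V).
by rewrite !compf0.
Qed.

Lemma approx_retract n V U : retract V U -> approx n U -> approx n V.
Proof.
move=> [i [r ri]] aU P tP f; have kP := kproj_loc (S := S) (tame_kproj tP).
have [W [tW bW [a [b hb]]]] := aU P tP (i _ kP f).
have kW := kproj_loc (S := S) (tame_kproj tW).
exists W; split=> //; exists a, (r _ kW b).
apply: htp_trans (htp_sym (ri _ kP f)) _.
apply: htp_trans (nmap_htp r kP hb) _; exact: nmap_comp.
Qed.

(** Up to a denominator, [i f] comes from a map over [A]; a further denominator kills its composite
    with [a], which vanishes after localization. Both are undone by an inverse scalar in [b]. *)
Lemma retract_factor P P' V Q (f : dghom P _S V) (a : dghom P' P) :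
  tame P -> tame P' -> tame Q -> retract V Q _S -> dgcomp f (loc_hom S a) ~ 0 ->
  exists (g : dghom P Q) (b : dghom Q _S V),
    f ~ dgcomp b (loc_hom S g) /\ dgcomp g a ~ 0.
Proof.
move=> tP tP' tQ [i [r ri]] fa.
have kP := kproj_loc (S := S) (tame_kproj tP); have kP' := kproj_loc (S := S) (tame_kproj tP').
have kQ := kproj_loc (S := S) (tame_kproj tQ).
have [t St [g0 hg0]] := tame_lift tP (tame_Dfb tQ) (i _ kP f).
have [|t' St' hg] := tame_inj tP' (tame_Dfb tQ) (g := dgcomp g0 a).
  rewrite loc_hom_comp; apply: htp_trans (htp_compr _ hg0) _.
  rewrite -dgcompA -dgscale_nat dgcompA -(comp0f _ (dgscale P' _S (fr0 t den1S))).
  apply: htp_compr; apply: htp_trans (htp_sym (nmap_comp i kP kP' _ _)) _.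
  exact: nat_map0.
pose g := dgcomp g0 (dgscale P t').
have [s Ss hgs] : exists2 s, mset S s &
    loc_hom S g ~ dgcomp (i _ kP f) (dgscale _ (fr0 s den1S)).
  exists (t * t'); first exact: msetM.
  by rewrite /g loc_hom_comp loc_dgscale fr0M dgscaleM dgcompA; exact: htp_compr.
have [c sc cs] := fr0_inv Ss.
pose b0 := r _ kQ (dgid Q _S).
exists g, (dgcomp b0 (dgscale _ c)); split; last first.
  by rewrite /g -dgcompA -dgscale_nat dgcompA.
have e1 : dgcomp b0 (loc_hom S g) ~ dgcomp f (dgscale _ (fr0 s den1S)).
  apply: htp_trans (htp_sym (nmap_comp r kQ kP (loc_hom S g) (dgid _))) _.
  rewrite comp1f; apply: htp_trans (nmap_htp r kP hgs) _.
  apply: htp_trans (nmap_comp r kP kP _ _) _; apply: htp_compr; exact: ri.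
rewrite -dgcompA -dgscale_nat dgcompA.
apply: htp_sym; apply: htp_trans (htp_compr _ e1) _.
by rewrite -dgcompA -dgscaleM sc dgscale1 compf1; exact: htp_refl.
Qed.

Lemma tame_model V Y : sums G Y -> retract V Y _S ->
  exists Q, [/\ tame Q, sums G Q & retract V Q _S].
Proof.
move=> sY rV; have [Q tQ [e qe]] := tame_resolution (sums_Dfb DG nH sY).
exists Q; split=> //; first exact: sums_qis' qe sY.
apply: retract_trans rV _; exact: retract_qis (loc_qis0 S qe).
Qed.

(** A factorization for [cone f] is corrected by two modules of [sums G], one covering the shift of
    [M] and one covering [M]; together they form the new layer. *)
Lemma approx_extend n M N (f : dghom M N) Y :
  sums G Y -> retract M Y _S -> approx n (cone f) -> approx n.+1 N.
Proof.
move=> sY rM aC P tP h.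
have [Z [tZ bZ [a [b hb]]]] := aC P tP (dgcomp (cone_in f) h).
have [Q [tQ sQ rQ]] : exists Q, [/\ tame Q, sums G Q & retract (dgshift 1 M) Q _S].
  apply: (tame_model (sums_shift 1 sY)); apply: retract_trans (retract_shift 1 rM) _.
  exact: retract_qis (loc_shift_qis S 1 Y).
(* The connecting map [Z_S -> Sigma M] vanishes on [P_S], so it factors through some [x : Z -> Q]
   over [A] that vanishes on [P]; then [a] lifts to the fibre of [x]. *)
have [|x [r [hr xa]]] :=
    @retract_factor Z P _ Q (dgcomp (cone_out f) b) a tZ tP tQ rQ.
  rewrite -dgcompA; apply: htp_trans (htp_compl _ (htp_sym hb)) _.
  rewrite dgcompA (_ : dgcomp (cone_out f) (cone_in f) = 0); last exact: dghom_ext.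
  by rewrite comp0f; exact: htp_refl.
have [a' ha'] := fib_lift xa.
have [g hg] : exists g : dghom (fib x) _S N,
    dgcomp (cone_in f) g ~ dgcomp b (loc_hom S (fib_out x)).
  apply: cone_lift; rewrite dgcompA; apply: htp_trans (htp_compr _ hr) _.
  rewrite -dgcompA -loc_hom_comp; apply: htp_trans (htp_compl _ (loc_htp S (fib_null x))) _.
  by rewrite loc_hom0 compf0; exact: htp_refl.
(* [h] and [g a'] agree only after mapping to the cone; their difference comes from [M] and is
   factored through the second module [Q']. *)
have [d hd] : exists d, dgcomp f d ~ h - dgcomp g (loc_hom S a').
  apply: cone_fact; rewrite compBr; apply/(proj1 (htp_sub _ _)).
  apply: htp_trans hb _; apply: htp_sym; rewrite dgcompA.
  apply: htp_trans (htp_compr _ hg) _; rewrite -dgcompA -loc_hom_comp ha'.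
  exact: htp_refl.
have [Q' [tQ' sQ' rQ']] := tame_model sY rM.
have [|x' [r' [hr' _]]] := @retract_factor P P _ Q' d 0 tP tP tQ' rQ'.
  by rewrite loc_hom0 compf0; exact: htp_refl.
pose W1 := dgsum (fib x) Q'.
pose a1 : dghom P W1 := sum_pair a' x'.
pose b1 : dghom W1 _S N := dgcomp g (loc_hom S (sum_pr1 _ _)) +
  dgcomp (dgcomp f r') (loc_hom S (sum_pr2 _ _)).
have hb1 : h ~ dgcomp b1 (loc_hom S a1).
  rewrite /b1 /a1 compDl -!dgcompA -!loc_hom_comp sum_pr1K sum_pr2K.
  rewrite -[h](subrK (dgcomp g (loc_hom S a'))) addrC.
  apply: htpD; first exact: htp_refl.
  apply: htp_trans (htp_sym hd) _; exact: htp_compl.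
have DW1 : Dfb A W1.
  apply: (Dfb_sum nH); last exact: tame_Dfb.
  by apply: (Dfb_fib nH); exact: tame_Dfb.
(* The factorization has to pass through a tame module, so [W1] is replaced by a resolution. *)
have [W tW [e qe]] := tame_resolution DW1.
have [a2 ha2] := kproj_lift (tame_kproj tP) qe a1.
exists W; split=> //; last first.
  exists a2, (dgcomp b1 (loc_hom S e)).
  rewrite -dgcompA -loc_hom_comp; apply: htp_trans hb1 _; apply/htp_compl/loc_htp.
  exact: htp_sym.
pose g1 : dghom W1 Z := dgcomp (fib_out x) (sum_pr1 _ _).
exists Z, (dgcomp g1 e); split=> //; first exact: tame_Dfb.
have sq : dgcomp g1 e = dgcomp (dgid Z) (dgcomp g1 e) by rewrite comp1f.
apply: (sums_qis' (fib_map_qis sq qe)).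
(* The kernel of [W1 -> Z] is the sum of [Sigma^-1 Q] and [Q'], which belongs to [sums G]. *)
have [||||k qk] := @ses_fib _ (dgsum (dgshift (-1) Q) Q') _ _
  (sum_pair (dgcomp (fib_in x) (sum_pr1 _ _)) (sum_pr2 _ _)) g1.
- exact: dghom_ext.
- by move=> i [y1 y2] [z1 z2] /= [-> ->].
- by move=> i [[w y] z] /= ->; exists (y, z).
- by move=> i z; exists ((z, 0), 0).
by apply: (sums_qis qk); apply: sums_sum sQ'; exact: sums_shift.
Qed.

Lemma thick1_retract V : thick1 (Dfb AS) (loc_class G (S := S)) V ->
  exists2 Y, sums G Y & retract V Y _S.
Proof.
elim=> {V} [V _ [X GX ->]||V V' _ [Y sY rY] _ [Y' sY' rY']|n V _ [Y sY rY]|].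
- by exists X; [exact: sums_gen | exact: retract_refl].
- exists (dgzero A); first exact: sums_zero.
  by apply: (retract_hom (i := 0) (r := 0)); exact: zero_hom_eq.
- exists (dgsum Y Y'); first exact: sums_sum.
  exact: retract_trans (retract_sum rY rY') (retract_loc_sum S Y Y').
- exists (dgshift n Y); first exact: sums_shift.
  exact: retract_trans (retract_shift n rY) (retract_qis (loc_shift_qis S n Y)).
move=> V V' U _ _ [F iF] _ [Y sY rY]; exists Y => //.
apply: retract_trans rY; apply: retract_trans (retract_iso iF).1.
apply: (retract_hom (i := sum_in1 V V') (r := sum_pr1 V V')); exact: dghom_ext.
Qed.

(** Maps from K-projective modules to acyclic ones are null-homotopic, so a resolution of 0 serves
    as the intermediate module. *)
Lemma approx0 V : acyclic V -> approx 0 V.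
Proof.
move=> aV P tP f; have [W tW [e qe]] := tame_resolution (Dfb_zero A).
exists W; split=> //; first exact/(qis_acyclic qe)/acyclic_zero.
exists 0, 0; rewrite comp0f; apply: kproj_null => //.
exact: kproj_loc (tame_kproj tP).
Qed.

Lemma thick_approx n V : thick (Dfb AS) (loc_class G (S := S)) n V -> approx n V.
Proof.
elim: n V => [|[|n] IH] V.
- move=> [_ [F /retract_iso[rV _]]]; apply: approx_retract rV _.
  by apply: approx0; exact: acyclic_zero.
(* Level 1 is the extension step for the identity of [V], whose cone is acyclic. *)
- move=> /thick1_retract[Y sY rY]; apply: (approx_extend (f := dgid V) sY rY).
  by apply: approx0; exact: cone_id_acyclic.
move=> [_ [X' [X1 [X2 [_ /thick1_retract[Y sY rY] /IH aX2 [u [v [w]]]]]]]].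
move=> [M [N [f [a [b [c [[ia ib ic] _]]]]]]].
apply: (approx_retract (U := dgsum V X')).
  apply: (retract_hom (i := sum_in1 V X') (r := sum_pr1 V X')); exact: dghom_ext.
apply: approx_retract (retract_iso ib).1 _.
apply: (approx_extend (f := f) sY); first exact: retract_trans (retract_iso ia).2 rY.
exact: approx_retract (retract_iso ic).2 aX2.
Qed.

(** [approx] is applied to the localized resolution itself. One denominator [t] brings [b] down to
    [A], a second one [t'] makes the triangle over [X] commute up to homotopy. *)
Lemma thick_spread n X : Dfb A X -> thick (Dfb AS) (loc_class G (S := S)) n X _S ->
  exists s P W (e : dghom P X) (a : dghom P W) (x : dghom W X),
    [/\ mset S s, qis e, Dfb A P, Dfb A W & built G n W /\ dgcomp x a ~ dgcomp e (dgscale P s)].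
Proof.
move=> DX /thick_approx aX; have [P tP [e qe]] := tame_resolution DX.
have [W [tW bW [a [b hb]]]] := aX P tP (loc_hom S e).
have [t St [g hg]] := tame_lift tW DX b.
have [|t' St' h'] := tame_inj tP DX (g := dgcomp g a - dgcomp e (dgscale P t)).
  rewrite loc_homD loc_homN !loc_hom_comp loc_dgscale; apply/(proj1 (htp_sub _ _)).
  apply: htp_trans (htp_compr _ hg) _.
  rewrite -dgcompA -dgscale_nat dgcompA; apply: htp_compr; exact: htp_sym.
exists (t * t'), P, W, e, a, (dgcomp g (dgscale W t')); split=> //.
- exact: msetM.
- exact: tame_Dfb.
- exact: tame_Dfb.
split=> //; rewrite -dgcompA -dgscale_nat dgcompA dgscaleM dgcompA.
by apply/htp_sub; rewrite -compBl.
Qed.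

End Forward.

(** * Splitting off [X] and openness of the locus *)

Section Split.
Variables (A : dgring) (S : multset (ring0 A)) (P W X : dgmod A).
Variables (e : dghom P X) (a : dghom P W) (x : dghom W X) (s : ring0 A).
Hypotheses (Ss : mset S s) (qe : qis e) (xa : dgcomp x a ~ dgcomp e (dgscale P s)).

Lemma dgscale_conep t i k (c : k + 1 = i) y z :
  dgscale (cone a) t i (conep a c y z) = conep a c (dgscale W t i y) (dgscale P t k z).
Proof. by rewrite dgscale_cone /conep dgscale_gcast. Qed.

(* x o a is s times the quasi-isomorphism e, so that a splits once s is inverted. *)
Lemma split_qis : qis (loc_hom S (sum_pair x (cone_in a))).
Proof.
have [ei es] := (qisE e).1 qe.
have xaE i p : cyc p -> isbnd (x i (a i p) - dgscale X s i (e i p)).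
  by move=> cp; have := htp_bnd xa cp; rewrite !dgcompE (dgscale_hom e).
apply: loc_qis => [i w cw /sum_bnd[bx]|i [y c] /sum_cyc[cy]].
  rewrite (cone_inE a (subrK 1 i)) => /(conep_bnd _ _ erefl)[w1 [p [ew /eqP]]].
  rewrite eq_sym oppr_eq0 => /eqP/cycP cp.
  exists s => //; have /(isbndP erefl)[p2 hp2] : isbnd (dgscale P s i p).
    apply: ei; first exact: cyc_hom.
    rewrite (dgscale_hom e); apply: isbnd_subr (xaE _ _ cp) _.
    rewrite (_ : a i p = w - dif erefl w1); last by rewrite ew addrC addKr.
    by rewrite homB hom_dif; apply: isbndB => //; exact: isbnd_dif.
  rewrite ew homD -(dgscale_hom a) hp2 !hom_dif.
  by apply: isbndD; exact: isbnd_dif.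
have [w [p ->]] := coneP (subrK 1 i) c => /conep_cyc[cp hw].
have /(isbndP (subrK 1 i))[p2 hp2] : isbnd (dgscale P s _ p).
  apply: ei; first exact: cyc_hom.
  rewrite (dgscale_hom e); apply: isbnd_subr (xaE _ _ cp) _.
  rewrite -[a _ p]opprK -hw homN hom_dif; apply: isbndN; exact: isbnd_dif.
(* Since [s p = d p2], this is a cycle of [W] whose image in the cone is homologous to [s] times
   [(w, p)]. *)
pose w2 := dgscale W s i w + a i p2.
have cw2 : cyc w2.
  apply/(cycP (subrK 1 i)); rewrite difD -!hom_dif -hp2 hw homN (dgscale_hom a).
  exact: addNr.
have [|p' cp' hp'] := es _ (dgscale X s i y - x i w2).
  by apply: cycB; exact: cyc_hom.
(* One factor [s] goes into [w2]; the other turns the remaining error [e p'] in [X] into [x (a p')]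
   modulo boundaries. *)
exists (s * s); first exact: msetM.
exists (dgscale W s i w2 + a i p'); first by apply: cycD; exact: cyc_hom.
rewrite -[dgscale _ _ _ _ - _]/((dgscale X (s * s) i y - x i (dgscale W s i w2 + a i p'),
  dgscale (cone a) (s * s) i (conep a (subrK 1 i) w p) -
    cone_in a i (dgscale W s i w2 + a i p')) : dgsum X (cone a) i).
apply/sum_bnd; split.
  rewrite (_ : _ - _ = dgscale X s i (dgscale X s i y - x i w2 - e i p') -
      (x i (a i p') - dgscale X s i (e i p'))).
    by apply: isbndB; [exact: isbnd_scale | exact: xaE].
  by rewrite homD (dgscale_hom x) -dgscaleA 2!homB opprB addrA subrK opprD addrA.
rewrite -dgscaleA homD dgscale_hom opprD addrA -homB; apply: isbndB.
  apply: isbnd_scale; rewrite dgscale_conep (cone_inE a (subrK 1 i)) conepB.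
  apply/(conep_bnd _ _ erefl); exists 0, (- p2).
  by rewrite dif0 add0r homN difN opprK subr0 /w2 opprD addrA subrr add0r hp2.
rewrite (cone_inE a (subrK 1 i)); apply/(conep_bnd _ _ erefl); exists 0, p'.
by rewrite dif0 add0r (cyc_dif cp') oppr0.
Qed.

End Split.

Theorem corollary4p9 (A : dgring)
  (noethH0 : noetherian (H0 A))
  (fgH : gr_fin_gen (R := H0 A) (fun i => homology (dgself A) i))
  (noethA : gr_noetherian A)
  (n : nat) (X : dgmod A) (DX : Dfb A X)
  (G : dgmod A -> Prop) (DG : forall Y, G Y -> Dfb A Y) :
  open [set p : spec (H0 A) |
    thick (Dfb (dgring_at p)) (subcat_at p G) n (dgmod_at p X)].
Proof.
have DA := Dfb_self fgH.
pose T p := thick (Dfb (dgring_at p)) (subcat_at p G) n (dgmod_at p X).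
(* All [c] whose basic open set lies in the locus: they cut out its interior, so every [p] in the
   locus needs one such [c] outside [p]. The class of [s] is one. *)
exists [set c | forall q : spec (H0 A), ~ prime_set q c -> T q].
apply/seteqP; split=> p /=; last by move=> /existsNP[c /not_implyP[hc /hc]].
move=> Tp hp.
have [s [P [W [e [a [x [Ss qe DP DW [bW xa]]]]]]]] :=
  thick_spread (S := prime_cpl p) noethH0 DA DG DX Tp.
apply: (Ss); apply: hp => q Sq.
have Sq' : mset (prime_cpl q) s by [].
apply: (thick_loc (S := prime_cpl q) DG noethH0 DX (Dfb_cone noethH0 a DP DW) bW
  (q := dgcomp (sum_pair (loc_hom _ (sum_pr1 _ _)) (loc_hom _ (sum_pr2 _ _)))
    (loc_hom (prime_cpl q) (sum_pair x (cone_in a))))).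
by apply: qis_comp; [exact: loc_sum_qis | exact: split_qis xa].
Qed.
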